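(* Let $n\ge2$ and let $\Omega$ be a bounded Lipschitz domain in $\mathbb{R}^n$. Assume that $b\in L^{n,1}(\Omega;\mathbb{R}^n)$ and $c\in L^{\frac n2,1}(\Omega)\cap L^s(\Omega)$ for some $1<s<\frac32$. Then for any $\varepsilon>0$ there is a constant $C_\varepsilon=C(n,\Omega,b,c,\varepsilon)$ such that the following inequalities hold: (i) For all $u\in W^{1,n,1}(\Omega)$, $$\|ub\|_{n,1;\Omega}+\|cu\|_{W^{-1,n,1}(\Omega)}\le\varepsilon\|Du\|_{n,1;\Omega}+C_\varepsilon\|u\|_{n,1;\Omega}.$$ (ii) For all $v\in W^{1,\frac n{n-1},\infty}(\Omega)$, $$\|b\cdot Dv\|_{W^{-1,\frac n{n-1},\infty}(\Omega)}+\|cv\|_{W^{-1,\frac n{n-1},\infty}(\Omega)}\le\varepsilon\|Dv\|_{\frac n{n-1},\infty;\Omega}+C_\varepsilon\|v\|_{\frac n{n-1},\infty;\Omega}.$$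
   Context: Lorentz spaces: for a measurable $f$ on a measure space $(X,\mu)$, let $d_f(\alpha)=\mu(\{|f|>\alpha\})$ for $\alpha>0$ and $f^*(t)=\inf\{\alpha>0:d_f(\alpha)\le t\}$ for $t>0$. For $1\le p,q\le\infty$, $L^{p,q}(X)$ is the set of measurable $f$ with $\|f\|_{p,q;X}<\infty$, where $\|f\|_{p,q;X}=\left(\int_0^\infty[t^{1/p}f^*(t)]^q\frac{dt}{t}\right)^{1/q}$ if $q<\infty$ and $\|f\|_{p,\infty;X}=\sup_{t>0}t^{1/p}f^*(t)$. $L^{p,p}=L^p$. Sobolev-Lorentz spaces: for $1<p<\infty$, $1\le q\le\infty$, $W^{1,p,q}(\Omega)$ is the space of $u\in L^{p,q}(\Omega)$ whose first weak derivatives lie in $L^{p,q}(\Omega)$, with quasi-norm $\sum_{|\alpha|\le1}\|D^\alpha u\|_{p,q;\Omega}$. $\widehat W^{1,p,q}(\Omega)$ is the closure of $C_c^\infty(\Omega)$ in $W^{1,p,q}(\Omega)$, and $W^{-1,p,q}(\Omega)$ is the dual space of $\widehat W^{1,p',q'}(\Omega)$, where $p',q'$ are the Hölder conjugates. A locally integrable function $g$ is regarded as an element of $W^{-1,p,q}(\Omega)$ if the functional $\varphi\mapsto\int_\Omega g\varphi\,dx$ on $C_c^\infty(\Omega)$ is bounded in the norm of $W^{1,p',q'}(\Omega)$ (and hence extends continuously to $\widehat W^{1,p',q'}(\Omega)$). The notation $C_\varepsilon=C(\dots)$ means that the constant depends only on the listed objects. *)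

(* Defs.v *)
From HB Require Import structures.
From mathcomp Require Import all_boot all_order all_algebra.
From mathcomp Require Import all_classical all_reals all_analysis.

Set Implicit Arguments.
Unset Strict Implicit.
Unset Printing Implicit Defensive.
Import Order.TTheory GRing.Theory Num.Theory.
Import numFieldNormedType.Exports.
Local Open Scope classical_set_scope.
Local Open Scope ring_scope.

Definition measure_rV_display : measure_display -> measure_display.
Proof. exact. Qed.

(* 'rV[R]_n carries the sigma-algebra generated by the n coordinates, that is
   the Borel sets of R^n (as n.-tuple R does in the library). *)
Section measurable_rV.
Context {R : realType}.
Variable n : nat.

Let coors : 'I_n -> 'rV[R]_n -> R := fun i x => x ord0 i.

Let rV_set0 : g_sigma_preimage coors set0.
Proof. exact: sigma_algebra0. Qed.

Let rV_setC A : g_sigma_preimage coors A -> g_sigma_preimage coors (~` A).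
Proof. exact: sigma_algebraC. Qed.

Let rV_bigcup (F : (set 'rV[R]_n)^nat) :
  (forall i, g_sigma_preimage coors (F i)) ->
  g_sigma_preimage coors (\bigcup_i (F i)).
Proof. exact: sigma_algebra_bigcup. Qed.

HB.instance Definition _ := @isMeasurable.Build
  (measure_rV_display default_measure_display)
  'rV[R]_n (g_sigma_preimage coors) rV_set0 rV_setC rV_bigcup.

End measurable_rV.

Section lebesgue_rV.
Context {R : realType}.

Lemma measurable_coord n (i : 'I_n) :
  measurable_fun [set: 'rV[R]_n] (fun x => x ord0 i).
Proof.
move=> _ Y mY; rewrite setTI; apply: sub_sigma_algebra => /=.
rewrite -bigcup_seq/=; exists i => /=; first by rewrite mem_index_enum.
by exists Y => //; rewrite setTI.
Qed.

Lemma measurable_fun_rVP d (T : measurableType d) n (f : T -> 'rV[R]_n) :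
  measurable_fun [set: T] f <->
  forall i, measurable_fun [set: T] (fun x => f x ord0 i).
Proof.
split=> [mf i|mf].
  exact: (measurableT_comp (measurable_coord i) mf).
pose coors (i : 'I_n) (x : 'rV[R]_n) := x ord0 i.
suff H : g_sigma_preimage (fun i => coors i \o f) `<=` measurable.
  move: H; rewrite g_sigma_preimage_comp => H _ A mA.
  by apply: H; exists A.
apply: smallest_sub; first exact: sigma_algebra_measurable.
case: n => [|n] in f mf coors *; first by rewrite big_ord0.
rewrite -bigcup_mkord_ord; apply: bigcup_sub => i Ii.
by move=> A [B mB <-]; exact: mf.
Qed.

Definition cons_rV n (p : R * 'rV[R]_n) : 'rV[R]_n.+1 :=
  \row_i (if unlift ord0 i is Some j then p.2 ord0 j else p.1).

Definition behead_rV n (x : 'rV[R]_n.+1) : R * 'rV[R]_n :=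
  (x ord0 ord0, \row_(j < n) x ord0 (lift ord0 j)).

Lemma cons_rVK n : cancel (@cons_rV n) (@behead_rV n).
Proof.
move=> [t y]; congr pair; first by rewrite mxE unlift_none.
by apply/rowP => j; rewrite !mxE liftK.
Qed.

Lemma measurable_cons_rV n : measurable_fun [set: R * 'rV[R]_n] (@cons_rV n).
Proof.
apply/measurable_fun_rVP => i.
under eq_fun do rewrite mxE.
case: (unlift ord0 i) => [j|]; last exact: measurable_fst.
exact: (measurableT_comp (measurable_coord j) measurable_snd).
Qed.

Lemma measurable_behead_rV n :
  measurable_fun [set: 'rV[R]_n.+1] (@behead_rV n).
Proof.
apply: measurable_fun_pair; first exact: measurable_coord.
apply/measurable_fun_rVP => i /=.
under eq_fun do rewrite mxE.
exact: measurable_coord.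
Qed.

Section cons_measure.
Variables (n : nat) (mu : {sigma_finite_measure set 'rV[R]_n -> \bar R}).

Definition cons_measure : set 'rV[R]_n.+1 -> \bar R :=
  pushforward (@lebesgue_measure R \x mu)%E (@cons_rV n).

Let cons_measure0 : cons_measure set0 = 0%E.
Proof. by rewrite /cons_measure /pushforward preimage_set0 measure0. Qed.

Let cons_measure_ge0 A : (0 <= cons_measure A)%E.
Proof. by rewrite /cons_measure /pushforward measure_ge0. Qed.

Let measurable_preimage A : measurable A -> measurable (@cons_rV n @^-1` A).
Proof.
by move=> mA; rewrite -[X in measurable X]setTI; exact: measurable_cons_rV.
Qed.

Let cons_measure_additive : semi_sigma_additive cons_measure.
Proof.
move=> F mF tF mUF; rewrite /cons_measure /pushforward preimage_bigcup.
apply: measure_semi_sigma_additive.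
- by move=> k; exact: measurable_preimage.
- apply/trivIsetP => /= i j _ _ ij; rewrite -preimage_setI.
  by move/trivIsetP : tF => /(_ _ _ _ _ ij) ->//; rewrite preimage_set0.
- by rewrite -preimage_bigcup; exact: measurable_preimage.
Qed.

HB.instance Definition _ := isMeasure.Build _ _ _ cons_measure
  cons_measure0 cons_measure_ge0 cons_measure_additive.

Let cons_measure_sigma_finite : sigma_finite setT cons_measure.
Proof.
have /sigma_finiteP[F [TF ndF Foo]] : sigma_finite setT (@lebesgue_measure R).
  exact: sigma_finiteT.
have /sigma_finiteP[G [TG ndG Goo]] := sigma_finiteT mu.
exists (fun k => @behead_rV n @^-1` (F k `*` G k)).
  apply/esym; rewrite -subTset => x _.
  have [k _ Fk] : (\bigcup_k F k) (behead_rV x).1 by rewrite -TF.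
  have [l _ Gl] : (\bigcup_k G k) (behead_rV x).2 by rewrite -TG.
  exists (maxn k l) => //; split => /=.
  - by move: Fk; exact/subsetPset/ndF/leq_maxl.
  - by move: Gl; exact/subsetPset/ndG/leq_maxr.
move=> k; have [mF Fk] := Foo k; have [mG Gk] := Goo k; split.
  rewrite -[X in measurable X]setTI; apply: measurable_behead_rV => //.
  exact: measurableX.
rewrite /cons_measure /pushforward -comp_preimage.
rewrite (_ : _ \o _ = id) ?preimage_id; last first.
  by apply/funext => p /=; rewrite cons_rVK.
by rewrite product_measure1E// lte_mul_pinfty// ge0_fin_numE.
Qed.

HB.instance Definition _ := Measure_isSigmaFinite.Build _ _ _ cons_measure
  cons_measure_sigma_finite.

End cons_measure.

(* Lebesgue measure on R^n: the n-fold product of Lebesgue measure on R. *)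
Fixpoint lebesgue_rV n : {sigma_finite_measure set 'rV[R]_n -> \bar R} :=
  if n is m.+1 then cons_measure (lebesgue_rV m) else \d_(0 : 'rV[R]_0).

End lebesgue_rV.

Section lorentz.
Context d (T : measurableType d) (R : realType).
Variables (mu : {measure set T -> \bar R}) (X : set T).
Implicit Types (f : T -> R) (p q : \bar R) (s t : R).

Definition distribution_function f (a : R) : \bar R :=
  mu [set x | X x /\ a < `|f x|].

Definition rearrangement f t : \bar R :=
  ereal_inf [set a%:E | a in [set a : R | 0 < a /\
    (distribution_function f a <= t%:E)%E]].

(* Since fine +oo = 0 and 0^-1 = 0, the factor t `^ (fine p)^-1 is t^(1/p) for
   every p in [1, +oo], with 1/oo = 0. Only q in [1, +oo] is meaningful. *)
Definition lorentz_norm p q f : \bar R :=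
  (if q is s%:E then
    (\int[lebesgue_measure]_(t in `]0%R, +oo[)
      (((t `^ (fine p)^-1)%:E * rearrangement f t) `^ s * (t^-1)%:E)) `^ s^-1
  else
    ereal_sup [set (t `^ (fine p)^-1)%:E * rearrangement f t
              | t in `]0%R, +oo[])%E.

Definition lorentz p q f : Prop :=
  measurable_fun X f /\ (lorentz_norm p q f < +oo)%E.

Definition lebesgue_space p f : Prop :=
  measurable_fun X f /\ finite_norm mu p (f \_ X).

End lorentz.

Section euclidean.
Context {R : realType} {n : nat}.
Implicit Types (u v : 'rV[R]_n) (f : 'rV[R]_n -> R).

(* The library norm `|v| of a row vector is the sup norm. *)
Definition dotp u v : R := \sum_(i < n) u ord0 i * v ord0 i.

Definition enorm v : R := Num.sqrt (dotp v v).

Definition partial (i : 'I_n) f : 'rV[R]_n -> R :=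
  fun x => 'D_(delta_mx ord0 i) f x.

Definition gradient f : 'rV[R]_n -> 'rV[R]_n :=
  fun x => \row_i partial i f x.

Definition smooth f : Prop := forall s : seq 'I_n,
  continuous (foldr partial f s) /\
  forall x i, derivable (foldr partial f s) x (delta_mx ord0 i).

End euclidean.

Section sobolev_lorentz.
Context {R : realType} {n : nat}.
Variable Omega : set 'rV[R]_n.
Implicit Types (p q : \bar R) (f g u w phi : 'rV[R]_n -> R).
Implicit Types (F Du Dw : 'rV[R]_n -> 'rV[R]_n).

Local Notation mu := (lebesgue_rV n).

(* Near each boundary point, Omega is the part lying above a Lipschitz graph
   over the hyperplane orthogonal to some unit vector e (the last axis of a
   rotated coordinate system). *)
Definition lipschitz_boundary : Prop :=
  forall x0, (closure Omega `\` Omega°) x0 ->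
  exists (r : R) (e : 'rV[R]_n) (gamma : 'rV[R]_n -> R),
    [/\ 0 < r, enorm e = 1,
        [lipschitz gamma y | y in [set y | dotp e y = 0]] &
        forall x, enorm (x - x0) < r ->
          Omega x <-> gamma (x - dotp e x *: e) < dotp e x].

Definition bounded_lipschitz_domain : Prop :=
  [/\ Omega !=set0, open Omega, connected Omega, bounded_set Omega &
      lipschitz_boundary].

Definition test_function phi : Prop :=
  [/\ smooth phi, compact (closure [set x | phi x != 0]) &
      closure [set x | phi x != 0] `<=` Omega].

Definition loc_integrable f : Prop :=
  measurable_fun Omega f /\
  forall K, compact K -> K `<=` Omega -> mu.-integrable K (EFin \o f).

Definition norm_L p q f : \bar R := lorentz_norm mu Omega p q f.

Definition vnorm_L p q F : \bar R := norm_L p q (fun x => enorm (F x)).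

Definition vlorentz p q F : Prop :=
  measurable_fun Omega F /\ (vnorm_L p q F < +oo)%E.

Definition weak_partial (i : 'I_n) u g : Prop :=
  [/\ loc_integrable u, loc_integrable g &
      forall phi, test_function phi ->
        \int[mu]_(x in Omega) (u x * partial i phi x) =
        - \int[mu]_(x in Omega) (g x * phi x)].

(* Weak derivatives being unique only up to null sets, a Sobolev function u is
   handled together with a representative Du of its weak gradient. *)
Definition sobolev p q u Du : Prop :=
  lorentz mu Omega p q u /\
  forall i, weak_partial i u (fun x => Du x ord0 i) /\
            lorentz mu Omega p q (fun x => Du x ord0 i).

Definition norm_W p q u Du : \bar R :=
  (norm_L p q u + \sum_(i < n) norm_L p q (fun x => Du x ord0 i))%E.

Definition sobolev0 p q w Dw : Prop :=
  sobolev p q w Dw /\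
  forall delta : R, 0 < delta -> exists2 phi, test_function phi &
    (norm_W p q (fun x => w x - phi x)%R (fun x => Dw x - gradient phi x)%R
     < delta%:E)%E.

Definition bounded_functional p q (M : R) (L : ('rV[R]_n -> R) -> R) : Prop :=
  (forall (a : R) u Du w Dw, sobolev0 p q u Du -> sobolev0 p q w Dw ->
    L (fun x => a * u x + w x) = a * L u + L w) /\
  (forall w Dw, sobolev0 p q w Dw ->
    (`|L w|%:E <= M%:E * norm_W p q w Dw)%E).

(* The norm of g in W^{-1,p,q}(Omega), the dual of sobolev0 p' q': it is +oo
   unless g is locally integrable and phi |-> \int g phi extends from the test
   functions to a bounded linear functional L, in which case it is the
   operator norm of L. *)
Definition norm_Wm1 p q g : \bar R :=
  ereal_inf [set M%:E | M in [set M : R | [/\ 0 <= M, loc_integrable g &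
    exists2 L : ('rV[R]_n -> R) -> R,
      bounded_functional (hoelder_conjugate p) (hoelder_conjugate q) M L &
      forall phi, test_function phi ->
        L phi = \int[mu]_(x in Omega) (g x * phi x)]]].

End sobolev_lorentz.

(* Main.v *)
Require Import Defs.
From mathcomp Require Import all_boot all_order all_algebra.
From mathcomp Require Import all_classical all_reals all_analysis.
From mathcomp Require Import measurable_realfun ring lra.

(** The Lorentz norm is ||f||_{p,1} = p * int_0^oo d_f(a)^(1/p) da, while
    g in L^{p',oo} amounts to int_E |g| <= A mu(E)^(1/p) for every E; the layer
    cake formula then pairs the two. Near each point of the closure Omega
    contains a cone, and mollifiers supported in this cone at the scales
    h lam^k telescope: the difference of two consecutive ones is the divergence
    of a test field of size r^(1-n). Hence an average of u is bounded by a sum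
    of averages of Du, which embeds W^{1,n,1} in L^oo, and W^{1,n',oo} in a
    weak space of exponent sigma = 2/n if n > 2 and sigma < 1 arbitrary if
    n = 2; the latter is where c in L^s is used. The factor epsilon comes from
    splitting b and c into a part of small norm and a bounded part; for b.Dv
    the second part is taken smooth, so that the derivative can be moved away
    from v. *)

Set Implicit Arguments.
Unset Strict Implicit.
Unset Printing Implicit Defensive.
Import Order.TTheory GRing.Theory Num.Theory.
Import numFieldNormedType.Exports.
Local Open Scope classical_set_scope.
Local Open Scope ring_scope.

(** * Distribution functions and Lorentz norms *)

(** Almost every estimate is stated through integrals over arbitrary measurable sets E. By Tonelli
    an average of u over cubes, integrated over E, becomes an integral against the measure of E
    intersected with a cube, which is at most mu(E) and at most (2r)^n. Summing the smaller of these
    two bounds over the scales produces powers of mu(E). The same formulation lets the averages pass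
    to u by L^1 density alone.

    The mollifiers point into the cone because a weak derivative may only be tested with functions
    supported in Omega; u itself is never extended.

    Dimension 2 is the obstacle in the weak embedding. Up to constants and the norm A of Du, the
    scale r contributes at most mu(E) r^(2-n) and at most mu(E)^(1/n) r. For n > 2 both sums are
    geometric around r = mu(E)^(1/n). For n = 2 the first bound does not depend on r, all scales
    above mu(E)^(1/2) count equally, and the resulting logarithm is absorbed by lowering the
    exponent of mu(E) below 1. Then c must have a finite layer norm with an exponent below 1, which
    L^{1,1} does not provide and L^s does. *)

Section layer_cake.
Context d (T : measurableType d) (R : realType).
Variables (mu : {sigma_finite_measure set T -> \bar R}) (D : set T).
Hypothesis mD : measurable D.
Implicit Types (f : T -> R) (g : T -> \bar R).
Local Notation leb := (@lebesgue_measure R).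

Definition suplevel f (a : R) : set T := [set x | D x /\ a < `|f x|].

Lemma measurable_suplevel f a : measurable_fun D f -> measurable (suplevel f a).
Proof.
move=> mf; rewrite (_ : suplevel f a = D `&` (Num.norm \o f) @^-1` `]a, +oo[).
  exact: (measurableT_comp (@normr_measurable R setT) mf).
by apply/seteqP; split => x /=; rewrite in_itv/= andbT.
Qed.

(** Tonelli for the indicator of {0 < a < |f(x)|} times g, everything being extended by zero outside
    D. The weight is general because three are used: 1, a second function to be paired with f, and a
    power of t when f is itself a rearrangement. *)
Lemma layer_cake_weight f g : measurable_fun D f -> measurable_fun D g ->
  (forall x, D x -> 0 <= g x)%E ->
  (\int[mu]_(x in D) (`|f x|%:E * g x) =
   \int[leb]_(a in `]0%R, +oo[) \int[mu]_(x in suplevel f a) g x)%E.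
Proof.
move=> mf mg g0.
pose h := (fun x => `|f x|) \_ D; pose g' := g \_ D.
have mh : measurable_fun setT h.
  apply/(measurable_restrictT _ mD).
  exact: (measurableT_comp (@normr_measurable R setT) mf).
have mg' : measurable_fun setT g' by exact/(measurable_restrictT _ mD).
have g'0 x : (0 <= g' x)%E.
  by rewrite /g' patchE; case: ifPn => // /set_mem; exact: g0.
pose S := [set z : T * R | 0 < z.2 /\ z.2 < h z.1].
have mS : measurable S.
  rewrite (_ : S = (snd @^-1` `]0, +oo[) `&`
      ((fun z : T * R => h z.1 - z.2) @^-1` `]0, +oo[)); last first.
    apply/seteqP; split => -[x a] /=; rewrite !in_itv/= !andbT subr_gt0.
      by move=> [].
    by move=> [].
  apply: measurableI; rewrite -[X in measurable X]setTI.
    exact: measurable_snd.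
  have : measurable_fun setT (fun z : T * R => h z.1 - z.2).
    apply: measurable_funB; last exact: measurable_snd.
    exact: (measurableT_comp mh measurable_fst).
  by apply.
pose F (z : T * R) : \bar R := ((\1_S z)%:E * g' z.1)%E.
have mF : measurable_fun setT F.
  apply: emeasurable_funM.
    by apply/measurable_EFinP; exact: measurable_indic.
  exact: (measurableT_comp mg' measurable_fst).
have F0 z : (0 <= F z)%E by apply: mule_ge0 => //; rewrite lee_fin.
have := @fubini_tonelli _ _ _ _ _ mu leb F mF F0.
rewrite [X in X = _ -> _](_ : _ = (\int[mu]_(x in D) (`|f x|%:E * g x))%E).
  move=> ->; rewrite [RHS]integral_mkcond; apply: eq_integral => a _.
  rewrite patchE /fubini_G /F; case: (ltP 0 a) => a0; last first.
    rewrite memNset; last by rewrite /= in_itv/= andbT ltNge a0.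
    apply: integral0_eq => x _; rewrite indicE memNset ?mul0e// => -[]/=.
    by rewrite ltNge a0.
  rewrite mem_set; last by rewrite /= in_itv/= a0.
  rewrite [RHS]integral_mkcond; apply: eq_integral => x _.
  rewrite indicE [RHS]patchE /= /g' patchE.
  case: (boolP (x \in D)) => xD; last first.
    rewrite mule0 memNset//; move/negP : xD => + [].
    by move=> /[swap] /mem_set.
  rewrite (_ : ((x, a) \in S) = (x \in suplevel f a)).
    by case: ifPn; rewrite ?mul1e ?mul0e.
  have hx : h x = `|f x| by rewrite /h patchE xD.
  apply/idP/idP => /set_mem; rewrite /S/= ?hx => -[? ?]; apply/mem_set => //=; rewrite ?hx//.
  by split => //; exact/set_mem.
rewrite [RHS]integral_mkcond; apply: eq_integral => x _.
rewrite /fubini_F /F patchE /g' /h.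
case: ifPn => xD.
  transitivity (\int[leb]_(a in `]0%R, `|f x|%R[) cst (g x) a)%E; last first.
    rewrite integral_cst//= lebesgue_measure_itv/= lte_fin; case: ltP => fx.
      by rewrite sube0 muleC.
    by rewrite mule0 (_ : `|f x| = 0) ?mul0e//; apply/le_anti; rewrite fx normr_ge0.
  rewrite [RHS]integral_mkcond; apply: eq_integral => a _; rewrite indicE !patchE xD.
  have hx : h x = `|f x| by rewrite /h patchE xD.
  rewrite (_ : ((x, a) \in S) = (a \in `]0%R, `|f x|[%classic)).
    by case: ifPn; rewrite ?mul1e ?mul0e.
  apply/idP/idP => /set_mem; rewrite /S/= ?hx => H; apply/mem_set => /=;
   move: H; rewrite /= in_itv/= ?hx; first by move=> [-> ->].
  by move/andP.
by rewrite integral0_eq// => a _; rewrite /= patchE (negbTE xD) mule0.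
Qed.

End layer_cake.

(** * Integrals of powers near infinity and near the origin *)

Section power_integrals.
Context {R : realType}.
Implicit Types (q s x m t : R).
Local Notation leb := (@lebesgue_measure R).

Lemma continuous_powR s x : 0 < x -> {for x, continuous (@powR R ^~ s)}.
Proof.
move=> x0; apply: differentiable_continuous; apply/derivable1_diffP.
by apply: derivable_powR; rewrite in_itv/= x0.
Qed.

Lemma powR_cvg_pinfty s : 0 < s -> x `^ (- s) @[x --> +oo] --> (0 : R).
Proof.
move=> s0; apply/cvgrPdist_lt => e e0; near=> x.
have x0 : 0 < x by near: x; apply: nbhs_pinfty_gt; rewrite num_real.
rewrite sub0r normrN ger0_norm ?powR_ge0// powRN.
rewrite -[ltRHS]invrK ltf_pV2 ?posrE ?powR_gt0 ?invr_gt0//.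
rewrite -[ltLHS]powRr1 ?invr_ge0 ?(ltW e0)// -[X in _ `^ X](@mulVf _ s) ?gt_eqF//.
rewrite powRrM gt0_ltr_powR ?nnegrE ?powR_ge0 ?(ltW x0)//.
Unshelve. all: by end_near. Qed.

Lemma integral_powR_tail q t : 0 < t -> 1 < q ->
  (\int[leb]_(a in `[t, +oo[) (a `^ (- q))%:E = (t `^ (1 - q) / (q - 1))%:E)%E.
Proof.
move=> t0 q1; have q10 : q - 1 != 0 by rewrite subr_eq0 gt_eqF.
have pos a : a \in `]t, +oo[ -> 0 < a.
  by rewrite in_itv/= andbT; exact: lt_trans.
pose F a := - (q - 1)^-1 * a `^ (1 - q).
have dF (a : R) : 0 < a -> is_derive a 1 F (a `^ (- q)).
  move=> a0; have := is_deriveZ (- (q - 1)^-1) (is_derive1_powR (1 - q) a0).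
  rewrite (_ : 1 - q - 1 = - q); last by ring.
  by rewrite (_ : _ *: _ = a `^ (- q))// /GRing.scale/=; field.
rewrite (@ge0_continuous_FTC2y _ _ F t 0).
- by rewrite sub0e -EFinN; congr EFin; rewrite /F; field.
- by move=> x _; rewrite powR_ge0.
- apply: continuous_in_subspaceT => x /set_mem/=; rewrite in_itv/= andbT => tx.
  by apply: continuous_powR; exact: lt_le_trans tx.
- rewrite -[X in _ --> X](mulr0 (- (q - 1)^-1)); apply: cvgMr.
  by rewrite -opprB; apply: powR_cvg_pinfty; rewrite subr_gt0.
- by move=> x tx; have [] := dF x (lt_trans t0 tx).
- apply: cvg_at_right_filter; apply: differentiable_continuous.
  by apply/derivable1_diffP; have [] := dF t t0.
- by move=> x /pos x0; rewrite derive1E; have [_ ->] := dF x x0.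
Qed.

Lemma integral_powR_head s m : 0 < s -> 0 < m ->
  (\int[leb]_(t in `]0%R, m[) (t `^ (s - 1))%:E = (m `^ s / s)%:E)%E.
Proof.
move=> s0 m0.
have mf (D : set R) : measurable D -> measurable_fun D (fun t => (t `^ (s - 1))%:E).
  by move=> _; apply/measurable_EFinP; apply: measurable_funTS; exact: measurable_powR.
rewrite integral_itv_bndo_bndc; last exact: mf.
pose F k : set R := `[m / k.+2%:R, m]%classic.
have Fm k : m / k.+2%:R < m.
  by rewrite ltr_pdivrMr// ltr_pMr// ltr1n.
have F0 k : 0 < m / k.+2%:R by rewrite divr_gt0.
have UF : `]0%R, m]%classic = \bigcup_k F k.
  apply/seteqP; split => [x|x [k _]]; rewrite /F/= !in_itv/=; last first.
    by move=> /andP[kx ->]; rewrite (lt_le_trans _ kx).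
  move=> /andP[x0 xm]; have [k _ /= kx] := near_infty_natSinv_lt (PosNum (divr_gt0 x0 m0)).
  exists k => //; rewrite /F/= in_itv/= xm andbT.
  have := kx k.+1 (leqnSn k); rewrite /= ltr_pdivlMr// mulrC => /ltW //.
have intF k : (\int[leb]_(t in F k) (t `^ (s - 1))%:E =
    (s^-1 * m `^ s)%:E - (s^-1 * (m / k.+2%:R) `^ s)%:E)%E.
  pose G t := s^-1 * t `^ s.
  have dG (t : R) : 0 < t -> is_derive t 1 G (t `^ (s - 1)).
    move=> t0; have := is_deriveZ s^-1 (is_derive1_powR s t0).
    by rewrite /GRing.scale/= mulKf ?gt_eqF.
  have cG t : 0 < t -> {for t, continuous G}.
    move=> t0; apply: differentiable_continuous.
    by apply/derivable1_diffP; have [] := dG t t0.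
  apply: (@continuous_FTC2 _ _ G) => //.
  - apply: continuous_in_subspaceT => x /set_mem/=; rewrite in_itv/= => /andP[kx _].
    by apply: continuous_powR; rewrite (lt_le_trans _ kx).
  - split.
    + move=> x; rewrite in_itv/= => /andP[kx _].
      by have [] := dG x (lt_trans (F0 k) kx).
    + exact/cvg_at_right_filter/cG.
    + exact/cvg_at_left_filter/cG.
  - move=> x; rewrite in_itv/= => /andP[kx _].
    by rewrite derive1E; have [_ ->] := dG x (lt_trans (F0 k) kx).
have mF k : measurable (F k) by exact: measurable_itv.
have ndF : {homo F : n0 m0 / (n0 <= m0)%N >-> (n0 <= m0)%O}.
  move=> i j ij; apply/subsetPset => x; rewrite /F/= !in_itv/= => /andP[ix ->].
  rewrite andbT (le_trans _ ix)// ler_pM2l// lef_pV2 ?posrE// ler_nat.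
  by rewrite !ltnS.
have H : (\int[leb]_(t in F k) (t `^ (s - 1))%:E)%E @[k --> \oo] -->
    (\int[leb]_(t in \bigcup_k F k) (t `^ (s - 1))%:E)%E.
  apply: ge0_nondecreasing_set_cvg_integral => //.
  - by move=> k; exact: mf.
  - by move=> k x _; rewrite lee_fin powR_ge0.
rewrite UF; apply: (cvg_unique _ H) => //.
rewrite (funext intF : (fun k => \int[leb]_(t in F k) (t `^ (s - 1))%:E)%E = _).
rewrite (_ : (m `^ s / s)%:E = ((s^-1 * m `^ s)%:E - 0)%E); last by rewrite sube0 mulrC.
apply: cvgeB => //; first exact: cvg_cst.
apply: cvg_EFin; first by near=> k.
rewrite -[X in _ --> X](mulr0 s^-1); apply: cvgMr.
have /cvg_at_rightP := powR_cvg0 s0; apply; split=> //.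
rewrite -[X in _ --> X](mulr0 m); apply: cvgMr.
by have := @cvg_harmonic R; rewrite -cvg_shiftS.
Unshelve. all: by end_near. Qed.

End power_integrals.

Lemma cvge0_lt (R : realType) (u : nat -> \bar R) (e : R) :
  u k @[k --> \oo] --> 0%E -> 0 < e -> exists k, (u k < e%:E)%E.
Proof.
move=> /fine_cvgP[ufin u0] e0.
have [k _ H] : \forall k \near \oo, (u k < e%:E)%E.
  near=> k; rewrite -[u k]fineK; last by near: k.
  by rewrite lte_fin; near: k; exact: (cvgr_lt _ u0 _ e0).
by exists k; exact: (H k (leqnn k)).
Unshelve. all: by end_near. Qed.

(** * Layer norms: pairing, quasi-triangle inequality, weak type, truncation *)

Section layer_norm.
Context d (T : measurableType d) (R : realType).
Variables (mu : {sigma_finite_measure set T -> \bar R}) (D : set T).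
Hypothesis mD : measurable D.
Hypothesis finD : (mu D < +oo)%E.
Implicit Types (f g h : T -> R) (s : R).
Local Notation leb := (@lebesgue_measure R).

(** The sets {phi > a} are intervals. *)
Lemma nonincreasing_emeasurable (phi : R -> \bar R) :
  (forall a b, a <= b -> (phi b <= phi a)%E) -> measurable_fun setT phi.
Proof.
move=> nphi; apply: (measurability _ (ErealGenOInfty.measurableE R)).
move=> /= _ [_ [a ->]] <-; rewrite setTI; apply: is_interval_measurable => s t/=.
rewrite !in_itv/= !andbT => _ ft u /andP[_ ut].
by rewrite in_itv/= andbT (lt_le_trans ft)// nphi.
Qed.

Lemma le_suplevel f a b : a <= b -> suplevel D f b `<=` suplevel D f a.
Proof. by move=> ab x [Dx bx]; split=> //; exact: le_lt_trans bx. Qed.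

Lemma subset_suplevel f a : suplevel D f a `<=` D.
Proof. by move=> x []. Qed.

Lemma poweR_mono s (x y : \bar R) : 0 <= s -> (0 <= x)%E -> (x <= y)%E ->
  (x `^ s <= y `^ s)%E.
Proof.
move=> s0 x0 xy; apply: gt0_ler_poweR => //; rewrite in_itv/= leey andbT//.
exact: le_trans xy.
Qed.

(* Up to the factor 1/s this is the Lorentz norm of L^{1/s,1}; unlike the latter
   it needs no rearrangement. *)
Definition layer_norm s f : \bar R :=
  (\int[leb]_(a in `]0%R, +oo[) (mu (suplevel D f a)) `^ s)%E.

Lemma measure_suplevel_le f a b : measurable_fun D f -> a <= b ->
  (mu (suplevel D f b) <= mu (suplevel D f a))%E.
Proof.
move=> mf ab; apply: le_measure; rewrite ?inE; try exact: measurable_suplevel.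
exact: le_suplevel.
Qed.

Lemma measure_suplevel_lty f a : measurable_fun D f -> (mu (suplevel D f a) < +oo)%E.
Proof.
move=> mf; apply: (le_lt_trans _ finD); apply: le_measure; rewrite ?inE//.
  exact: measurable_suplevel.
exact: subset_suplevel.
Qed.

Lemma measurable_layer s f (A : set R) : 0 <= s -> measurable_fun D f ->
  measurable_fun A (fun a => (mu (suplevel D f a)) `^ s)%E.
Proof.
move=> s0 mf; apply: measurable_funTS; apply: nonincreasing_emeasurable => a b ab.
by apply: poweR_mono => //; exact: measure_suplevel_le.
Qed.

Lemma layer_norm_ge0 s f : (0 <= layer_norm s f)%E.
Proof. by apply: integral_ge0 => a _; exact: poweR_ge0. Qed.

Lemma le_layer_norm s f g : 0 <= s -> measurable_fun D f -> measurable_fun D g ->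
  (forall a, 0 < a -> (mu (suplevel D f a) <= mu (suplevel D g a))%E) ->
  (layer_norm s f <= layer_norm s g)%E.
Proof.
move=> s0 mf mg fg; apply: ge0_le_integral => //.
- by move=> *; exact: poweR_ge0.
- exact: measurable_layer.
- exact: measurable_layer.
- move=> a; rewrite /= in_itv/= andbT => a0; apply: poweR_mono => //; exact: fg.
Qed.

Lemma le_layer_norm_norm s f g : 0 <= s -> measurable_fun D f -> measurable_fun D g ->
  (forall x, D x -> `|f x| <= `|g x|) -> (layer_norm s f <= layer_norm s g)%E.
Proof.
move=> s0 mf mg fg; apply: le_layer_norm => // a a0.
apply: le_measure; rewrite ?inE; try exact: measurable_suplevel.
by move=> x [Dx ax]; split=> //; apply: lt_le_trans (fg _ Dx).
Qed.

Lemma integral_layer f : measurable_fun D f ->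
  (\int[mu]_(x in D) `|f x|%:E = layer_norm 1 f)%E.
Proof.
move=> mf; transitivity (\int[mu]_(x in D) (`|f x|%:E * cst 1 x))%E.
  by apply: eq_integral => x _; rewrite mule1.
rewrite layer_cake_weight//.
apply: eq_integral => a _.
by rewrite integral_cst ?mul1e ?poweRe1//; exact: measurable_suplevel.
Qed.

(* For 0 < s < 1 this is membership in the Marcinkiewicz space L^{1/(1-s),oo},
   and for s = 1 it says |g| <= A almost everywhere. *)
Definition avg_bounded s (A : R) g := forall F, measurable F -> F `<=` D ->
  (\int[mu]_(x in F) `|g x|%:E <= A%:E * (mu F) `^ s)%E.

(** The Hölder inequality between L^{1/s,1} and its dual, without rearrangements: the layer cake
    formula with weight |g| leaves the integral of |g| over each level set of f, which [avg_bounded]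
    controls by a power of the measure of that set. *)
Lemma avg_bounded_integral_layer s A f g : 0 <= s -> 0 <= A ->
  measurable_fun D f -> measurable_fun D g -> avg_bounded s A g ->
  (\int[mu]_(x in D) (`|f x| * `|g x|)%:E <= A%:E * layer_norm s f)%E.
Proof.
move=> s0 A0 mf mg gA; under eq_integral do rewrite EFinM.
have mg' : measurable_fun D (fun x => `|g x|%:E).
  apply/measurable_EFinP; exact: (measurableT_comp (@normr_measurable R setT) mg).
rewrite (@layer_cake_weight _ _ _ _ _ mD _ (fun x => `|g x|%:E))//.
rewrite -ge0_integralZl//; last 2 first.
  exact: measurable_layer.
  by move=> a _; exact: poweR_ge0.
apply: ge0_le_integral => //.
- by move=> *; apply: integral_ge0 => *; rewrite lee_fin.
- apply: measurable_funTS; apply: nonincreasing_emeasurable => a b ab.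
  apply: ge0_subset_integral; try exact: measurable_suplevel.
  + by apply: measurable_funS mg' => //; exact: subset_suplevel.
  + by move=> *; rewrite lee_fin.
  + exact: le_suplevel.
- by apply: emeasurable_funM => //; exact: measurable_layer.
- by move=> a _; apply: gA; [exact: measurable_suplevel|exact: subset_suplevel].
Qed.

(** Each of the fractions x/(x+y) and y/(x+y) lies in [0,1], hence is at most its power s; the two
    fractions add up to 1. *)
Lemma powR_subadd s (x y : R) : 0 < s -> s <= 1 -> 0 <= x -> 0 <= y ->
  (x + y) `^ s <= x `^ s + y `^ s.
Proof.
move=> s0 s1 x0 y0; have [->|xy0] := eqVneq (x + y) 0.
  by rewrite powR0 ?gt_eqF// addr_ge0// powR_ge0.
have {}xy0 : 0 < x + y by rewrite lt_def xy0 addr_ge0.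
have key z : 0 <= z -> z <= x + y -> z / (x + y) * (x + y) `^ s <= z `^ s.
  move=> z0 zxy; rewrite -[X in _ <= X `^ _](divfK (lt0r_neq0 xy0)).
  rewrite powRM ?divr_ge0 ?(ltW xy0)// ler_wpM2r ?powR_ge0//.
  have [->|zN0] := eqVneq z 0; first by rewrite mul0r powR_ge0.
  apply: ger1_powR => //; rewrite ler_pdivrMr// mul1r zxy andbT.
  by rewrite divr_gt0// lt_def zN0.
rewrite (le_trans _ (lerD (key x _ _) (key y _ _)))// ?lerDl ?lerDr//.
by rewrite -mulrDl -mulrDl divff ?gt_eqF// mul1r.
Qed.

Lemma poweR_subadd s (x y : \bar R) : 0 < s -> s <= 1 -> (0 <= x)%E -> (0 <= y)%E ->
  ((x + y) `^ s <= x `^ s + y `^ s)%E.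
Proof.
move=> s0 s1; case: x => [x| |]//; case: y => [y| |]//= x0 y0.
- by rewrite -EFinD lee_fin powR_subadd// -lee_fin.
- by rewrite gt_eqF.
- by rewrite gt_eqF.
- by rewrite gt_eqF.
Qed.

(** The image of Lebesgue measure under a -> a/c, rescaled by 1/c, has the right value on half-open
    intervals, so it is Lebesgue measure by uniqueness. *)
Lemma integral_dilation (c : R) (phi : R -> \bar R) : 0 < c ->
  measurable_fun setT phi -> (forall a, (0 <= phi a)%E) ->
  (\int[leb]_(a in `]0%R, +oo[) phi (a / c)%R =
   c%:E * \int[leb]_(a in `]0%R, +oo[) phi a)%E.
Proof.
move=> c0 mphi phi0.
pose dil : measurableTypeR R -> measurableTypeR R := fun a => a / c.
have mdil : measurable_fun setT dil.
  by apply: (@mulrr_measurable R setT c^-1).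
pose mdilf : {mfun measurableTypeR R >-> measurableTypeR R} := mfun_Sub (mem_set mdil).
have c1 : 0 <= c^-1 by rewrite invr_ge0 ltW.
have E A : measurable A ->
    leb A = mscale (NngNum c1) (pushforward leb mdilf) A.
  apply: lebesgue_measure_unique => //= _ [[a b]] _ <-.
  rewrite /mscale /pushforward/=.
  rewrite [X in (_ = _ * lebesgue_measure X)%E](_ : _ = `]a * c, b * c]%classic); last first.
    by apply/seteqP; split => x /=; rewrite /mdilf/= /dil !in_itv/= ltr_pdivlMr// ler_pdivrMr.
  rewrite !lebesgue_measure_itv/= !lte_fin ltr_pM2r//; case: ifPn => _; last by rewrite mule0.
  by rewrite -!EFinB -EFinM; congr EFin; rewrite -mulrBl mulrC mulfK ?gt_eqF.
rewrite (@eq_measure_integral _ (measurableTypeR R) _ _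
  (mscale (NngNum c1) (pushforward leb mdilf)) leb phi); last first.
  by move=> A mA _; exact: E.
rewrite ge0_integral_mscale//; last first.
  by move=> ?; exact: measurable_funTS.
rewrite ge0_integral_pushforward//; last by move=> ?; exact: measurable_funTS.
rewrite muleA -EFinM /= divff ?gt_eqF// mul1e.
rewrite (_ : mdilf @^-1` _ = `]0%R, +oo[%classic)//.
by apply/seteqP; split => x /=; rewrite /dil !in_itv/= !andbT pmulr_lgt0 ?invr_gt0.
Qed.

Lemma ge0_integral_ray_split (phi : R -> \bar R) (t : R) : 0 < t ->
  measurable_fun setT phi -> (forall a, (0 <= phi a)%E) ->
  (\int[leb]_(a in `]0%R, +oo[) phi a =
   \int[leb]_(a in `]0%R, t[) phi a + \int[leb]_(a in `[t, +oo[) phi a)%E.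
Proof.
move=> t0 mphi phi0.
have -> : `]0, +oo[%classic = `]0, t[%classic `|` `[t, +oo[%classic.
  by rewrite -itv_bndbnd_setU// bnd_simp ltW.
rewrite ge0_integral_setU//; first by exact: measurable_funTS.
apply/disj_setPS => x []/=; rewrite !in_itv/= andbT => /andP[_ xt].
by rewrite leNgt xt.
Qed.

(** Subadditivity of x^s for s <= 1 splits the integrand, and the dilations by a and b come out as
    factors. This is where s <= 1 enters the quasi-triangle inequality. *)
Lemma layer_norm_split s (a b : R) f g h : 0 < s -> s <= 1 -> 0 < a -> 0 < b ->
  measurable_fun D f -> measurable_fun D g -> measurable_fun D h ->
  (forall t, 0 < t -> (mu (suplevel D h t) <=
     mu (suplevel D f (t / a)) + mu (suplevel D g (t / b)))%E) ->
  (layer_norm s h <= a%:E * layer_norm s f + b%:E * layer_norm s g)%E.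
Proof.
move=> s0 s1 a0 b0 mf mg mh hfg; have s0' := ltW s0.
have mN (c : R) (k : T -> R) : 0 < c -> measurable_fun D k ->
    measurable_fun setT (fun t : R => (mu (suplevel D k (t / c))) `^ s)%E.
  move=> c0 mk; apply: nonincreasing_emeasurable => x y xy.
  by apply: poweR_mono => //; apply: measure_suplevel_le => //; rewrite ler_pM2r ?invr_gt0.
rewrite -(@integral_dilation a (fun t : R => (mu (suplevel D f t)) `^ s)%E)//; last 2 first.
- exact: measurable_layer.
- by move=> ?; exact: poweR_ge0.
rewrite -(@integral_dilation b (fun t : R => (mu (suplevel D g t)) `^ s)%E)//; last 2 first.
- exact: measurable_layer.
- by move=> ?; exact: poweR_ge0.
rewrite -ge0_integralD//; last 4 first.
- by move=> *; exact: poweR_ge0.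
- by apply: measurable_funTS; exact: mN.
- by move=> *; exact: poweR_ge0.
- by apply: measurable_funTS; exact: mN.
apply: ge0_le_integral => //.
- by move=> *; exact: poweR_ge0.
- exact: measurable_layer.
- by apply: emeasurable_funD; apply: measurable_funTS; exact: mN.
- move=> t; rewrite /= in_itv/= andbT => t0.
  apply: le_trans (poweR_subadd s0 s1 _ _) => //.
  by apply: poweR_mono => //; exact: hfg.
Qed.

Lemma layer_normZ s (c : R) f : 0 < s -> s <= 1 -> 0 < c -> measurable_fun D f ->
  layer_norm s (fun x => c * f x) = (c%:E * layer_norm s f)%E.
Proof.
move=> s0 s1 c0 mf.
rewrite -(@integral_dilation c (fun t : R => (mu (suplevel D f t)) `^ s)%E)//; last 2 first.
- by apply: measurable_layer => //; exact: ltW.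
- by move=> ?; exact: poweR_ge0.
apply: eq_integral => t _; congr ((mu _) `^ _)%E; apply/seteqP; split=> x [Dx] tx; split=> //.
  by rewrite ltr_pdivrMr// mulrC -[X in X * _]gtr0_norm// -normrM.
by move: tx; rewrite ltr_pdivrMr// mulrC -[X in X * _]gtr0_norm// -normrM.
Qed.

Lemma layer_normD s f g : 0 < s -> s <= 1 ->
  measurable_fun D f -> measurable_fun D g ->
  (layer_norm s (fun x => f x + g x)%R <= 2%:E * (layer_norm s f + layer_norm s g))%E.
Proof.
move=> s0 s1 mf mg; rewrite ge0_muleDr; try exact: layer_norm_ge0.
apply: layer_norm_split => //; first exact: measurable_funD.
move=> t t0.
apply: (@le_trans _ _ (mu (suplevel D f (t / 2) `|` suplevel D g (t / 2)))%E).
  apply: le_measure; rewrite ?inE.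
  - by apply: measurable_suplevel => //; exact: measurable_funD.
  - by apply: measurableU; exact: measurable_suplevel.
  - move=> x [Dx tx]; have [fx|fx] := ltP (t / 2) `|f x|; first by left.
    right; split => //; rewrite ltNge; apply/negP => gx; move: tx.
    rewrite ltNge => /negP; apply; rewrite (le_trans (ler_normD _ _))//.
    by rewrite [leRHS](splitr t) lerD.
by apply: measureU2; exact: measurable_suplevel.
Qed.

(** The part of a level set of f lying in F has measure at most mu(F) and at most (K/a)^(1/(1-s)).
    The first bound is integrated up to the height where the two agree, the second beyond it; the
    sum is exactly (K/s) mu(F)^s. *)
Lemma avg_bounded_weak_type s (K : R) f : 0 < s -> s < 1 -> 0 <= K ->
  measurable_fun D f ->
  (forall a, 0 < a -> (mu (suplevel D f a) <= ((K / a) `^ (1 - s)^-1)%:E)%E) ->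
  avg_bounded s (K / s) f.
Proof.
move=> s0 s1 K0 mf fK F mF FD.
have mfF : measurable_fun F f by exact: measurable_funS mf.
have finF : (mu F < +oo)%E.
  by apply: (le_lt_trans _ finD); apply: le_measure; rewrite ?inE.
have -> : (\int[mu]_(x in F) `|f x|%:E = \int[mu]_(x in F) (`|f x|%:E * cst 1 x))%E.
  by apply: eq_integral => x _; rewrite mule1.
rewrite layer_cake_weight//.
have levE a : (\int[mu]_(x in suplevel F f a) cst 1 x = mu (suplevel F f a))%E.
  by rewrite integral_cst ?mul1e//; exact: measurable_suplevel.
under eq_integral do rewrite levE.
have mlev (A : set R) : measurable_fun A (fun a : R => mu (suplevel F f a)).
  apply: measurable_funTS; apply: nonincreasing_emeasurable => a b ab.
  apply: le_measure; rewrite ?inE; try exact: measurable_suplevel.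
  by move=> x [Fx bx]; split=> //; exact: le_lt_trans bx.
have levF a : (mu (suplevel F f a) <= mu F)%E.
  apply: le_measure; rewrite ?inE//; first exact: measurable_suplevel.
  by move=> x [].
have levK a : 0 < a -> (mu (suplevel F f a) <= ((K / a) `^ (1 - s)^-1)%:E)%E.
  move=> a0; apply: le_trans (fK _ a0).
  apply: le_measure; rewrite ?inE//; try exact: measurable_suplevel.
  by move=> x [Fx ax]; split => //; exact: FD.
have rhs0 : (0 <= (K / s)%:E * (mu F) `^ s)%E.
  by rewrite mule_ge0 ?poweR_ge0// lee_fin divr_ge0// ltW.
have [K00|KN0] := eqVneq K 0.
  rewrite integral0_eq// => a; rewrite /= in_itv/= andbT => a0; apply/eqP.
  rewrite eq_le measure_ge0 andbT (le_trans (levK _ a0))// K00 mul0r powR0//.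
  by rewrite invr_eq0 subr_eq0 gt_eqF.
have {}K0 : 0 < K by rewrite lt_def KN0.
have [F0|F0] := eqVneq (mu F) 0%E.
  rewrite integral0_eq// => a _; apply/eqP; rewrite eq_le measure_ge0 andbT -F0.
  exact: levF.
pose m := fine (mu F).
have mE : mu F = m%:E by rewrite fineK// ge0_fin_numE.
have m0 : 0 < m by rewrite lt_def -eqe -mE F0/= fine_ge0.
(* The height at which (K/t)^(1/(1-s)) equals m. *)
pose t := K * m `^ (s - 1).
have t0 : 0 < t by rewrite mulr_gt0// powR_gt0.
have s10 : 0 < 1 - s by rewrite subr_gt0.
have q1 : 1 < (1 - s)^-1 by rewrite invf_gt1// gtrBl.
rewrite (@ge0_integral_ray_split _ t)//.
rewrite mE poweR_EFin -EFinM.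
have -> : K / s * m `^ s = m * t + K `^ (1 - s)^-1 * (t `^ (1 - (1 - s)^-1) / ((1 - s)^-1 - 1)).
  have -> : m * t = K * m `^ s by rewrite /t mulrCA mulr_powRB1// ltW.
  rewrite /t powRM ?powR_ge0 ?(ltW K0)// -powRrM.
  have -> : (s - 1) * (1 - (1 - s)^-1) = s by field; rewrite gt_eqF.
  have KK : K `^ (1 - s)^-1 * K `^ (1 - (1 - s)^-1) = K.
    by rewrite -powRD; [rewrite addrCA subrr addr0 powRr1// ltW|rewrite (gt_eqF K0) implybT].
  rewrite !mulrA KK; field.
  by rewrite (gt_eqF s10)/= mulN1r opprB addrC subrK (gt_eqF s0).
rewrite EFinD; apply: leeD.
  apply: (@le_trans _ _ (\int[leb]_(a in `]0%R, t[) cst m%:E a)%E).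
    by apply: ge0_le_integral => //; [exact: mlev|move=> a _; rewrite /= -mE].
  by rewrite integral_cst//= lebesgue_measure_itv/= lte_fin t0 sube0 EFinM.
apply: (@le_trans _ _ (\int[leb]_(a in `[t, +oo[) ((K `^ (1 - s)^-1)%:E * (a `^ (- (1 - s)^-1))%:E))%E).
  apply: ge0_le_integral => //.
    exact: mlev.
    apply/measurable_EFinP; apply: measurable_funM => //.
    by apply: measurable_funTS; exact: measurable_powR.
  move=> a; rewrite /= in_itv/= andbT => ta; have a0 := lt_le_trans t0 ta.
  rewrite (le_trans (levK _ a0))// -EFinM lee_fin powRM ?invr_ge0 ?(ltW a0) ?(ltW K0)//.
  by rewrite -(powR_inv1 (ltW a0)) -powRrM mulN1r.
rewrite ge0_integralZl//; first by rewrite integral_powR_tail// EFinM.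
- apply/measurable_EFinP; apply: measurable_funTS; exact: measurable_powR.
- by move=> *; rewrite lee_fin powR_ge0.
- by rewrite lee_fin powR_ge0.
Qed.

Lemma measure_suplevel_cvg0 f : measurable_fun D f ->
  mu (suplevel D f k.+1%:R) @[k --> \oo] --> 0%E.
Proof.
move=> mf; rewrite -(@measure0 _ _ _ mu).
have <- : \bigcap_k suplevel D f k.+1%:R = set0.
  apply/seteqP; split=> // x fx; have [_] := fx (Num.bound `|f x|) I.
  rewrite ltNge => /negP; apply; rewrite (le_trans (ltW (archi_boundP _)))//.
  by rewrite ler_nat.
apply: nonincreasing_cvg_mu => //.
- exact: measure_suplevel_lty.
- by move=> k; exact: measurable_suplevel.
- by apply: bigcap_measurable => // k _; exact: measurable_suplevel.
- move=> i j ij; apply/subsetPset; apply: le_suplevel.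
  by rewrite ler_nat ltnS.
Qed.

(** The level set at height a of the part of f above k+1 is the level set of f at height max(a,
    k+1), whose measure tends to 0. Dominated convergence applies, with the integrand for f as the
    majorant. *)
Lemma layer_norm_truncation s f (e : R) : 0 < s -> measurable_fun D f ->
  (layer_norm s f < +oo)%E -> 0 < e ->
  exists2 M : R, 0 < M &
    (layer_norm s (fun x => if `|f x| <= M then 0 else f x)%R < e%:E)%E.
Proof.
move=> s0 mf Nf e0; have s0' := ltW s0.
pose g (k : nat) x := if `|f x| <= k.+1%:R then 0 else f x.
have mg k : measurable_fun D (g k).
  apply: measurable_fun_if => //.
  - apply: measurable_fun_ler => //.
    exact: (measurableT_comp (@normr_measurable R setT) mf).
  - by apply: measurable_funS mf.
have gE k a : 0 < a -> suplevel D (g k) a = suplevel D f (Num.max a k.+1%:R).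
  move=> a0; apply/seteqP; split => x; rewrite /suplevel/= /g => -[Dx]; case: ifPn => fx.
  - by rewrite normr0 ltNge (ltW a0).
  - by move=> ax; split=> //; rewrite gt_max ax/= ltNge.
  - by rewrite gt_max => /andP[_]; rewrite ltNge fx.
  - by rewrite gt_max => /andP[].
have Ncvg : layer_norm s (g k) @[k --> \oo] --> (\int[leb]_(a in `]0%R, +oo[) (cst 0 a))%E.
  apply: (@dominated_cvg _ (measurableTypeR R) R leb `]0%R, +oo[%classic _
    (fun k a => ((mu (suplevel D (g k) a)) `^ s)%E) (cst 0%E)
    (fun a => (mu (suplevel D f a)) `^ s)%E) => //.
  - by move=> k; exact: measurable_layer.
  - move=> a; rewrite /= in_itv/= andbT => a0.
    have cv0 := measure_suplevel_cvg0 mf.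
    apply: cvg_EFin.
      by near=> k; rewrite fin_num_poweR// ge0_fin_numE// measure_suplevel_lty.
    have /fine_cvg/cvgrPdist_lt c0 := cv0.
    apply/cvgrPdist_lt => r r0.
    near=> k; have : `|0 - (fine \o (fun k : nat => mu (suplevel D f k.+1%:R))) k| < r `^ s^-1.
      by near: k; exact: c0 (powR_gt0 _ r0).
    rewrite !sub0r !normrN /= fine_poweR.
    rewrite !ger0_norm ?powR_ge0 ?fine_ge0// => lek.
    rewrite -[ltRHS](powRr1 (ltW r0)) -(@mulVf _ s) ?gt_eqF// powRrM.
    rewrite gt0_ltr_powR ?nnegrE ?fine_ge0 ?powR_ge0//.
    apply: le_lt_trans lek.
    apply: fine_le; rewrite ?ge0_fin_numE ?measure_suplevel_lty//.
    rewrite gE//; apply: measure_suplevel_le => //.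
    by rewrite le_max lexx orbT.
  - by move=> a _; rewrite fin_num_poweR// ge0_fin_numE// measure_suplevel_lty.
  - apply/integrableP; split; first exact: measurable_layer.
    by under eq_integral do rewrite gee0_abs ?poweR_ge0//.
  - move=> k a; rewrite /= in_itv/= andbT => a0.
    rewrite gee0_abs ?poweR_ge0//; apply: poweR_mono => //.
    rewrite gE//; apply: measure_suplevel_le => //.
    by rewrite le_max lexx.
rewrite integral0 in Ncvg.
have [k ke] := cvge0_lt Ncvg e0.
by exists k.+1%:R.
Unshelve. all: by end_near. Qed.

End layer_norm.

(** * Comparison of layer norms with Lorentz norms *)

Section lorentz_layer_norm.
Context d (T : measurableType d) (R : realType).
Variables (mu : {sigma_finite_measure set T -> \bar R}) (D : set T).
Hypothesis mD : measurable D.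
Hypothesis finD : (mu D < +oo)%E.
Implicit Types (f g h : T -> R) (s p : R).
Local Notation leb := (@lebesgue_measure R).
Local Notation N := (layer_norm mu D).

Lemma le_layer_norm_exponent s t f : 0 < s -> s <= t -> measurable_fun D f ->
  (N t f <= (mu D) `^ (t - s) * N s f)%E.
Proof.
move=> s0 st mf; have t0 := lt_le_trans s0 st; rewrite -ge0_integralZl//; last 3 first.
- by apply: measurable_layer => //; exact: ltW.
- by move=> *; exact: poweR_ge0.
- exact: poweR_ge0.
apply: ge0_le_integral => //.
- by move=> *; exact: poweR_ge0.
- by apply: measurable_layer => //; exact: ltW.
- by apply: emeasurable_funM => //; apply: measurable_layer => //; exact: ltW.
- move=> a _.
  have lD : (mu (suplevel D f a) <= mu D)%E.
    by apply: le_measure; rewrite ?inE//; [exact: measurable_suplevel|move=> x []].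
  apply: (@le_trans _ _ ((mu (suplevel D f a)) `^ (t - s) * (mu (suplevel D f a)) `^ s)%E).
    rewrite -[mu (suplevel D f a)]fineK ?ge0_fin_numE ?measure_suplevel_lty//.
    by rewrite !poweR_EFin -EFinM lee_fin -powRD subrK// gt_eqF.
  by rewrite lee_wpmul2r ?poweR_ge0// poweR_mono ?subr_ge0.
Qed.

(** Heights below 1 are handled by the finite measure of D, heights above 1 by the decay, which is
    integrable because r s > 1. This turns weak L^r into a finite layer norm. *)
Lemma layer_norm_decay s (r B : R) f : 0 < s -> 1 < r * s -> 0 <= B ->
  measurable_fun D f ->
  (forall a, 0 < a -> (mu (suplevel D f a) <= (B * a `^ (- r))%:E)%E) ->
  (N s f < +oo)%E.
Proof.
move=> s0 rs1 B0 mf fB; have s0' := ltW s0.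
rewrite /layer_norm (@ge0_integral_ray_split _ _ 1)//; last 2 first.
- by apply: measurable_layer => //; exact: ltW.
- by move=> a; exact: poweR_ge0.
apply: lte_add_pinfty.
  apply: (@le_lt_trans _ _ (\int[leb]_(a in `]0%R, 1%R[) cst ((mu D) `^ s)%E a)%E).
    apply: ge0_le_integral => //.
    + by move=> *; exact: poweR_ge0.
    + by apply: measurable_layer => //; exact: ltW.
    + move=> a _; apply: poweR_mono => //.
      by apply: le_measure; rewrite ?inE//; [exact: measurable_suplevel|move=> x []].
  rewrite integral_cst//= lebesgue_measure_itv/= lte_fin ltr01 sube0 mule1.
  exact: poweR_lty.
apply: (@le_lt_trans _ _ (\int[leb]_(a in `[1%R, +oo[) ((B `^ s)%:E * (a `^ (- (r * s)))%:E))%E).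
  apply: ge0_le_integral => //.
  - by move=> *; exact: poweR_ge0.
  - by apply: measurable_layer => //; exact: ltW.
  - apply/measurable_EFinP; apply: measurable_funM => //.
    by apply: measurable_funTS; exact: measurable_powR.
  - move=> a; rewrite /= in_itv/= andbT => a1; have a0 := lt_le_trans ltr01 a1.
    apply: (le_trans (poweR_mono s0' _ (fB _ a0))) => //.
    by rewrite poweR_EFin -EFinM lee_fin powRM ?powR_ge0// -powRrM mulNr.
rewrite ge0_integralZl//; first by rewrite integral_powR_tail// -EFinM ltry.
- apply/measurable_EFinP; apply: measurable_funTS; exact: measurable_powR.
- by move=> *; rewrite lee_fin powR_ge0.
- by rewrite lee_fin powR_ge0.
Qed.

(** Converts closeness in measure of uniformly bounded functions into closeness in layer norm:
    heights below e cost e mu(D)^s, and level sets between e and b have measure at most r. *)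
Lemma layer_norm_two_step s f (e b r : R) : 0 < s -> 0 < e -> 0 <= b -> 0 <= r ->
  measurable_fun D f -> (forall x, D x -> `|f x| <= b) ->
  (mu (suplevel D f e) <= r%:E)%E ->
  (N s f <= e%:E * (mu D) `^ s + (b * r `^ s)%:E)%E.
Proof.
move=> s0 e0 b0 r0 mf fd fe; have s0' := ltW s0.
rewrite /layer_norm (@ge0_integral_ray_split _ _ e)//; last 2 first.
- by apply: measurable_layer.
- by move=> a; exact: poweR_ge0.
apply: leeD.
  apply: (@le_trans _ _ (\int[leb]_(a in `]0%R, e[) cst ((mu D) `^ s)%E a)%E).
    apply: ge0_le_integral => //.
    + by move=> *; exact: poweR_ge0.
    + by apply: measurable_layer.
    + move=> a _; apply: poweR_mono => //.
      by apply: le_measure; rewrite ?inE//; [exact: measurable_suplevel|move=> x []].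
  by rewrite integral_cst//= lebesgue_measure_itv/= lte_fin e0 sube0 muleC.
apply: (@le_trans _ _ (\int[leb]_(a in `[e, +oo[) ((r `^ s)%:E * (\1_(`]0%R, b[) a)%:E))%E).
  apply: ge0_le_integral => //.
  - by move=> *; exact: poweR_ge0.
  - by apply: measurable_layer.
  - by apply/measurable_EFinP; apply: measurable_funM => //; exact: measurable_indic.
  - move=> a; rewrite /= in_itv/= andbT => ea; have a0 := lt_le_trans e0 ea.
    have [ab|ba] := ltP a b.
      rewrite indicE mem_set/= ?in_itv/= ?a0// mule1 -poweR_EFin.
      apply: poweR_mono => //; apply: le_trans fe; exact: measure_suplevel_le.
    rewrite (_ : suplevel D f a = set0) ?measure0 ?poweR0r ?gt_eqF//.
      by rewrite -EFinM lee_fin mulr_ge0 ?powR_ge0.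
    by apply/seteqP; split => // x [Dx]; rewrite ltNge (le_trans (fd _ Dx)).
rewrite ge0_integralZl//; [|by apply/measurable_EFinP; exact: measurable_indic|
  by rewrite lee_fin powR_ge0].
rewrite integral_indic//= mulrC EFinM lee_wpmul2l ?lee_fin ?powR_ge0//.
apply: (@le_trans _ _ (leb `]0%R, b[)%E).
  apply: le_measure; rewrite ?inE.
  - by apply: measurableI; exact: measurable_itv.
  - exact: measurable_itv.
  - by move=> x [].
by rewrite lebesgue_measure_itv/= lte_fin; case: ifPn; rewrite ?sube0 ?lee_fin.
Qed.

Local Notation rearr := (rearrangement mu D).

(** The duality between f^* and the distribution function. From right to left an infimum must exceed
    a strictly; this follows from right continuity of the distribution function, which still exceeds
    t at a + 1/(k+1) for some k. *)
Lemma rearrangement_gt f (a t : R) : measurable_fun D f -> 0 < a ->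
  (a%:E < rearr f t)%E = (t%:E < mu (suplevel D f a))%E.
Proof.
move=> mf a0; apply/idP/idP => [|ta].
  rewrite !ltNge; apply: contra => ta; apply: ereal_inf_lbound.
  by exists a.
have [k tk] : exists k : nat, (t%:E < mu (suplevel D f (a + k.+1%:R^-1)))%E.
  apply/not_existsP => H; move: ta; apply/negP; rewrite -leNgt.
  have cv : mu (suplevel D f (a + k.+1%:R^-1)) @[k --> \oo] --> mu (suplevel D f a).
    have -> : suplevel D f a = \bigcup_k suplevel D f (a + k.+1%:R^-1).
      apply/seteqP; split=> [x [Dx ax]|x [k _] [Dx ax]]; last first.
        by split=> //; apply: le_lt_trans ax; rewrite lerDl.
      have fa0 : 0 < `|f x| - a by rewrite subr_gt0.
      have [k _ /(_ k (leqnn k))/= kx] := near_infty_natSinv_lt (PosNum fa0).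
      by exists k => //; split=> //; rewrite addrC -ltrBrDr.
    apply: nondecreasing_cvg_mu.
    - by move=> k; exact: measurable_suplevel.
    - by apply: bigcup_measurable => k _; exact: measurable_suplevel.
    - move=> i j ij; apply/subsetPset; apply: le_suplevel.
      by rewrite lerD2l lef_pV2 ?posrE// ler_nat ltnS.
  apply: (cvge_to_le cv); near=> k; rewrite leNgt; exact/negP/H.
apply: (@lt_le_trans _ _ (a + k.+1%:R^-1)%:E); first by rewrite lte_fin ltrDl.
apply: le_ereal_inf_tmp => _ [b [b0 bt] <-].
rewrite lee_fin leNgt; apply/negP => ba; move: tk; apply/negP; rewrite -leNgt.
apply: le_trans bt; apply: measure_suplevel_le => //; exact: ltW.
Unshelve. all: by end_near. Qed.

Lemma rearrangement_ge0 f t : (0 <= rearr f t)%E.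
Proof. by apply: le_ereal_inf_tmp => _ [b [b0 _] <-]; rewrite lee_fin ltW. Qed.

Lemma rearrangement_fin_num f t : measurable_fun D f -> 0 < t -> rearr f t \is a fin_num.
Proof.
move=> mf t0; rewrite ge0_fin_numE ?rearrangement_ge0//.
have [k kt] := cvge0_lt (measure_suplevel_cvg0 mD finD mf) t0.
apply: (@le_lt_trans _ _ k.+1%:R%:E); last exact: ltry.
by apply: ereal_inf_lbound; exists k.+1%:R => //; split => //; exact: ltW.
Qed.

Lemma measurable_rearrangement f : measurable_fun setT (rearr f).
Proof.
apply: nonincreasing_emeasurable => a b ab.
apply: le_ereal_inf => _ [x [x0 xa] <-]; exists x => //; split=> //.
by apply: le_trans xa _; rewrite lee_fin.
Qed.

(** The layer cake formula applied to f^* with weight t^(1/p-1). By [rearrangement_gt] the set where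
    f^* > a is the interval from 0 to the measure of {|f| > a}, and the weight integrates over it to
    p times the power 1/p of that measure. *)
Lemma lorentz_norm1E p f : 0 < p -> measurable_fun D f ->
  lorentz_norm mu D p%:E 1%E f = (p%:E * N p^-1 f)%E.
Proof.
move=> p0 mf; rewrite /lorentz_norm invr1 poweRe1; last first.
  apply: integral_ge0 => t; rewrite /= in_itv/= andbT => t0.
  by rewrite mule_ge0 ?poweR_ge0// lee_fin invr_ge0 ltW.
transitivity (\int[leb]_(t in `]0%R, +oo[)
    (`|fine (rearr f t)|%:E * (t `^ (p^-1 - 1))%:E))%E.
  apply: eq_integral => t; rewrite inE/= in_itv/= andbT => t0.
  rewrite poweRe1; last by rewrite mule_ge0// ?lee_fin ?powR_ge0// rearrangement_ge0.
  rewrite -[rearr f t]fineK ?rearrangement_fin_num// -!EFinM/=; congr EFin.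
  rewrite ger0_norm ?fine_ge0 ?rearrangement_ge0//.
  rewrite powRB; last by rewrite (gt_eqF t0) implybT.
  by rewrite powRr1 ?(ltW t0)// mulrAC mulrC.
rewrite layer_cake_weight//=; last 3 first.
- apply: measurable_funTS.
  exact: (measurableT_comp (@fine_measurable R setT measurableT) (measurable_rearrangement f)).
- by apply/measurable_EFinP; apply: measurable_funTS; exact: measurable_powR.
- by move=> t _; rewrite lee_fin powR_ge0.
rewrite /layer_norm -ge0_integralZl//; last 3 first.
- by apply: measurable_layer => //; rewrite invr_ge0 ltW.
- by move=> *; exact: poweR_ge0.
- by rewrite lee_fin ltW.
apply: eq_integral => a; rewrite inE/= in_itv/= andbT => a0.
have mfin : mu (suplevel D f a) \is a fin_num by rewrite ge0_fin_numE ?measure_suplevel_lty.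
transitivity (\int[leb]_(t in `]0%R, fine (mu (suplevel D f a))[) (t `^ (p^-1 - 1))%:E)%E.
  congr (integral _ _ _).
  apply/seteqP; split=> t; rewrite /suplevel/= !in_itv/= ?andbT.
    move=> [t0]; rewrite ger0_norm ?fine_ge0 ?rearrangement_ge0// -lte_fin fineK ?rearrangement_fin_num//.
    by rewrite rearrangement_gt// t0/= -lte_fin fineK.
  move=> /andP[t0 ta]; split=> //.
  rewrite ger0_norm ?fine_ge0 ?rearrangement_ge0// -lte_fin fineK ?rearrangement_fin_num//.
  by rewrite rearrangement_gt// -[X in (_ < X)%E]fineK// lte_fin.
rewrite -[in RHS](fineK mfin).
have [m0|mN0] := eqVneq (fine (mu (suplevel D f a))) 0.
  rewrite m0 set_itv_ge ?bnd_simp// integral_set0 poweR_EFin powR0 ?mule0//.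
  by rewrite invr_eq0 gt_eqF.
rewrite integral_powR_head ?invr_gt0//; last by rewrite lt_def mN0 fine_ge0.
by rewrite invrK poweR_EFin -EFinM mulrC.
Qed.

Lemma lorentz_normy_weak_type p (K : R) f : 0 < p -> measurable_fun D f ->
  (lorentz_norm mu D p%:E +oo f <= K%:E)%E ->
  forall a, 0 < a -> (mu (suplevel D f a) <= ((K / a) `^ p)%:E)%E.
Proof.
move=> p0 mf fK a a0; rewrite leNgt; apply/negP => Ka.
have mfin : mu (suplevel D f a) \is a fin_num by rewrite ge0_fin_numE ?measure_suplevel_lty.
(* The midpoint t lies strictly between (K/a)^p and the measure of the level set, so f^*(t) > a
   while t^(1/p) a >= K: the supremum would exceed K. *)
move: Ka; rewrite -(fineK mfin) lte_fin => /midf_lt [Kt tm].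
set t := (_ + _) / 2 in Kt tm.
have t0 : 0 < t by apply: le_lt_trans Kt; exact: powR_ge0.
have : ((t `^ (fine p%:E)^-1)%:E * rearr f t <= K%:E)%E.
  by apply: le_trans fK; apply: ereal_sup_ubound; exists t => //; rewrite /= in_itv/= t0.
have at_ : (a%:E < rearr f t)%E by rewrite rearrangement_gt// -(fineK mfin) lte_fin.
apply/negP; rewrite -ltNge.
apply: (@le_lt_trans _ _ ((t `^ p^-1) * a)%:E); last first.
  by rewrite EFinM lte_pmul2l// lte_fin powR_gt0.
rewrite lee_fin -ler_pdivrMr//; case: (leP K 0) => K0.
  by rewrite (@le_trans _ _ 0) ?powR_ge0// ler_pdivrMr// mul0r.
rewrite -[leLHS](powRr1 (divr_ge0 (ltW K0) (ltW a0))) -(@mulfV _ p) ?gt_eqF// powRrM.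
by rewrite ge0_ler_powR ?nnegrE ?powR_ge0 ?invr_ge0 ?(ltW p0) ?(ltW t0) ?(ltW Kt).
Qed.

End lorentz_layer_norm.

(** * Borel sets of R^n *)

Section rV_borel.
Context {R : realType} {n : nat}.
Implicit Types (x y v : 'rV[R]_n) (r : R).
Local Notation mu := (lebesgue_rV n : {measure set 'rV[R]_n -> \bar R}).

Lemma rV_norm_leP v r : 0 <= r -> reflect (forall i, `|v ord0 i| <= r) (`|v| <= r).
Proof.
move=> r0; rewrite [`|v|]/Num.norm/= mx_normrE; apply: (iffP idP) => [vr i|vr].
  apply: le_trans vr; apply/bigmax_geP; right => /=.
  by exists (ord0, i) => //=; rewrite mem_index_enum.
by apply/bigmax_leP; split => // -[j i] _ /=; rewrite (ord1 j).
Qed.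

Lemma coord_le_norm v i : `|v ord0 i| <= `|v|.
Proof. exact/(rV_norm_leP v (normr_ge0 v)). Qed.

Lemma ball_rVE x r y : ball x r y <-> `|x - y| < r.
Proof. by rewrite mx_norm_ball. Qed.

(** The closed ball of the sup norm: being a product of intervals, it has an explicit volume. *)
Definition cube x r : set 'rV[R]_n := [set y | `|y - x| <= r].

Lemma cubeE x r : 0 <= r ->
  cube x r = [set y | forall i, x ord0 i - r <= y ord0 i <= x ord0 i + r].
Proof.
move=> r0; apply/seteqP; split => y /=; rewrite /cube/=.
  by move/(rV_norm_leP _ r0) => H i; have := H i; rewrite !mxE ler_distl.
by move=> H; apply/(rV_norm_leP _ r0) => i; rewrite !mxE ler_distl.
Qed.

Lemma measurable_box (a b : 'I_n -> R) :
  measurable [set y : 'rV[R]_n | forall i, a i <= y ord0 i <= b i].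
Proof.
rewrite (_ : mkset _ = \bigcap_(i in [set: 'I_n])
  ((fun y : 'rV[R]_n => y ord0 i) @^-1` `[a i, b i])).
  apply: fin_bigcap_measurable => // i _; rewrite -[X in measurable X]setTI.
  by apply: measurable_coord.
apply/seteqP; split => y /= H i; first by move=> _; rewrite /= in_itv/=; exact: H.
by have := H i I; rewrite /= in_itv/=.
Qed.

Lemma measurable_cube x r : measurable (cube x r).
Proof.
have [r0|r0] := leP 0 r; first by rewrite cubeE//; exact: measurable_box.
rewrite (_ : cube x r = set0)//; apply/seteqP; split => // y; rewrite /cube/= => yr.
by move: r0; rewrite ltNge (le_trans _ yr).
Qed.

(** The sigma-algebra is generated by the coordinates, so open sets must be rebuilt from boxes: U is
    the union of the cubes with rational centre and radius 1/(k+1) contained in U, enumerated by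
    [pickle]. *)
Lemma rV_open_measurable (U : set 'rV[R]_n) : open U -> measurable U.
Proof.
move=> oU.
pose G (m : nat) : set 'rV[R]_n :=
  if unpickle m is Some (q, k) then
    if `[< cube (map_mx ratr (q : 'rV[rat]_n)) k.+1%:R^-1 `<=` U >]
    then cube (map_mx ratr q) k.+1%:R^-1 else set0
  else set0.
have -> : U = \bigcup_m G m.
  apply/seteqP; split => [x Ux|x [m _]]; last first.
    by rewrite /G; case: unpickle => [[q k]|[]//]; case: asboolP => [sub /sub//|_ []].
  have /nbhs_ballP[e /= e0 xeU] : nbhs x U by exact: open_nbhs_nbhs.
  have [k _ /(_ k (leqnn k))/= ke] := near_infty_natSinv_lt (PosNum (divr_gt0 e0 (ltr0n R 2))).
  have k0 : 0 < k.+1%:R^-1 :> R by rewrite invr_gt0.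
  have /choice[q qx] : forall i, exists q : rat, `|ratr q - x ord0 i| <= k.+1%:R^-1.
    move=> i; have [|q] := @rat_in_itvoo R (x ord0 i - k.+1%:R^-1) (x ord0 i + k.+1%:R^-1).
      by rewrite ltrD2l gt0_cp.
    by rewrite in_itv/= => qx; exists q; rewrite ler_distl; case/andP: qx => /ltW-> /ltW->.
  have sub : cube (map_mx ratr (\row_i q i)) k.+1%:R^-1 `<=` U.
    move=> y /=; rewrite /cube/= => yq; apply: xeU; apply/ball_rVE.
    rewrite -(subrK (map_mx ratr (\row_i q i)) x) -addrA (le_lt_trans (ler_normD _ _))//.
    rewrite [ltRHS]splitr ltr_leD//; last by rewrite distrC (le_trans yq)// ltW.
    apply: le_lt_trans ke; apply/rV_norm_leP => [|i]; first exact: ltW.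
    by rewrite !mxE distrC.
  exists (pickle (\row_i q i, k)) => //; rewrite /G pickleK; case: asboolP => // _.
  rewrite /cube/= distrC; apply/rV_norm_leP => [|i]; first exact: ltW.
  by rewrite !mxE.
apply: bigcupT_measurable => m; rewrite /G; case: unpickle => // -[q k].
by case: ifPn => // _; exact: measurable_cube.
Qed.

Lemma rV_closed_measurable (A : set 'rV[R]_n) : closed A -> measurable A.
Proof. by move/closed_openC/rV_open_measurable/measurableC; rewrite setCK. Qed.

Lemma rV_compact_measurable (A : set 'rV[R]_n) : compact A -> measurable A.
Proof.
move=> /compact_closed cA; apply: rV_closed_measurable; apply: cA.
exact: norm_hausdorff.
Qed.

Lemma rV_continuous_measurable (f : 'rV[R]_n -> R) :
  continuous f -> measurable_fun setT f.
Proof.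
move=> /continuousP cf; apply: (measurability _ (RGenOpens.measurableE R)).
move=> _ [_ [a [b ->] <-]]; rewrite setTI; apply: rV_open_measurable.
exact/cf/interval_open.
Qed.

End rV_borel.

Lemma lebesgue_rV_box (R : realType) n (a b : 'I_n -> R) : (forall i, a i <= b i) ->
  lebesgue_rV n [set y : 'rV[R]_n | forall i, a i <= y ord0 i <= b i] =
  (\prod_(i < n) (b i - a i))%:E.
Proof.
elim: n a b => [|n IH] a b ab.
  rewrite big_ord0 /= /dirac indicE mem_set// => -[].
  by move=> m m0; exfalso; move: m0; rewrite ltn0.
rewrite big_ord_recl /= /cons_measure /pushforward.
rewrite (_ : _ @^-1` _ = `[a ord0, b ord0]%classic `*`
    [set y : 'rV[R]_n | forall i, a (lift ord0 i) <= y ord0 i <= b (lift ord0 i)]); last first.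
  apply/seteqP; split => -[t y]/=.
    move=> H; split; first by have := H ord0; rewrite mxE unlift_none in_itv.
    by move=> i; have := H (lift ord0 i); rewrite mxE liftK.
  rewrite in_itv/= => -[t0 H] i; rewrite mxE.
  by case: unliftP => [j ->|->].
rewrite product_measure1E//; last exact: measurable_box.
rewrite IH// EFinM; congr (_ * _)%E.
transitivity (@lebesgue_measure R `[a ord0, b ord0]%classic); first by [].
rewrite lebesgue_measure_itv/= lte_fin; case: ltP => [_|ba].
  by rewrite EFinB.
by apply/esym; congr EFin; apply/eqP; rewrite subr_eq0 eq_le ba ab.
Qed.

Lemma lebesgue_rV_cube (R : realType) n (x : 'rV[R]_n) r : 0 <= r ->
  lebesgue_rV n (cube x r) = ((2 * r) ^+ n)%:E.
Proof.
move=> r0; rewrite cubeE// lebesgue_rV_box => [|i]; last first.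
  by rewrite lerD2l ge0_cp.
congr EFin; rewrite (eq_bigr (fun=> 2 * r)) => [|i _]; last by ring.
by rewrite prodr_const card_ord.
Qed.

Lemma lebesgue_rV_bounded (R : realType) n (A : set 'rV[R]_n) :
  measurable A -> bounded_set A -> (lebesgue_rV n A < +oo)%E.
Proof.
move=> mA [M [Mr AM]]; have AM1 : A `<=` cube 0 (`|M| + 1).
  move=> x Ax; rewrite /cube/= subr0; apply: AM => //.
  by rewrite (le_lt_trans (ler_norm M))// ltrDl.
apply: (@le_lt_trans _ _ (lebesgue_rV n (cube 0 (`|M| + 1)))).
  by apply: le_measure; rewrite ?inE//; exact: measurable_cube.
by rewrite lebesgue_rV_cube ?ltry// addr_ge0.
Qed.

(** * Smooth cut-offs *)

Section smooth1.
Context {R : realType}.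
Implicit Types (f g : R -> R) (k m : nat).

Fixpoint derivable_upto k f : Prop :=
  (forall x : R, derivable f x 1) /\
  (if k is k'.+1 then derivable_upto k' (derive1 f) else True).

Definition smooth1 f := forall k, derivable_upto k f.

Lemma derivable_uptoW k f : derivable_upto k.+1 f -> derivable_upto k f.
Proof. by elim: k f => [|k IH] f [df sf]; split => //; exact: IH. Qed.

Lemma smooth1_derivable f : smooth1 f -> forall x : R, derivable f x 1.
Proof. by move=> /(_ 0)[]. Qed.

Lemma smooth1_derive f : smooth1 f -> smooth1 (derive1 f).
Proof. by move=> sf k; have [] := sf k.+1. Qed.

Lemma smooth1_is_derive f : smooth1 f -> forall x : R, is_derive x 1 f ((derive1 f) x).
Proof.
move=> sf x; apply: DeriveDef; first exact: smooth1_derivable.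
by rewrite derive1E.
Qed.

Lemma smooth1_continuous f : smooth1 f -> continuous f.
Proof.
move=> sf x; apply: differentiable_continuous; apply/derivable1_diffP.
exact: smooth1_derivable.
Qed.

Lemma is_derive_derive1 f g : (forall x : R, is_derive x 1 f (g x)) -> (derive1 f) = g.
Proof. by move=> fg; apply/funext => x; rewrite derive1E; have [_ ->] := fg x. Qed.

Lemma derivable_uptoS k f g : (forall x : R, is_derive x 1 f (g x)) ->
  derivable_upto k g -> derivable_upto k.+1 f.
Proof.
by move=> fg gk; split=> [x|]; [have [] := fg x|rewrite (is_derive_derive1 fg)].
Qed.

Lemma derivable_upto_cst k (c : R) : derivable_upto k (cst c).
Proof.
elim: k c => [|k IH] c; first by split=> // x; exact: derivable_cst.
by apply: derivable_uptoS (IH 0) => x; exact: is_derive_cst.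
Qed.

Lemma derivable_uptoD k f g :
  derivable_upto k f -> derivable_upto k g -> derivable_upto k (f \+ g).
Proof.
elim: k f g => [|k IH] f g [df sf] [dg sg].
  by split=> [x|//]; exact: (derivableD (df x) (dg x)).
apply: (@derivable_uptoS _ _ ((derive1 f) \+ (derive1 g))); last exact: IH.
move=> x; apply: is_derive_eq; last by rewrite /= !derive1E.
by apply: is_deriveD; exact: derivableP.
Qed.

Lemma derivable_uptoM k f g :
  derivable_upto k f -> derivable_upto k g -> derivable_upto k (f \* g).
Proof.
elim: k f g => [|k IH] f g Hf Hg.
  by split=> // x; apply: derivableM; [case: Hf|case: Hg].
have [df sf] := Hf; have [dg sg] := Hg.
apply: (@derivable_uptoS _ _ ((f \* (derive1 g)) \+ (g \* (derive1 f)))).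
  move=> x; apply: is_derive_eq; last by rewrite /= !derive1E.
  by apply: is_deriveM; exact: derivableP.
by apply: derivable_uptoD; apply: IH => //; exact: derivable_uptoW.
Qed.

Lemma smooth1_cst (c : R) : smooth1 (cst c).
Proof. by move=> k; exact: derivable_upto_cst. Qed.

Lemma smooth1D f g : smooth1 f -> smooth1 g -> smooth1 (f \+ g).
Proof. by move=> sf sg k; exact: derivable_uptoD. Qed.

Lemma smooth1M f g : smooth1 f -> smooth1 g -> smooth1 (f \* g).
Proof. by move=> sf sg k; exact: derivable_uptoM. Qed.

Lemma smooth1Z (c : R) f : smooth1 f -> smooth1 (fun x => c * f x).
Proof. by move=> sf; apply: (smooth1M (smooth1_cst c)). Qed.

Lemma smooth1B f g : smooth1 f -> smooth1 g -> smooth1 (f \- g).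
Proof.
move=> sf sg; rewrite (_ : f \- g = f \+ (fun x => -1 * g x)).
  by apply: smooth1D => //; exact: smooth1Z.
by apply/funext => x /=; rewrite mulN1r.
Qed.

Lemma is_derive_affine f (a b x df : R) : is_derive (a * x + b) 1 f df ->
  is_derive x 1 (fun y => f (a * y + b)) (a * df).
Proof.
move=> fd; have aff : is_derive x 1 (fun y : R => a * y + b) a.
  have := is_deriveD (is_deriveZ a (is_derive_id x 1)) (is_derive_cst b x 1).
  by rewrite addr0 /GRing.scale/= mulr1.
by have := @is_derive1_comp R f (fun y => a * y + b) x df a fd aff; rewrite mulrC.
Qed.

Lemma smooth1_affine f (a b : R) : smooth1 f -> smooth1 (fun x => f (a * x + b)).
Proof.
move=> sf k; elim: k f sf => [|k IH] f sf.
  by split=> // x; have [] := is_derive_affine (smooth1_is_derive sf (a * x + b)).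
apply: (@derivable_uptoS _ _ ((cst a) \* (fun x => (derive1 f) (a * x + b)))).
  by move=> x; apply: is_derive_affine; exact: smooth1_is_derive.
by apply: derivable_uptoM; [exact: derivable_upto_cst|apply: IH; exact: smooth1_derive].
Qed.

Lemma is_derive_inv f (x df : R) : f x != 0 -> is_derive x 1 f df ->
  is_derive x 1 (fun y => (f y)^-1) (- (f x) ^- 2 * df).
Proof.
move=> fx0 [fd <-]; apply: DeriveDef; first exact: derivableV.
by rewrite deriveV.
Qed.

Lemma smooth1_div f g : smooth1 f -> smooth1 g -> (forall x, g x != 0) ->
  smooth1 (fun x => f x / g x).
Proof.
move=> sf sg g0 k; elim: k f g sf sg g0 => [|k IH] f g sf sg g0.
  split=> // x; apply: derivableM; first exact: smooth1_derivable.
  by apply: derivableV => //; exact: smooth1_derivable.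
refine (@derivable_uptoS _ _
  (fun x => (((derive1 f) \* g) \- (f \* (derive1 g))) x / (g \* g) x) _ _).
  move=> x; apply: is_derive_eq.
    apply: is_deriveM; first exact: smooth1_is_derive.
    by apply: is_derive_inv; [exact: g0|exact: smooth1_is_derive].
  by rewrite /GRing.scale/=; field.
apply: IH.
- by apply: smooth1B; apply: smooth1M => //; exact: smooth1_derive.
- exact: smooth1M.
- by move=> x; rewrite /= mulf_neq0.
Qed.

(* These functions span a space stable under differentiation. *)
Definition flat m (t : R) : R := if t <= 0 then 0 else t^-1 ^+ m * expR (- t^-1).

Lemma flat_ge0 m t : 0 <= flat m t.
Proof.
rewrite /flat; have [t0|t0] := leP t 0; first exact: lexx.
by apply: mulr_ge0; rewrite ?expR_ge0// exprn_ge0// invr_ge0 ltW.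
Qed.

(** The exponential of 1/t dominates the term of degree m+2 of its series. Quadratic vanishing at 0
    is what makes [flat m] differentiable there with derivative 0. *)
Lemma flat_le_sqr m t : flat m t <= m.+2`!%:R * t ^+ 2.
Proof.
rewrite /flat; have [t0|t0] := leP t 0; first by rewrite mulr_ge0// sqr_ge0.
have := @expR_ge1Dxn R t^-1 m.+1; rewrite invr_ge0 (ltW t0) => /(_ isT) H.
have {H} : t^-1 ^+ m.+2 / m.+2`!%:R <= expR t^-1 by apply: le_trans H; rewrite lerDr.
rewrite ler_pdivrMr ?ltr0n ?fact_gt0// => H.
rewrite expRN ler_pdivrMr ?expR_gt0//.
have -> : t^-1 ^+ m = t ^+ 2 * t^-1 ^+ m.+2.
  by rewrite -[m.+2]addn2 exprD mulrCA -exprMn divff ?gt_eqF// expr1n mulr1.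
by rewrite [leRHS]mulrAC [leLHS]mulrC ler_wpM2r ?sqr_ge0// [leRHS]mulrC.
Qed.

Lemma is_derive_flat m (t : R) :
  is_derive t 1 (flat m) ((- m%:R) * flat m.+1 t + flat m.+2 t).
Proof.
have [t0|t0|->] := ltgtP t 0.
- rewrite /flat !ifT ?(ltW t0)// mulr0 addr0.
  apply: (@near_eq_is_derive _ _ _ (cst 0)).
  near=> s; rewrite /flat ifT// ltW//; near: s; exact: lt_nbhsl.
- have iV : is_derive t 1 (fun y : R => y^-1) (- t ^- 2).
    by have := @is_derive_inv id t 1 (lt0r_neq0 t0) (is_derive_id t 1); rewrite mulr1.
  apply: (@near_eq_is_derive _ _ _ ((fun y : R => y^-1) ^+ m * (expR \o - (fun y : R => y^-1)))).
    near=> s; rewrite /flat ifF; first by rewrite fctE/= exprfctE.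
    by apply/negbTE; rewrite -ltNge; near: s; exact: lt_nbhsr.
  apply: is_derive_eq.
  rewrite /flat !ifF; try by apply/negbTE; rewrite -ltNge.
  rewrite /= exprfctE /GRing.scale/= opprfctE opprK.
  case: m => [|m]; rewrite ?expr0 ?exprS/=; field; rewrite gt_eqF//.
- have f0 k : flat k 0 = 0 by rewrite /flat lexx.
  rewrite !f0 mulr0 addr0.
  (* By [flat_le_sqr] the difference quotient at 0 is at most (m+2)! |h|. *)
  have H : (fun h : R => h^-1 *: (flat m (h *: 1 + 0) - flat m 0)) @ 0^' --> 0.
    rewrite f0; apply/cvgrPdist_le => e e0; near=> h.
    rewrite sub0r normrN subr0 addr0 /GRing.scale/= mulr1 normrM normfV.
    have h0 : h != 0 by near: h; exact: nbhs_dnbhs_neq.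
    rewrite ler_pdivrMl ?normr_gt0// (ger0_norm (flat_ge0 _ _)).
    rewrite (le_trans (flat_le_sqr _ _))// -real_normK ?num_real// expr2 mulrCA ler_wpM2l//.
    rewrite mulrC -ler_pdivlMr ?ltr0n ?fact_gt0//.
    near: h; apply: dnbhs0_le; rewrite divr_gt0// ltr0n fact_gt0//.
  by apply: DeriveDef; [apply/cvg_ex; exists 0|exact: cvg_lim H].
Unshelve. all: by end_near. Qed.

Lemma smooth1_flat m : smooth1 (flat m).
Proof.
move=> k; elim: k m => [|k IH] m.
  by split=> // x; have [] := is_derive_flat m x.
apply: (derivable_uptoS (is_derive_flat m)).
apply: derivable_uptoD => //; apply: derivable_uptoM => //.
exact: derivable_upto_cst.
Qed.

Lemma flat_gt0 m t : 0 < t -> 0 < flat m t.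
Proof.
by move=> t0; rewrite /flat [t <= 0]leNgt t0/= mulr_gt0 ?expR_gt0// exprn_gt0// invr_gt0.
Qed.

Lemma flat_eq0 m t : t <= 0 -> flat m t = 0.
Proof. by rewrite /flat => ->. Qed.

Lemma flat0_le1 t : flat 0 t <= 1.
Proof.
have [t0|t0] := leP t 0; first by rewrite flat_eq0.
by rewrite /flat [t <= 0]leNgt t0/= expr0 mul1r -expR0 ler_expR oppr_le0 invr_ge0 ltW.
Qed.

Lemma flat_ge m (a t : R) : 0 < a -> a <= t -> t <= 1 -> expR (- a^-1) <= flat m t.
Proof.
move=> a0 at_ t1; have t0 := lt_le_trans a0 at_.
rewrite /flat [t <= 0]leNgt t0/= -[leLHS]mul1r ler_pM ?expR_ge0//.
  by rewrite exprn_ege1// invf_ge1.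
by rewrite ler_expR lerN2 lef_pV2.
Qed.

Definition smooth_step (t : R) : R := flat 0 t / (flat 0 t + flat 0 (1 - t)).

Let den (t : R) : R := flat 0 t + flat 0 (1 - t).

(** One of t and 1 - t is at least 1/2, and [flat 0] takes the value exp(-2) at 1/2. *)
Let den_ge (t : R) : expR (- 2) <= den t.
Proof.
have [t1|t1] := leP t 1; last first.
  rewrite /den (flat_eq0 0 (t := 1 - t)) ?subr_le0 ?(ltW t1)// addr0.
  rewrite /flat [t <= 0]leNgt (lt_trans ltr01 t1)/= expr0 mul1r ler_expR lerN2.
  by rewrite (@le_trans _ _ 1) ?ler1n// invf_le1 ?(ltW t1)// (lt_trans ltr01).
have [t0|t0] := leP 0 t; last first.
  rewrite /den flat_eq0 ?(ltW t0)// add0r.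
  have t'1 : 1 < 1 - t by rewrite ltrBrDl gtrDr.
  rewrite /flat [1 - t <= 0]leNgt (lt_trans ltr01 t'1)/= expr0 mul1r ler_expR lerN2.
  by rewrite (@le_trans _ _ 1) ?ler1n// invf_le1 ?(ltW t'1)// (lt_trans ltr01).
have -> : (2 : R) = 2^-1^-1 by rewrite invrK.
have [th|th] := leP 2^-1 t.
  by rewrite (le_trans (flat_ge 0 _ th t1))// ?invr_gt0// lerDl flat_ge0.
rewrite (@le_trans _ _ (flat 0 (1 - t))) ?lerDr ?flat_ge0//.
by apply: flat_ge; rewrite ?invr_gt0//; lra.
Qed.

Let den_gt0 (t : R) : 0 < den t.
Proof. exact: lt_le_trans (expR_gt0 _) (den_ge t). Qed.

Lemma smooth_step_ge0 t : 0 <= smooth_step t.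
Proof. by rewrite divr_ge0 ?flat_ge0// ltW// den_gt0. Qed.

Lemma smooth_step_le1 t : smooth_step t <= 1.
Proof. by rewrite ler_pdivrMr ?den_gt0// mul1r lerDl flat_ge0. Qed.

Lemma smooth_step_eq0 t : t <= 0 -> smooth_step t = 0.
Proof. by move=> t0; rewrite /smooth_step flat_eq0// mul0r. Qed.

Lemma smooth_step_eq1 t : 1 <= t -> smooth_step t = 1.
Proof.
move=> t1; rewrite /smooth_step (flat_eq0 0 (t := 1 - t)) ?subr_le0// addr0 divff//.
by rewrite gt_eqF// flat_gt0// (lt_le_trans ltr01).
Qed.

Let reflE m : (fun t => flat m (1 - t)) = (fun t => flat m (-1 * t + 1)).
Proof. by apply/funext => t; rewrite mulN1r addrC. Qed.

Let smooth1_den : smooth1 den.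
Proof.
apply: smooth1D; first exact: smooth1_flat.
by rewrite reflE; apply: smooth1_affine; exact: smooth1_flat.
Qed.

Lemma smooth1_smooth_step : smooth1 smooth_step.
Proof.
apply: (@smooth1_div (flat 0) den); [exact: smooth1_flat|exact: smooth1_den|].
by move=> t; rewrite gt_eqF// den_gt0.
Qed.

Lemma derive1_smooth_step t : derive1 smooth_step t =
  (flat 2 t * flat 0 (1 - t) + flat 0 t * flat 2 (1 - t)) / (den t) ^+ 2.
Proof.
have dfl (s : R) : is_derive s 1 (flat 0) (flat 2 s).
  by have := is_derive_flat 0 s; rewrite oppr0 mul0r add0r.
have dfl' : is_derive t 1 (fun t => flat 0 (1 - t)) (- flat 2 (1 - t)).
  have e1 : -1 * t + 1 = 1 - t by ring.
  have /is_derive_affine : is_derive (-1 * t + 1) 1 (flat 0) (flat 2 (1 - t)).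
    by rewrite e1.
  by rewrite reflE mulN1r.
have dden : is_derive t 1 den (flat 2 t - flat 2 (1 - t)) by exact: (is_deriveD (dfl t) dfl').
have dn0 : den t != 0 by rewrite gt_eqF ?den_gt0.
have H : is_derive t 1 smooth_step
    (flat 0 t *: (- (den t) ^- 2 * (flat 2 t - flat 2 (1 - t))) + (den t)^-1 *: flat 2 t).
  exact: (is_deriveM (dfl t) (is_derive_inv dn0 dden)).
rewrite derive1E; have [_ ->] := H; move: dn0.
by rewrite /den /GRing.scale/= => dn0; field.
Qed.

Lemma derive1_smooth_step_ge0 t : 0 <= derive1 smooth_step t.
Proof.
rewrite derive1_smooth_step divr_ge0 ?sqr_ge0// addr_ge0// mulr_ge0 ?flat_ge0//.
Qed.

Lemma derive1_smooth_step_eq0 t : t <= 0 \/ 1 <= t -> derive1 smooth_step t = 0.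
Proof.
rewrite derive1_smooth_step => -[t0|t1]; first by rewrite !(flat_eq0 _ t0) !mul0r addr0 mul0r.
by rewrite !(flat_eq0 _ (t := 1 - t)) ?subr_le0// !mulr0 addr0 mul0r.
Qed.

(** On ]0,1[ the numerator of the derivative is at most 2 * 4!, by [flat_le_sqr] with m = 2, and the
    squared denominator is at least exp(-4). *)
Definition smooth_step_slope : R := 48 * expR 4.

Lemma derive1_smooth_step_le t : derive1 smooth_step t <= smooth_step_slope.
Proof.
have slope0 : 0 <= smooth_step_slope by rewrite mulr_ge0// expR_ge0.
have [t0|t0] := leP t 0; first by rewrite derive1_smooth_step_eq0//; left.
have [t1|t1] := leP 1 t; first by rewrite derive1_smooth_step_eq0//; right.
rewrite derive1_smooth_step ler_pdivrMr; last by rewrite exprn_gt0// den_gt0.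
have f2 s : 0 < s -> s < 1 -> flat 2 s <= 24.
  move=> s0 s1; rewrite (le_trans (flat_le_sqr _ _))//.
  by rewrite -[leRHS]mulr1 ler_pM ?sqr_ge0// expr_le1 ?(ltW s0)// ltW.
rewrite (@le_trans _ _ 48)//.
  have := f2 t t0 t1; have := f2 (1 - t); rewrite subr_gt0 gtrBl => /(_ t1 t0) A B.
  have -> : (48 : R) = 24 * 1 + 1 * 24 by ring.
  by rewrite lerD// ler_pM ?flat_ge0// flat0_le1.
rewrite /smooth_step_slope -mulrA ler_peMr//.
have -> : (4 : R) = 2 + 2 by ring.
rewrite expRD -expr2 -exprMn exprn_ege1//.
by rewrite -[leLHS](expRxMexpNx_1 2) ler_wpM2l// expR_ge0.
Qed.

(** On [1/4, 3/4] every factor of the numerator is at least exp(-4), so the numerator is at least 2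
    exp(-8), while the squared denominator is at most 4. *)
Definition smooth_step_min : R := expR (- 4) ^+ 2 / 2.

Lemma smooth_step_min_gt0 : 0 < smooth_step_min.
Proof. by rewrite divr_gt0// exprn_gt0// expR_gt0. Qed.

Lemma derive1_smooth_step_ge t : 4^-1 <= t -> t <= 3 / 4 ->
  smooth_step_min <= derive1 smooth_step t.
Proof.
move=> t1 t3; rewrite derive1_smooth_step ler_pdivlMr ?exprn_gt0 ?den_gt0//.
have le4 m s : 4^-1 <= s -> s <= 1 -> expR (- 4) <= flat m s.
  by move=> s4 s1; rewrite -[4]invrK flat_ge// invr_gt0.
have t' : 4^-1 <= 1 - t by lra.
have t'' : 1 - t <= 1 by rewrite gerBl (le_trans _ t1)// invr_ge0.
have t1' : t <= 1 by rewrite (le_trans t3)//; lra.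
apply: (@le_trans _ _ (smooth_step_min * 2 ^+ 2)).
  rewrite ler_wpM2l ?(ltW smooth_step_min_gt0)// lerXn2r ?nnegrE ?(ltW (den_gt0 t))//.
  by rewrite (_ : 2 = 1 + 1)// lerD// flat0_le1.
have -> : smooth_step_min * 2 ^+ 2 = expR (- 4) * expR (- 4) + expR (- 4) * expR (- 4).
  by rewrite /smooth_step_min; field.
by rewrite lerD// ler_pM ?expR_ge0// le4.
Qed.

End smooth1.

(** * Smooth functions of several variables *)

Section smooth_rV.
Context {R : realType} {n : nat}.
Implicit Types (f g phi : 'rV[R]_n -> R) (x y : 'rV[R]_n) (i j : 'I_n).
Local Notation e_ i := (delta_mx ord0 i : 'rV[R]_n).

Lemma smooth_partial f i : smooth f -> smooth (partial i f).
Proof. by move=> sf s; have := sf (rcons s i); rewrite foldr_rcons. Qed.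

Lemma smooth_continuous f : smooth f -> continuous f.
Proof. by move=> /(_ [::])[]. Qed.

Lemma smooth_derivable f x i : smooth f -> derivable f x (e_ i).
Proof. by move=> /(_ [::])[_]; exact. Qed.

(** [smooth] quantifies over all words of partial derivatives; it suffices to exhibit a class of
    continuous, derivable functions that is stable under each partial derivative. *)
Lemma smooth_coind (S : set ('rV[R]_n -> R)) :
  (forall f, S f -> [/\ continuous f, forall x i, derivable f x (e_ i) &
    forall i, S (partial i f)]) ->
  forall f, S f -> smooth f.
Proof.
move=> H f Sf s; have Sfs : S (foldr partial f s).
  by elim: s => //= i s IH; have [_ _] := H _ IH; exact.
by have [] := H _ Sfs.
Qed.

(** By the Leibniz rule a partial derivative of a product is a sum of products. Closing under both
    operations yields a class to which [smooth_coind] applies. *)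
Inductive smooth_closure : set ('rV[R]_n -> R) :=
| closure_smooth f of smooth f : smooth_closure f
| closureD f g of smooth_closure f & smooth_closure g : smooth_closure (f \+ g)
| closureM f g of smooth_closure f & smooth_closure g : smooth_closure (f \* g).

Lemma partialD f g i : (forall x, derivable f x (e_ i)) ->
  (forall x, derivable g x (e_ i)) ->
  partial i (f \+ g) = partial i f \+ partial i g.
Proof. by move=> df dg; apply/funext => x; exact: (deriveD (df x) (dg x)). Qed.

Lemma partialM f g i : (forall x, derivable f x (e_ i)) ->
  (forall x, derivable g x (e_ i)) ->
  partial i (f \* g) = (f \* partial i g) \+ (g \* partial i f).
Proof. by move=> df dg; apply/funext => x; exact: (deriveM (df x) (dg x)). Qed.

Lemma smooth_closureP f : smooth_closure f -> smooth f.
Proof.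
move: f; apply: smooth_coind => f; elim=> {f}.
- move=> f sf; split; [exact: smooth_continuous| |].
    by move=> x i; exact: smooth_derivable.
  by move=> i; apply: closure_smooth; exact: smooth_partial.
- move=> f g cf [sf df pf] cg [sg dg pg]; split.
  + by move=> x; apply: continuousD; [exact: sf|exact: sg].
  + by move=> x i; exact: (derivableD (df x i) (dg x i)).
  + by move=> i; rewrite partialD//; exact: closureD.
- move=> f g cf [sf df pf] cg [sg dg pg]; split.
  + by move=> x; apply: continuousM; [exact: sf|exact: sg].
  + by move=> x i; exact: (derivableM (df x i) (dg x i)).
  + by move=> i; rewrite partialM//; apply: closureD; exact: closureM.
Qed.

Lemma smoothD f g : smooth f -> smooth g -> smooth (f \+ g).
Proof.
by move=> sf sg; apply: smooth_closureP; apply: closureD; exact: closure_smooth.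
Qed.

Lemma smoothM f g : smooth f -> smooth g -> smooth (f \* g).
Proof.
by move=> sf sg; apply: smooth_closureP; apply: closureM; exact: closure_smooth.
Qed.

(** A partial derivative of such a product only replaces one factor by its derivative, so smoothness
    in R^n reduces to smoothness in one variable. All cut-offs, kernels and fields below have this
    form. *)
Definition tensor (F : 'I_n -> R -> R) y : R := \prod_(j < n) F j (y ord0 j).

Lemma is_derive_tensor F y i : (forall j, smooth1 (F j)) ->
  is_derive y (e_ i) (tensor F)
    (tensor (fun j => if j == i then derive1 (F i) else F j) y).
Proof.
move=> sF.
pose Q := \prod_(j < n | j != i) F j (y ord0 j).
have TE (z : 'rV[R]_n) : (forall j, j != i -> z ord0 j = y ord0 j) ->
    tensor F z = F i (z ord0 i) * Q.
  move=> zy; rewrite /tensor (bigD1 i)//=; congr (_ * _).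
  by apply: eq_bigr => j ji; rewrite zy.
have -> : tensor (fun j => if j == i then derive1 (F i) else F j) y =
    derive1 (F i) (y ord0 i) * Q.
  rewrite /tensor (bigD1 i)//= eqxx; congr (_ * _).
  by apply: eq_bigr => j /negbTE ->.
have H : (fun h : R => h^-1 *: (tensor F (h *: e_ i + y) - tensor F y)) @ 0^' -->
    (derive1 (F i) (y ord0 i) * Q : R).
  rewrite (_ : (fun h => _) = (fun h : R =>
      h^-1 *: (F i (h *: (1 : R) + y ord0 i) - F i (y ord0 i)) * Q)); last first.
    apply/funext => h; rewrite (TE y)// TE.
      by rewrite !mxE !eqxx/= /GRing.scale/= -mulrBl mulrA.
    by move=> j ji; rewrite !mxE eqxx/= (negbTE ji) mulr0 add0r.
  apply: cvgMl; rewrite derive1E.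
  exact: (@smooth1_derivable _ _ (sF i) (y ord0 i)).
by apply: DeriveDef; [apply/cvg_ex; exists (derive1 (F i) (y ord0 i) * Q)|exact: cvg_lim H].
Qed.

Lemma continuous_tensor (F : 'I_n -> R -> R) : (forall j, continuous (F j)) -> continuous (tensor F).
Proof.
move=> cF; rewrite /tensor; elim: (index_enum _) => [|j s IH].
  rewrite (_ : (fun y => _) = cst 1); first exact: cst_continuous.
  by apply/funext => y; rewrite big_nil.
rewrite (_ : (fun y => _) =
    (F j \o fun y : 'rV[R]_n => y ord0 j) \* (fun y => \prod_(j <- s) F j (y ord0 j))).
  move=> x; apply: continuousM; last exact: IH.
  by apply: continuous_comp; [exact: coord_continuous|exact: cF].
by apply/funext => y; rewrite big_cons.
Qed.

Lemma smooth_tensor F : (forall j, smooth1 (F j)) -> smooth (tensor F).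
Proof.
move=> sF; apply: (@smooth_coind [set f | exists2 F, (forall j, smooth1 (F j)) & f = tensor F]).
  move=> _ [{}F {}sF ->]; split.
  - by apply: continuous_tensor => j; exact: smooth1_continuous.
  - by move=> x i; have [] := is_derive_tensor x i sF.
  - move=> i; exists (fun j => if j == i then derive1 (F i) else F j).
      by move=> j; case: ifPn => // _; exact: smooth1_derive.
    by apply/funext => x; have [_] := is_derive_tensor x i sF.
by exists F.
Qed.

Lemma partial_tensor F i : (forall j, smooth1 (F j)) ->
  partial i (tensor F) = tensor (fun j => if j == i then derive1 (F i) else F j).
Proof. by move=> sF; apply/funext => x; have [_] := is_derive_tensor x i sF. Qed.

Lemma compact_box (a b : 'I_n -> R) :
  compact [set y : 'rV[R]_n | forall i, a i <= y ord0 i <= b i].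
Proof.
have := @rV_compact _ _ (fun i => `[a i, b i]%classic) (fun i => @segment_compact R (a i) (b i)).
by congr compact; apply/seteqP; split => y /= H i; have := H i; rewrite /= in_itv.
Qed.

Lemma tensor_test_function (Omega : set 'rV[R]_n) F (a b : 'I_n -> R) :
  (forall j, smooth1 (F j)) -> (forall j t, F j t != 0 -> a j <= t <= b j) ->
  [set y : 'rV[R]_n | forall i, a i <= y ord0 i <= b i] `<=` Omega ->
  test_function Omega (tensor F).
Proof.
move=> sF Fab abO; set B := mkset _ in abO.
have cB : closed B by apply: compact_closed; [exact: norm_hausdorff|exact: compact_box].
have sB : closure [set x | tensor F x != 0] `<=` B.
  rewrite [X in _ `<=` X]((closure_id B).1 cB); apply: closureS => x /=.
  by rewrite prodf_seq_neq0 => /allP H i; apply: Fab; apply: H; rewrite mem_index_enum.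
split; first exact: smooth_tensor.
- by apply: subclosed_compact sB; [exact: closed_closure|exact: compact_box].
- exact: subset_trans sB abO.
Qed.

Lemma test_functionM (Omega : set 'rV[R]_n) g phi :
  smooth g -> test_function Omega phi -> test_function Omega (g \* phi).
Proof.
move=> sg [sphi cphi phiO].
have sub : closure [set x | (g \* phi) x != 0] `<=` closure [set x | phi x != 0].
  by apply: closureS => x /=; rewrite mulf_eq0 negb_or => /andP[].
split; [exact: smoothM| |exact: subset_trans sub phiO].
by apply: subclosed_compact sub => //; exact: closed_closure.
Qed.

(** The approximating class: the Lipschitz bound serves the convergence of averages, the bounds on g
    and its partial derivatives serve the integration by parts in the drift term, and the class is
    stable under sums and products. *)
Definition nice g := smooth g /\ exists M : R, [/\ 0 <= M, forall x, `|g x| <= M,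
  forall i x, `|partial i g x| <= M & forall x y, `|g x - g y| <= M * `|x - y|].

Lemma partial_cst (c : R) i : partial i (cst c) = cst 0.
Proof. by apply/funext => x; exact: derive_cst. Qed.

Lemma smooth_cst (c : R) : smooth (cst c : 'rV[R]_n -> R).
Proof.
apply: (@smooth_coind [set f | exists c, f = cst c]); last by exists c.
move=> _ [{}c ->]; split; first exact: cst_continuous.
  by move=> x i; exact: derivable_cst.
by move=> i; exists 0; rewrite partial_cst.
Qed.

Lemma nice_cst (c : R) : nice (cst c).
Proof.
split; first exact: smooth_cst.
exists `|c|; split => // [i x|x y]; first by rewrite partial_cst normr0.
by rewrite subrr normr0 mulr_ge0.
Qed.

Lemma niceD f g : nice f -> nice g -> nice (f \+ g).
Proof.
move=> [sf [M [M0 fM dfM lfM]]] [sg [K [K0 gK dgK lgK]]]; split; first exact: smoothD.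
exists (M + K); split; first exact: addr_ge0.
- by move=> x; rewrite (le_trans (ler_normD _ _))// lerD.
- move=> i x; rewrite partialD => [|z|z]; [|exact: smooth_derivable|exact: smooth_derivable].
  by rewrite (le_trans (ler_normD _ _))// lerD.
- move=> x y; rewrite /= opprD addrACA (le_trans (ler_normD _ _))// mulrDl lerD//.
Qed.

Lemma niceM f g : nice f -> nice g -> nice (f \* g).
Proof.
move=> [sf [M [M0 fM dfM lfM]]] [sg [K [K0 gK dgK lgK]]]; split; first exact: smoothM.
have MK : 0 <= M * K by exact: mulr_ge0.
exists (M * K + M * K); split; first exact: addr_ge0.
- by move=> x; rewrite normrM -[leLHS]addr0 lerD// ler_pM.
- move=> i x; rewrite partialM => [|z|z]; [|exact: smooth_derivable|exact: smooth_derivable].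
  rewrite (le_trans (ler_normD _ _))// !normrM lerD//; first exact: ler_pM.
  by rewrite mulrC ler_pM.
- move=> x y; rewrite /= (_ : _ - _ = f x * (g x - g y) + (f x - f y) * g y); last by ring.
  rewrite (le_trans (ler_normD _ _))// !normrM mulrDl lerD//.
    by rewrite -mulrA ler_pM.
  by rewrite mulrAC ler_pM.
Qed.

Definition coord_step i (a k : R) y : R := smooth_step (k * y ord0 i + a).

Lemma coord_step_tensor i a k : coord_step i a k =
  tensor (fun j => if j == i then (fun t => smooth_step (k * t + a)) else cst 1).
Proof.
apply/funext => y; rewrite /tensor (bigD1 i)//= eqxx big1 ?mulr1// => j /negbTE ->.
by [].
Qed.

Lemma derive1_step_affine (a k t : R) :
  derive1 (fun t => smooth_step (k * t + a)) t = k * derive1 smooth_step (k * t + a).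
Proof.
rewrite derive1E.
by have [_ ->] := is_derive_affine (smooth1_is_derive smooth1_smooth_step (k * t + a)).
Qed.

Lemma nice_coord_step i a k : nice (coord_step i a k).
Proof.
have sF j : smooth1 (if j == i then (fun t => smooth_step (k * t + a)) else cst 1).
  case: ifPn => _; last exact: smooth1_cst.
  by apply: smooth1_affine; exact: smooth1_smooth_step.
have S0 : 0 <= smooth_step_slope :> R by rewrite mulr_ge0// expR_ge0.
split; first by rewrite coord_step_tensor; exact: smooth_tensor.
pose M := 1 + `|k| * smooth_step_slope.
have kS0 : 0 <= `|k| * smooth_step_slope by rewrite mulr_ge0.
have dle (t : R) : `|derive1 (fun t => smooth_step (k * t + a)) t| <= `|k| * smooth_step_slope.
  rewrite derive1_step_affine normrM ler_wpM2l//.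
  by rewrite ger0_norm ?derive1_smooth_step_ge0// derive1_smooth_step_le.
exists M; split; first exact: addr_ge0.
- move=> x; rewrite ger0_norm ?smooth_step_ge0// (le_trans (smooth_step_le1 _))//.
  by rewrite lerDl.
- move=> l x; rewrite coord_step_tensor partial_tensor// /tensor normr_prod.
  have [il|il] := eqVneq i l.
    rewrite il (bigD1 l)//= eqxx big1 => [|j jl]; last by rewrite (negbTE jl) normr1.
    by rewrite mulr1 (le_trans (dle _))// lerDr.
  rewrite (bigD1 l)//= eqxx derive1_cst/= normr0 mul0r.
  exact: addr_ge0.
- move=> x y; rewrite /coord_step.
  have lip (s t : R) : s <= t -> `|smooth_step (k * t + a) - smooth_step (k * s + a)| <=
      (`|k| * smooth_step_slope) * `|t - s|.
    move=> st; have sk : smooth1 (fun t => smooth_step (k * t + a)).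
      by apply: smooth1_affine; exact: smooth1_smooth_step.
    have [c _ ->] := @MVT_segment _ _ (derive1 (fun t => smooth_step (k * t + a))) s t st
      (fun z _ => smooth1_is_derive sk z)
      (continuous_subspaceT (smooth1_continuous sk)).
    by rewrite normrM ler_wpM2r.
  have {}lip s t : `|smooth_step (k * t + a) - smooth_step (k * s + a)| <=
      (`|k| * smooth_step_slope) * `|t - s|.
    have [st|ts] := leP s t; first exact: lip.
    by rewrite distrC [`|t - s|]distrC; apply: lip; exact: ltW.
  rewrite (le_trans (lip _ _))//.
  have := coord_le_norm (x - y) i; rewrite !mxE => H.
  by rewrite ler_pM// lerDr.
Qed.

End smooth_rV.

(** * Density of smooth functions *)

Section nice_density.
Context {R : realType} {n : nat}.
Variable D : set 'rV[R]_n.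
Hypothesis mD : measurable D.
Local Notation mu := (lebesgue_rV n : {sigma_finite_measure set 'rV[R]_n -> \bar R}).
Hypothesis finD : (mu D < +oo)%E.
Implicit Types (E : set 'rV[R]_n) (f g h : 'rV[R]_n -> R).

Lemma nice_continuous g : nice g -> continuous g.
Proof. by move=> [/smooth_continuous]. Qed.

Lemma nice_measurable g : nice g -> measurable_fun D g.
Proof.
by move=> ng; apply: measurable_funTS; apply: rV_continuous_measurable; exact: nice_continuous.
Qed.

(** Approximation in measure is stable under complements, intersections and countable unions, so
    these sets form a sigma-algebra. Since the approximants have values in [0,1], it later upgrades
    to layer norms through [layer_norm_two_step]. *)
Definition nice_indicator E : Prop := measurable E /\ forall e : R, 0 < e ->
  exists g, [/\ nice g, forall x, 0 <= g x <= 1 &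
    (mu (suplevel D (fun x => \1_E x - g x)%R e) < e%:E)%E].

Let mind E g : measurable E -> nice g -> measurable_fun D (fun x => \1_E x - g x)%R.
Proof.
move=> mE ng; apply: measurable_funB; last exact: nice_measurable.
by apply: measurable_funTS; exact: measurable_indic.
Qed.

Let msup E g (a : R) : measurable E -> nice g ->
  measurable (suplevel D (fun x => \1_E x - g x)%R a).
Proof. by move=> mE ng; apply: measurable_suplevel => //; exact: mind. Qed.

Lemma nice_indicator0 : nice_indicator set0.
Proof.
split=> // e e0; exists (cst 0); split.
- exact: nice_cst.
- by move=> x; rewrite lexx ler01.
- rewrite (_ : suplevel _ _ _ = set0) ?measure0 ?lte_fin//.
  apply/seteqP; split=> // x [_]; rewrite indicE in_set0 subrr normr0.
  by rewrite ltNge (ltW e0).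
Qed.

Lemma nice_indicatorC E : nice_indicator E -> nice_indicator (~` E).
Proof.
move=> [mE aE]; split; first exact: measurableC.
move=> e /aE[g [ng g01 ge]]; exists (cst 1 \+ (cst (-1) \* g)); split.
- by apply: niceD; [exact: nice_cst|apply: niceM => //; exact: nice_cst].
- by move=> x; rewrite /= mulN1r; have := g01 x; lra.
- have key x : \1_(~` E) x - (cst 1 \+ (cst (-1) \* g)) x = - (\1_E x - g x) :> R.
    by rewrite !indicE in_setC /=; case: (x \in E) => /=; ring.
  rewrite (_ : suplevel _ _ _ = suplevel D (fun x => \1_E x - g x)%R e)//.
  by apply/seteqP; split => x; rewrite /suplevel/= key normrN.
Qed.

Lemma nice_indicatorI E F : nice_indicator E -> nice_indicator F ->
  nice_indicator (E `&` F).
Proof.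
move=> [mE aE] [mF aF]; split; first exact: measurableI.
move=> e e0; have e2 : 0 < e / 2 by rewrite divr_gt0.
have [g [ng g01 ge]] := aE _ e2; have [h [nh h01 he]] := aF _ e2.
exists (g \* h); split; first exact: niceM.
  move=> x /=; have /andP[gx gx'] := g01 x; have /andP[hx hx'] := h01 x.
  by rewrite mulr_ge0//= mulr_ile1.
apply: (@le_lt_trans _ _ (mu (suplevel D (fun x => \1_E x - g x)%R (e / 2) `|`
    suplevel D (fun x => \1_F x - h x)%R (e / 2)))).
  apply: le_measure; rewrite ?inE.
  - by apply: msup; [exact: measurableI|exact: niceM].
  - by apply: measurableU; exact: msup.
  - move=> x [Dx]; rewrite indicI /= => ex.
    have [a1|a1] := ltP (e / 2) `|\1_E x - g x|; first by left.
    right; split=> //; rewrite ltNge; apply/negP => a2; move: ex; apply/negP.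
    rewrite -leNgt (_ : _ - _ = (\1_E x : R) * (\1_F x - h x) + (\1_E x - g x) * h x); last by ring.
    rewrite (le_trans (ler_normD _ _))// !normrM [leRHS]splitr lerD//.
      by rewrite -[leRHS]mul1r ler_pM// indicE; case: (_ \in _); rewrite ?normr1 ?normr0.
    have /andP[hx hx'] := h01 x.
    by rewrite -[leRHS]mulr1 ler_pM// ger0_norm.
apply: le_lt_trans; first by apply: measureU2; exact: msup.
by rewrite [X in (_ < X%:E)%E]splitr EFinD lteD.
Qed.

Lemma nice_indicatorU E F : nice_indicator E -> nice_indicator F ->
  nice_indicator (E `|` F).
Proof.
move=> aE aF; rewrite -[E `|` F]setCK setCU.
by apply: nice_indicatorC; apply: nice_indicatorI; exact: nice_indicatorC.
Qed.

(** Because mu(D) is finite, a finite partial union misses only a small part of the union inside D;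
    the partial union is then approximated within e/2. *)
Lemma nice_indicator_bigcup (E : (set 'rV[R]_n)^nat) :
  (forall k, nice_indicator (E k)) -> nice_indicator (\bigcup_k E k).
Proof.
move=> aE; have mU : measurable (\bigcup_k E k).
  by apply: bigcup_measurable => k _; have [] := aE k.
split=> // e e0; have e2 : 0 < e / 2 by rewrite divr_gt0.
pose F k := \big[setU/set0]_(i < k) E i.
have aF k : nice_indicator (F k).
  rewrite /F; elim: k => [|k IH]; first by rewrite big_ord0; exact: nice_indicator0.
  by rewrite big_ord_recr/=; exact: nice_indicatorU.
have mF k : measurable (F k) by have [] := aF k.
pose G k := D `&` (\bigcup_k E k `\` F k).
have mG k : measurable (G k) by apply: measurableI => //; exact: measurableD.
have G0 : mu (G k) @[k --> \oo] --> 0%E.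
  rewrite -(@measure0 _ _ _ mu).
  have <- : \bigcap_k G k = set0.
    apply/seteqP; split=> // x Gx; have [_ [[k _ Ekx] _]] := Gx 0%N I.
    have [_ [_ nF]] := Gx k.+1 I; apply: nF; rewrite /F big_ord_recr/=.
    by right.
  apply: nonincreasing_cvg_mu => //.
  - by apply: (le_lt_trans _ finD); apply: le_measure; rewrite ?inE// => x [].
  - by apply: bigcap_measurable.
  - move=> i j ij; apply/subsetPset => x [Dx [Ux nF]]; split=> //; split=> //.
    apply: contra_not nF; exact: subset_bigsetU.
have [k Gk] := cvge0_lt G0 e2.
have [_ /(_ _ e2)[g [ng g01 ge]]] := aF k.
exists g; split=> //.
apply: (@le_lt_trans _ _ (mu (G k `|` suplevel D (fun x => \1_(F k) x - g x)%R (e / 2)))).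
  apply: le_measure; rewrite ?inE; [exact: msup|by apply: measurableU => //; exact: msup|].
  move=> x [Dx ex]; have [GKx|nG] := pselect (G k x); first by left.
  right; split=> //; apply: (@lt_trans _ _ e); first by rewrite ltr_pdivrMr// ltr_pMr// ltr1n.
  move: ex; rewrite !indicE (_ : (x \in \bigcup_k E k) = (x \in F k))//.
  apply/idP/idP => /set_mem H; apply/mem_set.
    by apply: contrapT => nF; apply: nG.
  by move: H; rewrite /F -bigcup_mkord => -[i _ Ei]; exists i.
apply: le_lt_trans; first by apply: measureU2 => //; exact: msup.
by rewrite [X in (_ < X%:E)%E]splitr EFinD lteD.
Qed.

(** A smooth step climbing from 0 to 1 across the slab a < x_i <= a + 1/(k+1) differs from the
    indicator only inside the slab, and these slabs shrink to the empty set. *)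
Lemma nice_indicator_ray i (a : R) :
  nice_indicator [set x : 'rV[R]_n | a < x ord0 i].
Proof.
have mray b : measurable [set x : 'rV[R]_n | b < x ord0 i].
  rewrite (_ : mkset _ = (fun x : 'rV[R]_n => x ord0 i) @^-1` `]b, +oo[).
    by rewrite -[X in measurable X]setTI; exact: measurable_coord.
  by apply/seteqP; split => x /=; rewrite in_itv/= andbT.
split=> // e e0.
pose G (k : nat) := D `&` ([set x : 'rV[R]_n | a < x ord0 i] `\`
  [set x : 'rV[R]_n | a + k.+1%:R^-1 < x ord0 i]).
have mG k : measurable (G k) by apply: measurableI => //; exact: measurableD.
have G0 : mu (G k) @[k --> \oo] --> 0%E.
  rewrite -(@measure0 _ _ _ mu).
  have <- : \bigcap_k G k = set0.
    apply/seteqP; split=> // x Gx; have [_ [ax _]] := Gx 0%N I.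
    have xa0 : 0 < x ord0 i - a by rewrite subr_gt0.
    have [k _ /(_ k (leqnn k))/= kx] := near_infty_natSinv_lt (PosNum xa0).
    have [_ [_]] := Gx k I; apply; rewrite /= addrC -ltrBrDr//.
  apply: nonincreasing_cvg_mu => //.
  - by apply: (le_lt_trans _ finD); apply: le_measure; rewrite ?inE// => x [].
  - by apply: bigcap_measurable.
  - move=> j l jl; apply/subsetPset => x [Dx [Ux nF]]; split=> //; split=> //.
    apply: contra_not nF => /=; apply: le_lt_trans.
    by rewrite lerD2l lef_pV2 ?posrE// ler_nat ltnS.
have [k Gk] := cvge0_lt G0 e0.
exists (coord_step i (- (k.+1%:R * a)) k.+1%:R); split.
- exact: nice_coord_step.
- by move=> x; rewrite smooth_step_ge0 smooth_step_le1.
- apply: le_lt_trans Gk; apply: le_measure; rewrite ?inE//.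
    by apply: msup => //; exact: nice_coord_step.
  move=> x [Dx]; rewrite indicE /coord_step -mulrBr => ex; split=> //.
  have k0 : 0 < k.+1%:R :> R by [].
  split.
    rewrite /= ltNge; apply/negP => xa; move: ex.
    rewrite memNset /=; last by rewrite ltNge xa.
    rewrite smooth_step_eq0 ?subrr ?normr0 ?ltNge ?(ltW e0)//.
    by rewrite pmulr_rle0// subr_le0.
  rewrite /= => ax; move: ex.
  rewrite mem_set /=; last by apply: lt_trans ax; rewrite ltrDl.
  rewrite smooth_step_eq1 ?subrr ?normr0 ?ltNge ?(ltW e0)//.
  by rewrite mulrC -ler_pdivrMr// div1r lerBrDl ltW.
Qed.

(** The class C of approximable sets is a sigma-algebra for which the coordinates are measurable.
    Hence so is the identity map from (R^n, C), which means that every measurable set belongs to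
    C. *)
Lemma measurable_nice_indicator E : measurable E -> nice_indicator E.
Proof.
move=> mE; pose C : set (set 'rV[R]_n) := [set F | nice_indicator F].
have sC : sigma_algebra setT C.
  split; first exact: nice_indicator0.
  - by move=> F CF; rewrite setTD; exact: nice_indicatorC.
  - by move=> F CF; exact: nice_indicator_bigcup.
pose id' : g_sigma_algebraType C -> 'rV[R]_n := id.
have mid : measurable_fun setT id'.
  apply/measurable_fun_rVP => i; apply: (measurability _ (RGenOInfty.measurableE R)).
  move=> _ [_ [a ->] <-]; rewrite setTI; apply: sub_sigma_algebra => /=.
  rewrite /C/= (_ : _ @^-1` _ = [set x : 'rV[R]_n | a < x ord0 i]).
    exact: nice_indicator_ray.
  by apply/seteqP; split => x /=; rewrite in_itv/= andbT.
have := mid measurableT E mE; rewrite setTI /id' preimage_id.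
by rewrite /measurable/= sigma_algebra_id.
Qed.

End nice_density.

(** * Density in layer norm: indicators, bounded functions, general functions *)

Section nice_approximation.
Context {R : realType} {n : nat}.
Variable D : set 'rV[R]_n.
Hypothesis mD : measurable D.
Local Notation mu := (lebesgue_rV n : {sigma_finite_measure set 'rV[R]_n -> \bar R}).
Hypothesis finD : (mu D < +oo)%E.
Variable s : R.
Hypotheses (s0 : 0 < s) (s1 : s <= 1).
Implicit Types (E : set 'rV[R]_n) (f g h : 'rV[R]_n -> R).
Local Notation N := (layer_norm mu D s).

Definition nice_approx f := forall e : R, 0 < e ->
  exists2 g, nice g & (N (fun x => f x - g x)%R < e%:E)%E.

Lemma layer_norm0 : N (cst 0) = 0%E.
Proof.
rewrite /layer_norm integral0_eq// => a; rewrite /= in_itv/= andbT => a0.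
rewrite (_ : suplevel _ _ _ = set0) ?measure0 ?poweR0r ?gt_eqF//.
by apply/seteqP; split=> // x [_]; rewrite normr0 ltNge (ltW a0).
Qed.

Lemma nice_nice_approx g : nice g -> nice_approx g.
Proof.
move=> ng e e0; exists g => //.
by under [X in N X]eq_fun do rewrite subrr; rewrite layer_norm0 lte_fin.
Qed.

Lemma nice_approx_indic E : measurable E -> nice_approx \1_E.
Proof.
move=> mE e e0; have [_ aE] := measurable_nice_indicator mD finD mE.
pose A := fine ((mu D) `^ s)%E.
have AE : ((mu D) `^ s = A%:E)%E.
  by rewrite fineK// ge0_fin_numE ?poweR_ge0// poweR_lty.
have A0 : 0 <= A by rewrite fine_ge0// poweR_ge0.
(* The two terms of [layer_norm_two_step] with b = 1 are d A and d^s; the two entries of the minimum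
   make them at most e/2 and e/4. [A + 1] guards against A = 0. *)
pose d := Num.min (e / 2 / (A + 1)) ((e / 4) `^ s^-1).
have d0 : 0 < d.
  by rewrite lt_min !divr_gt0//= ?powR_gt0 ?divr_gt0// ltr_pwDr.
have [g [ng g01 gd]] := aE d d0; exists g => //.
apply: (@le_lt_trans _ _ (d%:E * (mu D) `^ s + (1 * d `^ s)%:E)%E).
  apply: layer_norm_two_step => //.
  - exact: ltW.
  - apply: measurable_funB; last exact: nice_measurable.
    by apply: measurable_funTS; exact: measurable_indic.
  - move=> x _; have := g01 x; rewrite indicE ler_norml; case: (_ \in _) => /=; lra.
  - exact: ltW.
rewrite AE mul1r -EFinM -EFinD lte_fin [ltRHS]splitr ler_ltD//.
  rewrite (@le_trans _ _ (e / 2 / (A + 1) * A))//.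
    by rewrite ler_wpM2r// ge_min lexx.
  rewrite mulrAC ler_pdivrMr; last by rewrite ltr_pwDr.
  by rewrite ler_wpM2l ?divr_ge0 ?(ltW e0)// lerDl.
apply: (@le_lt_trans _ _ (e / 4)); last by lra.
have e4 : 0 <= e / 4 by rewrite divr_ge0// ltW.
have -> : e / 4 = ((e / 4) `^ s^-1) `^ s by rewrite -powRrM mulVf ?gt_eqF// powRr1.
rewrite ge0_ler_powR ?nnegrE ?powR_ge0 ?(ltW s0) ?(ltW d0)//.
by rewrite ge_min lexx orbT.
Qed.

Lemma nice_approxD f h : measurable_fun D f -> measurable_fun D h ->
  nice_approx f -> nice_approx h -> nice_approx (fun x => f x + h x).
Proof.
move=> mf mh af ah e e0; have e4 : 0 < e / 4 by rewrite divr_gt0.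
have [g ng fg] := af _ e4; have [k nk hk] := ah _ e4.
exists (g \+ k); first exact: niceD.
rewrite (_ : (fun x => _) = (fun x => (f x - g x) + (h x - k x))); last first.
  by apply/funext => x /=; ring.
have mfg : measurable_fun D (fun x => f x - g x).
  by apply: measurable_funB => //; exact: nice_measurable.
have mhk : measurable_fun D (fun x => h x - k x).
  by apply: measurable_funB => //; exact: nice_measurable.
apply: le_lt_trans; first exact: (layer_normD _ mD s0 s1 mfg mhk).
have -> : e = 2 * (e / 4 + e / 4) by field.
by rewrite EFinM lte_pmul2l// EFinD lteD.
Qed.

Lemma nice_approxZ (c : R) f : 0 < c -> measurable_fun D f -> nice_approx f ->
  nice_approx (fun x => c * f x).
Proof.
move=> c0 mf af e e0; have [g ng fg] := af (e / c) (divr_gt0 e0 c0).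
exists (cst c \* g); first by apply: niceM => //; exact: nice_cst.
rewrite (_ : (fun x => _) = (fun x => c * (f x - g x))); last first.
  by apply/funext => x /=; ring.
rewrite layer_normZ//; last by apply: measurable_funB => //; exact: nice_measurable.
have -> : e = c * (e / c) by field; rewrite gt_eqF.
by rewrite EFinM lte_pmul2l.
Qed.

Lemma nice_approx_lim f : measurable_fun D f ->
  (forall e : R, 0 < e -> exists h, [/\ measurable_fun D h, nice_approx h &
     (N (fun x => f x - h x)%R < e%:E)%E]) -> nice_approx f.
Proof.
move=> mf af e e0; have e4 : 0 < e / 4 by rewrite divr_gt0.
have [h [mh ah fh]] := af _ e4; have [g ng hg] := ah _ e4.
exists g => //; rewrite (_ : (fun x => _) = (fun x => (f x - h x) + (h x - g x))); last first.
  by apply/funext => x /=; ring.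
have mfh : measurable_fun D (fun x => f x - h x) by exact: measurable_funB.
have mhg : measurable_fun D (fun x => h x - g x).
  by apply: measurable_funB => //; exact: nice_measurable.
apply: le_lt_trans; first exact: (layer_normD _ mD s0 s1 mfh mhg).
have -> : e = 2 * (e / 4 + e / 4) by field.
by rewrite EFinM lte_pmul2l// EFinD lteD.
Qed.

(** For c > 0 and t >= 0 this is c min(k, floor(t/c)), written as a sum of indicators of half-lines
    so that composing it with f gives a sum of indicators of sets. *)
Definition staircase (c : R) (k : nat) (t : R) : R :=
  \sum_(j < k) c * (j.+1%:R * c <= t)%R%:R.

Lemma staircase_bound (c t : R) k : 0 < c -> 0 <= t ->
  [/\ k%:R * c <= t -> staircase c k t = k%:R * c, staircase c k t <= t &
      t < k%:R * c -> t - staircase c k t <= c].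
Proof.
move=> c0 t0; elim: k => [|k [IH1 IH2 IH3]].
  rewrite /staircase big_ord0 mul0r; split => //; move=> /lt_le_trans /(_ t0).
  by rewrite ltxx.
have step : staircase c k.+1 t = staircase c k t + c * (k.+1%:R * c <= t)%R%:R.
  by rewrite /staircase big_ord_recr.
have kS : k.+1%:R * c = k%:R * c + c by rewrite -natr1; ring.
have [kt|tk] := leP (k.+1%:R * c) t.
  have E : staircase c k.+1 t = k.+1%:R * c.
    by rewrite step kt mulr1 IH1 ?kS//; move: kt; rewrite kS; lra.
  by split => //; rewrite ?E// => ?; lra.
rewrite step leNgt tk mulr0 addr0; split => // _.
have [kt|kt] := ltP t (k%:R * c); first exact: IH3.
by rewrite IH1//; move: tk; rewrite kS; lra.
Qed.

Lemma nice_approx_ge0_bounded f (M : R) : measurable_fun D f -> 0 < M ->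
  (forall x, D x -> 0 <= f x <= M) -> nice_approx f.
Proof.
move=> mf M0 f0M; apply: nice_approx_lim => // e e0.
pose A := fine ((mu D) `^ s)%E.
have AE : ((mu D) `^ s = A%:E)%E.
  by rewrite fineK// ge0_fin_numE ?poweR_ge0// poweR_lty.
have A0 : 0 <= A by rewrite fine_ge0// poweR_ge0.
pose c := e / 2 / (A + 1).
have c0 : 0 < c by rewrite !divr_gt0// ltr_pwDr.
pose k := (Num.bound (M / c)).+1.
have Mk : M < k%:R * c.
  rewrite -ltr_pdivrMr// (lt_trans (archi_boundP _)) ?ltr_nat//.
  by rewrite divr_ge0// ltW.
pose E (j : nat) : set 'rV[R]_n := D `&` f @^-1` `[j.+1%:R * c, +oo[%classic.
have mE j : measurable (E j) by apply: mf.
pose h x : R := \sum_(j < k) c * \1_(E j) x.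
have hE x : D x -> h x = staircase c k (f x).
  move=> Dx; apply: eq_bigr => j _; congr (_ * _); rewrite indicE; congr (_%:R).
  by congr nat_of_bool; apply/idP/idP => [/set_mem[_]/=|H]; [|apply/mem_set; split=> //=];
    rewrite in_itv/= andbT.
have [mh ah] : measurable_fun D h /\ nice_approx h.
  rewrite /h; elim: k {Mk h hE} => [|k [mh ah]].
    rewrite (_ : (fun x => _) = cst 0); last by apply/funext => x; rewrite big_ord0.
    by split; [exact: measurable_cst|apply: nice_nice_approx; exact: nice_cst].
  have mi : measurable_fun D (\1_(E k) : _ -> R).
    by apply: measurable_funTS; exact: measurable_indic.
  rewrite (_ : (fun x => _) =
      (fun x => (\sum_(j < k) c * \1_(E j) x) + c * \1_(E k) x)); last first.
    by apply/funext => x; rewrite big_ord_recr.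
  have mci : measurable_fun D (fun x => c * \1_(E k) x) by exact: measurable_funM.
  split; first exact: measurable_funD.
  by apply: nice_approxD => //; apply: nice_approxZ => //; exact: nice_approx_indic.
exists h; split => //.
(* The error is at most c everywhere on D, so the set where it exceeds c is empty and
   [layer_norm_two_step] is used with r = 0. *)
apply: (@le_lt_trans _ _ (c%:E * (mu D) `^ s + (c * 0 `^ s)%:E)%E).
  apply: layer_norm_two_step => //; first exact: ltW.
  - exact: measurable_funB.
  - move=> x Dx; rewrite hE//; have /andP[fx0 fxM] := f0M x Dx.
    have [_ H1 H2] := staircase_bound k c0 fx0.
    by rewrite ger0_norm ?subr_ge0// H2// (le_lt_trans fxM).
  - rewrite (_ : suplevel _ _ _ = set0) ?measure0//; apply/seteqP; split=> // x [Dx].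
    rewrite hE//; have /andP[fx0 fxM] := f0M x Dx.
    have [_ H1 H2] := staircase_bound k c0 fx0.
    by rewrite ger0_norm ?subr_ge0// ltNge H2// (le_lt_trans fxM).
rewrite powR0 ?gt_eqF// mulr0 adde0 AE -EFinM lte_fin.
apply: (@le_lt_trans _ _ (e / 2)); last by rewrite ltr_pdivrMr// ltr_pMr// ltr1n.
rewrite /c mulrAC ler_pdivrMr; last by rewrite ltr_pwDr.
by rewrite ler_wpM2l ?divr_ge0 ?(ltW e0)// lerDl.
Qed.

Lemma finite_layer_norm_approx f : measurable_fun D f -> (N f < +oo)%E -> nice_approx f.
Proof.
move=> mf Nf; apply: nice_approx_lim => // e e0.
have [M M0 fM] := layer_norm_truncation mD finD s0 mf Nf e0.
pose h x := if `|f x| <= M then f x else 0.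
have mh : measurable_fun D h.
  apply: measurable_fun_if => //.
  - apply: measurable_fun_ler => //.
    exact: (measurableT_comp (@normr_measurable R setT) mf).
  - by apply: measurable_funS mf.
exists h; split => //; last first.
  rewrite (_ : (fun x => _) = (fun x => if `|f x| <= M then 0 else f x))//.
  by apply/funext => x; rewrite /h; case: ifPn => _; rewrite ?subrr ?subr0.
(* The staircase argument wants nonnegative functions: h + M takes values in [0, 2M], and the
   constant -M is itself in the approximating class. *)
rewrite (_ : h = (fun x => (h x + M) + cst (- M) x)); last first.
  by apply/funext => x; rewrite addrK.
apply: nice_approxD => //; first exact: measurable_funD.
  apply: (@nice_approx_ge0_bounded _ (M + M)); rewrite ?addr_gt0//.
    exact: measurable_funD.
  move=> x _; rewrite /h; case: ifPn => [|_]; last by lra.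
  by rewrite ler_norml; lra.
by apply: nice_nice_approx; exact: nice_cst.
Qed.

End nice_approximation.

(** * Interior cones and their mollifiers *)

Section cone_condition.
Context {R : realType} {n : nat}.
Implicit Types (x y e w : 'rV[R]_n).

Lemma dotpDr e x y : dotp e (x + y) = dotp e x + dotp e y.
Proof. by rewrite /dotp -big_split/=; apply: eq_bigr => i _; rewrite mxE mulrDr. Qed.

Lemma dotpZr e x (a : R) : dotp e (a *: x) = a * dotp e x.
Proof. by rewrite /dotp mulr_sumr; apply: eq_bigr => i _; rewrite mxE mulrCA. Qed.

Lemma dotpNr e x : dotp e (- x) = - dotp e x.
Proof. by rewrite -scaleN1r dotpZr mulN1r. Qed.

Lemma dotpBr e x y : dotp e (x - y) = dotp e x - dotp e y.
Proof. by rewrite dotpDr dotpNr. Qed.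

Lemma dotpp_ge0 x : 0 <= dotp x x.
Proof. by apply: sumr_ge0 => i _; rewrite -expr2 sqr_ge0. Qed.

Lemma coord_le_enorm x i : `|x ord0 i| <= enorm x.
Proof.
rewrite -sqrtr_sqr ler_sqrt ?dotpp_ge0// /dotp (bigD1 i)//= expr2 lerDl.
by apply: sumr_ge0 => j _; rewrite -expr2 sqr_ge0.
Qed.

Lemma norm_le_enorm x : `|x| <= enorm x.
Proof. by apply/rV_norm_leP => [|i]; [exact: sqrtr_ge0|exact: coord_le_enorm]. Qed.

Lemma norm_dotp_le e w : `|dotp e w| <= n%:R * (`|e| * `|w|).
Proof.
rewrite (le_trans (ler_norm_sum _ _ _))//.
apply: (@le_trans _ _ (\sum_(i < n) `|e| * `|w|)).
  by apply: ler_sum => i _; rewrite normrM ler_pM// coord_le_norm.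
by rewrite sumr_const card_ord -[leLHS]mulr_natl.
Qed.

Lemma enorm_le_norm x : enorm x <= n%:R * `|x|.
Proof.
have nx0 : 0 <= n%:R * `|x| by rewrite mulr_ge0.
rewrite -[leRHS](ger0_norm nx0) -sqrtr_sqr ler_sqrt ?sqr_ge0//.
rewrite (le_trans (ler_norm _))// (le_trans (norm_dotp_le _ _))//.
rewrite exprMn -expr2 ler_wpM2r ?sqr_ge0// -natrX ler_nat.
by case: n => // m; rewrite expnS expn1 leq_pmulr.
Qed.

(** From every point of Omega near x0 the cone of directions e + w with |w| <= tau, cut at height h,
    stays in Omega. The direction e is the same for all these points. Taking e = 0 covers interior
    points, so that interior and boundary points are treated alike. *)
Definition cone_condition (Omega : set 'rV[R]_n) x0 (r tau h : R) e :=
  [/\ 0 < r, 0 < tau <= 1, 0 < h, `|e| <= 1 &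
    forall x, Omega x -> `|x - x0| < r ->
    forall t w, 0 < t <= h -> `|w| <= tau -> Omega (x + t *: (e + w))].

Lemma cone_condition_interior (Omega : set 'rV[R]_n) x0 :
  open Omega -> Omega x0 -> exists r tau h e, cone_condition Omega x0 r tau h e.
Proof.
move=> oO Ox0; have /nbhs_ballP[r /= r0 rO] : nbhs x0 Omega by exact: open_nbhs_nbhs.
exists (r / 2), 1, (r / 4), 0; split; rewrite ?divr_gt0// ?ltr01 ?lexx ?normr0//.
move=> x _ xx0 t w /andP[t0 th] w1; apply: rO; apply/ball_rVE.
rewrite add0r opprD addrA (le_lt_trans (ler_normB _ _))//.
rewrite distrC normrZ gtr0_norm// (splitr r) ltr_leD//.
rewrite (@le_trans _ _ (r / 4 * 1))//; first by apply: ler_pM => //; exact: ltW.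
by rewrite mulr1; lra.
Qed.

(** Moving by t(e + w) raises the height by t(1 + e.w), while the Lipschitz graph rises at most by L
    t |w - (e.w)e|; for small w the point stays above the graph. *)
Lemma cone_condition_boundary (Omega : set 'rV[R]_n) x0 :
  lipschitz_boundary Omega -> (closure Omega `\` Omega°) x0 ->
  exists r tau h e, cone_condition Omega x0 r tau h e.
Proof.
move=> lO /lO[r0 [e [gamma [r00 e1 lg gO]]]].
have [L [L0 gL]] : exists L : R, 0 < L /\ forall y z, dotp e y = 0 -> dotp e z = 0 ->
    `|gamma y - gamma z| <= L * `|y - z|.
  have [L [L0 HL]] : exists L : R, 0 < L /\
      L.-lipschitz_[set y | dotp e y = 0] gamma.
    have [M [Mr HM]] := lg; exists (`|M| + 1); split; first by rewrite ltr_pwDr.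
    by apply: HM; rewrite (le_lt_trans (ler_norm M))// ltrDl.
  by exists L; split => // y z ey ez; have := HL (y, z); apply.
have ee : dotp e e = 1.
  by move: e1; rewrite /enorm => /(congr1 (fun z : R => z ^+ 2)); rewrite sqr_sqrtr ?dotpp_ge0// expr1n.
have ne1 : `|e| <= 1 by rewrite -e1 norm_le_enorm.
have n1 : 0 < n.+1%:R :> R by [].
(* Chosen so that L (n+1) tau + (n+1) tau = 1. The first term bounds the rise of the graph per unit
   of t, the second exceeds |e.w|. [n.+1] comes from comparing the Euclidean and sup norms and is
   never zero. *)
pose tau : R := ((L + 1) * n.+1%:R)^-1.
have tau0 : 0 < tau by rewrite invr_gt0 mulr_gt0// addr_gt0.
have tauE : (L + 1) * n.+1%:R * tau = 1 by rewrite mulfV// gt_eqF// mulr_gt0// addr_gt0.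
have tau1 : tau <= 1.
  by rewrite invf_le1 ?mulr_gt0 ?addr_gt0// mulr_ege1 ?ler1n// lerDr ltW.
(* With A = r0/(n+1), the starting point is within A/4 of x0 and the displacement is at most 2
   (A/8); both end points stay in the ball where the graph describes Omega. *)
exists (r0 / (4 * n.+1%:R)), tau, (r0 / (8 * n.+1%:R)), e.
have r4 : 0 < r0 / (4 * n.+1%:R) by rewrite divr_gt0// mulr_gt0.
have r8 : 0 < r0 / (8 * n.+1%:R) by rewrite divr_gt0// mulr_gt0.
split => //; first by rewrite tau0.
move=> x Ox xx0 t w /andP[t0 th] wt.
have nw : n%:R * `|w| <= n%:R * tau by rewrite ler_wpM2l.
have ew : `|dotp e w| <= n%:R * tau.
  rewrite (le_trans (norm_dotp_le _ _))// (le_trans _ nw)// ler_wpM2l//.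
  by rewrite -[leRHS]mul1r ler_wpM2r.
have near_x0 y : `|y - x0| < r0 / n.+1%:R -> enorm (y - x0) < r0.
  move=> yx0; rewrite (le_lt_trans (enorm_le_norm _))//.
  rewrite (@le_lt_trans _ _ (n.+1%:R * `|y - x0|))//.
    by rewrite ler_wpM2r// ler_nat.
  by rewrite mulrC -ltr_pdivlMr.
have small (k : R) : r0 / (k * n.+1%:R) = (r0 / n.+1%:R) / k.
  by rewrite invfM mulrA mulrAC.
have A0 : 0 < r0 / n.+1%:R by rewrite divr_gt0.
move: r4 r8 xx0 th; rewrite !small; set A := r0 / _ in A0 near_x0 *.
move=> r4 r8 xx0 th.
have gx : gamma (x - dotp e x *: e) < dotp e x.
  by apply/gO => //; apply: near_x0; apply: lt_le_trans xx0 _; lra.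
apply/gO.
  apply: near_x0; rewrite addrAC (le_lt_trans (ler_normD _ _))// normrZ gtr0_norm//.
  have ew2 : `|e + w| <= 2.
    by rewrite (le_trans (ler_normD _ _))// (_ : 2 = 1 + 1)// lerD// (le_trans wt).
  have : t * `|e + w| <= A / 8 * 2 by rewrite ler_pM// ltW.
  lra.
have proj0 y : dotp e (y - dotp e y *: e) = 0 by rewrite dotpBr dotpZr ee mulr1 subrr.
have dE : dotp e (x + t *: (e + w)) = dotp e x + t * (1 + dotp e w).
  by rewrite dotpDr dotpZr dotpDr ee.
have := gL _ _ (proj0 (x + t *: (e + w))) (proj0 x).
rewrite (_ : _ - _ - (x - _) = t *: (w - dotp e w *: e)); last first.
  by apply/rowP => i; rewrite dE !mxE; ring.
rewrite normrZ gtr0_norm// => gle.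
have nwe : `|w - dotp e w *: e| <= n.+1%:R * tau.
  rewrite (le_trans (ler_normB _ _))// normrZ -nat1r mulrDl mul1r lerD//.
  by rewrite -[leRHS]mulr1 ler_pM.
move: gle; rewrite dE ler_norml => /andP[_]; rewrite lerBlDr => gle.
apply: (le_lt_trans gle).
have : L * (t * `|w - dotp e w *: e|) <= t * (1 + dotp e w).
  rewrite mulrCA ler_wpM2l ?(ltW t0)//.
  apply: (@le_trans _ _ (L * (n.+1%:R * tau))); first by rewrite ler_wpM2l// ltW.
  move: ew; rewrite ler_norml => /andP[ew _].
  have H1 : n%:R * tau <= n.+1%:R * tau by rewrite ler_wpM2r ?ler_nat// ltW.
  have H2 : L * (n.+1%:R * tau) + n.+1%:R * tau = 1 by rewrite -[RHS]tauE; ring.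
  lra.
by move=> H; lra.
Qed.

Lemma cone_condition_lipschitz (Omega : set 'rV[R]_n) x0 :
  bounded_lipschitz_domain Omega -> closure Omega x0 ->
  exists r tau h e, cone_condition Omega x0 r tau h e.
Proof.
move=> [_ oO _ _ lO] cx0; have [Ox0|nO] := pselect (Omega x0).
  exact: cone_condition_interior.
apply: cone_condition_boundary => //; split=> // /interior_subset; exact: nO.
Qed.

End cone_condition.

(** * Mollifiers supported in a cone and their telescoping fields *)

Section cone_kernels.
Context {R : realType} {n : nat}.
Variables (e : 'rV[R]_n) (tau : R).
Hypotheses (tau01 : 0 < tau <= 1) (e1 : `|e| <= 1).
Implicit Types (x y z : 'rV[R]_n) (r s : R) (i j : 'I_n).

Let a : R := tau / 4.
Let A : R := (2 * a)^-1.

(** Close enough to 1 that the kernels at scales r and [lam * r], both of half-width a = tau/4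
    relative to their scale, fit in the same cross-section of the cone: their centres differ by at
    most r tau/8 in each coordinate. *)
Definition cone_ratio : R := 1 - tau / 8.
Local Notation lam := cone_ratio.

Let tau0 : 0 < tau. Proof. by case/andP: tau01. Qed.
Let tau1 : tau <= 1. Proof. by case/andP: tau01. Qed.
Let a0 : 0 < a. Proof. by rewrite divr_gt0. Qed.
Let A0 : 0 < A. Proof. by rewrite invr_gt0 mulr_gt0. Qed.

Lemma cone_ratio_gt0 : 0 < lam.
Proof. by move: tau0 tau1; rewrite /cone_ratio; lra. Qed.

Lemma cone_ratio_lt1 : lam < 1.
Proof. by move: tau0 tau1; rewrite /cone_ratio; lra. Qed.

(** As a function of (s - x_j)/r, climbs from 0 to 1 across [e_j - a, e_j + a]; its derivative
    [bump] is the one-dimensional mollifier. *)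
Let ramp r x j : R -> R :=
  fun s => smooth_step (A / r * s + (A * (a - e ord0 j) - A / r * x ord0 j)).

Let bump r x j : R -> R := derive1 (ramp r x j).

Let arg r x j s : R := A / r * s + (A * (a - e ord0 j) - A / r * x ord0 j).

Let argE r x j s : 0 < r ->
  arg r x j s = ((s - x ord0 j) / r - e ord0 j + a) / (2 * a).
Proof. by move=> r0; rewrite /arg /A; field; rewrite !gt_eqF. Qed.

Let bumpE r x j s : bump r x j s = A / r * derive1 smooth_step (arg r x j s).
Proof. exact: derive1_step_affine. Qed.

Let smooth1_ramp r x j : smooth1 (ramp r x j).
Proof. by apply: smooth1_affine; exact: smooth1_smooth_step. Qed.

Let smooth1_bump r x j : smooth1 (bump r x j).
Proof. exact: smooth1_derive. Qed.

Let bump_ge0 r x j s : 0 < r -> 0 <= bump r x j s.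
Proof.
by move=> r0; rewrite bumpE mulr_ge0 ?derive1_smooth_step_ge0// divr_ge0// ltW.
Qed.

Let bump_le r x j s : 0 < r -> bump r x j s <= A * smooth_step_slope / r.
Proof.
move=> r0; rewrite bumpE [leRHS]mulrAC ler_wpM2l ?derive1_smooth_step_le//.
by rewrite divr_ge0// ltW.
Qed.

Let bump_neq0 r x j s : 0 < r -> bump r x j s != 0 ->
  r * (e ord0 j - a) <= s - x ord0 j <= r * (e ord0 j + a).
Proof.
move=> r0; rewrite bumpE mulf_eq0 negb_or => /andP[_ H].
have /andP[s0 s1] : 0 < arg r x j s < 1.
  rewrite !ltNge; apply/andP; split; apply: contra H => H;
    by rewrite derive1_smooth_step_eq0//; first [by left|by right].
move: s0 s1; rewrite argE// pmulr_lgt0 ?invr_gt0 ?mulr_gt0// => s0.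
rewrite ltr_pdivrMr ?mulr_gt0// mul1r => s1.
have -> : s - x ord0 j = r * ((s - x ord0 j) / r) by field; rewrite gt_eqF.
by rewrite !ler_pM2l//; apply/andP; split; lra.
Qed.

Let bump_ge r x j s : 0 < r -> `|s - x ord0 j - r * e ord0 j| <= r * (a / 2) ->
  A * smooth_step_min / r <= bump r x j s.
Proof.
move=> r0; rewrite ler_norml => /andP[s1 s2].
have q1 : e ord0 j - a / 2 <= (s - x ord0 j) / r.
  by rewrite ler_pdivlMr//; lra.
have q2 : (s - x ord0 j) / r <= e ord0 j + a / 2.
  by rewrite ler_pdivrMr//; lra.
rewrite bumpE [leLHS]mulrAC ler_wpM2l//; first by rewrite divr_ge0// ltW.
rewrite argE//; apply: derive1_smooth_step_ge.
  by rewrite ler_pdivlMr ?mulr_gt0//; lra.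
by rewrite ler_pdivrMr ?mulr_gt0//; lra.
Qed.

Let ramp_eq0 r x j s : 0 < r -> s - x ord0 j <= r * (e ord0 j - a) -> ramp r x j s = 0.
Proof.
move=> r0; rewrite -ler_pdivrMl// [_^-1 * _]mulrC => H.
apply: smooth_step_eq0; rewrite -/(arg r x j s) argE//.
by rewrite pmulr_lle0 ?invr_gt0 ?mulr_gt0//; lra.
Qed.

Let ramp_eq1 r x j s : 0 < r -> r * (e ord0 j + a) <= s - x ord0 j -> ramp r x j s = 1.
Proof.
move=> r0; rewrite -ler_pdivlMl// [_^-1 * _]mulrC => H.
apply: smooth_step_eq1; rewrite -/(arg r x j s) argE//.
by rewrite ler_pdivlMr ?mulr_gt0//; lra.
Qed.

Let e_bound j : -1 <= e ord0 j <= 1.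
Proof. by rewrite -ler_norml (le_trans (coord_le_norm e j)). Qed.

(** For r' between [lam * r] and r, the interval of half-width r' a about r' e_j lies in the one of
    half-width r tau about r e_j, because (r - r')|e_j| <= r tau/8 and r' a <= r tau/4. *)
Let hull r r' j : 0 < r -> lam * r <= r' -> r' <= r ->
  r * (e ord0 j - tau) <= r' * (e ord0 j - a) /\
  r' * (e ord0 j + a) <= r * (e ord0 j + tau).
Proof.
move=> r0 lr rr; have /andP[em ep] := e_bound j.
have rt : 0 <= r * tau by rewrite mulr_ge0// ltW.
have d0 : 0 <= r - r' by rewrite subr_ge0.
have dr : r - r' <= r * tau / 8 by move: lr; rewrite /cone_ratio; lra.
have rta : r' * a <= r * tau / 4.
  by rewrite /a mulrA ler_wpM2r// ler_wpM2r// ltW.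
have H1 : (r - r') * e ord0 j <= r - r' by rewrite -[leRHS]mulr1 ler_wpM2l.
have H2 : - (r - r') <= (r - r') * e ord0 j by rewrite -mulrN1 ler_wpM2l.
rewrite !mulrBr !mulrDr; move: H1 H2; rewrite mulrBl => H1 H2; split; lra.
Qed.

Let hull_bound r j : 0 < r ->
  - (2 * r) <= r * (e ord0 j - tau) /\ r * (e ord0 j + tau) <= 2 * r.
Proof.
move=> r0; have /andP[em ep] := e_bound j; have t1 := tau1.
split; rewrite -subr_ge0.
  have -> : r * (e ord0 j - tau) - - (2 * r) = r * (e ord0 j - tau + 2) by ring.
  by rewrite mulr_ge0 ?(ltW r0)//; lra.
have -> : 2 * r - r * (e ord0 j + tau) = r * (2 - (e ord0 j + tau)) by ring.
by rewrite mulr_ge0 ?(ltW r0)//; lra.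
Qed.

Let ramp_diff_neq0 r x j s : 0 < r -> ramp r x j s - ramp (lam * r) x j s != 0 ->
  r * (e ord0 j - tau) <= s - x ord0 j <= r * (e ord0 j + tau).
Proof.
move=> r0 H; have lr0 : 0 < lam * r by rewrite mulr_gt0// cone_ratio_gt0.
have lrr : lam * r <= r by rewrite ler_piMl ?(ltW r0)// ltW// cone_ratio_lt1.
have [h1 h2] := hull j r0 lrr (lexx r).
have [h3 h4] := hull j r0 (lexx _) lrr.
apply/andP; split; rewrite leNgt; apply: contra H => H.
  by rewrite !ramp_eq0 ?subrr// (le_trans (ltW H)).
by rewrite !ramp_eq1 ?subrr// (le_trans _ (ltW H)).
Qed.

Let ramp_diff_le r r' x j s : `|ramp r x j s - ramp r' x j s| <= 1.
Proof.
have := smooth_step_ge0 (arg r x j s); have := smooth_step_le1 (arg r x j s).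
have := smooth_step_ge0 (arg r' x j s); have := smooth_step_le1 (arg r' x j s).
by rewrite /ramp -!/(arg _ _ _ _) ler_norml; lra.
Qed.

Definition cone_kernel r x : 'rV[R]_n -> R := tensor (bump r x).

(** A single ramp stays equal to 1 far to the right. The difference of two ramps has compact
    support, and its derivative is the difference of the two bumps. *)
Let field_factor r x i j : R -> R :=
  if (j < i)%N then bump (lam * r) x j
  else if j == i then ramp r x j \- ramp (lam * r) x j else bump r x j.

(* The coordinates below i are already at the finer scale lam * r, those above
   i still at scale r: summing the i-th partial derivatives telescopes. *)
Definition cone_field r x i : 'rV[R]_n -> R := tensor (field_factor r x i).

Let smooth1_field r x i j : smooth1 (field_factor r x i j).
Proof.
rewrite /field_factor; case: ifPn => // _; case: ifPn => // _.
exact: smooth1B.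
Qed.

Let mixed r x (k : nat) : 'rV[R]_n -> R :=
  tensor (fun j => if (j < k)%N then bump (lam * r) x j else bump r x j).

Let partial_cone_field r x i y :
  partial i (cone_field r x i) y = mixed r x i y - mixed r x i.+1 y.
Proof.
rewrite /cone_field partial_tensor// /mixed /tensor.
rewrite (bigD1 i)//= eqxx.
rewrite [X in _ = X - _](bigD1 i)//= [X in _ = _ - X](bigD1 i)//= ltnn leqnn.
have dE : derive1 (field_factor r x i i) (y ord0 i) =
    bump r x i (y ord0 i) - bump (lam * r) x i (y ord0 i).
  have H := is_deriveB (smooth1_is_derive (smooth1_ramp r x i) (y ord0 i))
    (smooth1_is_derive (smooth1_ramp (lam * r) x i) (y ord0 i)).
  by rewrite /field_factor ltnn eqxx derive1E; have [_ ->] := H.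
rewrite dE mulrBl; congr (_ * _ - _ * _); apply: eq_bigr => j ji;
  rewrite (negbTE ji) /field_factor (negbTE ji)//.
by rewrite (_ : (j < i.+1)%N = (j < i)%N)// ltnS leq_eqVlt val_eqE (negbTE ji).
Qed.

Lemma sum_partial_cone_field r x y :
  \sum_(i < n) partial i (cone_field r x i) y =
  cone_kernel r x y - cone_kernel (lam * r) x y.
Proof.
under eq_bigr do rewrite partial_cone_field.
rewrite -(big_mkord xpredT (fun k => mixed r x k y - mixed r x k.+1 y)).
transitivity (- mixed r x n y - (- mixed r x 0 y)).
  rewrite -(telescope_sumr (fun k => - mixed r x k y) (leq0n n)).
  by apply: eq_bigr => k _; rewrite opprK addrC.
rewrite opprK addrC; congr (_ - _).
by rewrite /mixed /tensor; apply: eq_bigr => j _; rewrite ltn_ord.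
Qed.

(** By [hull] the support lies in x + r(e + w) with |w| <= tau, a section of the cone contained in
    Omega. This admits the field in the definition of the weak derivative. *)
Lemma cone_field_test (Omega : set 'rV[R]_n) x0 r0 h r x i :
  cone_condition Omega x0 r0 tau h e -> Omega x -> `|x - x0| < r0 ->
  0 < r -> r <= h -> test_function Omega (cone_field r x i).
Proof.
move=> [_ _ _ _ cO] Ox xx0 r_gt0 rh.
have lr0 : 0 < lam * r by rewrite mulr_gt0// cone_ratio_gt0.
have lrr : lam * r <= r by rewrite ler_piMl ?(ltW r_gt0)// ltW// cone_ratio_lt1.
apply: (@tensor_test_function _ _ _ _
  (fun j => x ord0 j + r * (e ord0 j - tau)) (fun j => x ord0 j + r * (e ord0 j + tau))) => //.
  move=> j t tn0.
  have [h1 h2] := hull j r_gt0 lrr (lexx r).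
  have [h3 h4] := hull j r_gt0 (lexx _) lrr.
  move: tn0; rewrite /field_factor; case: ifPn => _.
    by move=> /(bump_neq0 lr0)/andP[H1 H2]; apply/andP; split; lra.
  case: ifPn => _; first by move=> /(ramp_diff_neq0 r_gt0)/andP[H1 H2]; apply/andP; split; lra.
  by move=> /(bump_neq0 r_gt0)/andP[H1 H2]; apply/andP; split; lra.
move=> y /= yB.
have -> : y = x + r *: (e + (r^-1 *: (y - x) - e)).
  by apply/rowP => j; rewrite !mxE; field; rewrite gt_eqF.
apply: cO => //; first by rewrite r_gt0.
apply/rV_norm_leP => [|j]; first exact: ltW.
have /andP[y1 y2] := yB j; rewrite !mxE ler_norml lerBrDr lerBlDr.
rewrite mulrC ler_pdivlMr// ler_pdivrMr//.
by apply/andP; split; lra.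
Qed.

Let field_support r x i y : 0 < r -> cone_field r x i y != 0 -> `|y - x| <= 2 * r.
Proof.
move=> r0; rewrite prodf_seq_neq0 => /allP H.
have lr0 : 0 < lam * r by rewrite mulr_gt0// cone_ratio_gt0.
have lrr : lam * r <= r by rewrite ler_piMl ?(ltW r0)// ltW// cone_ratio_lt1.
apply/rV_norm_leP => [|j]; first by rewrite mulr_ge0// ltW.
have [h1 h2] := hull j r0 lrr (lexx r).
have [h3 h4] := hull j r0 (lexx _) lrr.
have : r * (e ord0 j - tau) <= y ord0 j - x ord0 j <= r * (e ord0 j + tau).
  have := H j; rewrite mem_index_enum => /(_ isT) /=; rewrite /field_factor; case: ifPn => _.
    by move=> /(bump_neq0 lr0)/andP[H1 H2]; apply/andP; split; lra.
  case: ifPn => _; first by move=> /(ramp_diff_neq0 r0).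
  by move=> /(bump_neq0 r0)/andP[H1 H2]; apply/andP; split; lra.
have [b1 b2] := hull_bound j r0.
by move=> /andP[H1 H2]; rewrite !mxE ler_norml; apply/andP; split; lra.
Qed.

(** The division by [lam] makes the bound valid also for the bumps at the finer scale [lam * r]. *)
Definition cone_slope : R := A * smooth_step_slope / lam.

Lemma cone_slope_ge0 : 0 <= cone_slope.
Proof.
by rewrite divr_ge0 ?(ltW cone_ratio_gt0)// mulr_ge0 ?(ltW A0)// mulr_ge0// expR_ge0.
Qed.

Let slope_ge r : 0 < r -> A * smooth_step_slope / r <= cone_slope / r.
Proof.
move=> r0; rewrite ler_wpM2r ?invr_ge0 ?(ltW r0)// /cone_slope.
rewrite ler_pdivlMr ?cone_ratio_gt0// ler_piMr ?(ltW cone_ratio_lt1)//.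
by rewrite mulr_ge0 ?(ltW A0)// mulr_ge0// expR_ge0.
Qed.

(** One factor, the difference of ramps, is at most 1 and only the n-1 bumps cost 1/r each: this is
    the gain of one power of r over the kernel. The radius 2r comes from |e| <= 1 and tau <= 1. *)
Lemma cone_field_le r x i y : 0 < r ->
  `|cone_field r x i y| <= (cone_slope / r) ^+ n.-1 * (\1_(cube x (2 * r)) y).
Proof.
move=> r0; have [->|fN0] := eqVneq (cone_field r x i y) 0.
  by rewrite normr0 mulr_ge0// exprn_ge0// divr_ge0 ?cone_slope_ge0// ltW.
rewrite indicE mem_set ?mulr1; last exact: field_support fN0.
have lr0 : 0 < lam * r by rewrite mulr_gt0// cone_ratio_gt0.
rewrite /cone_field /tensor normr_prod (bigD1 i)//= -[leRHS]mul1r ler_pM//.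
- exact: prodr_ge0.
- by rewrite /field_factor ltnn eqxx ramp_diff_le.
- apply: (@le_trans _ _ (\prod_(j < n | j != i) (cone_slope / r))).
    apply: ler_prod => j ji; rewrite normr_ge0/= /field_factor (negbTE ji).
    case: ifPn => _; rewrite ger0_norm ?bump_ge0//.
      apply: (le_trans (bump_le _ _ _ lr0)).
      by rewrite /cone_slope -[leRHS]mulrA -invfM.
    exact: (le_trans (bump_le _ _ _ r0)) (slope_ge r0).
  rewrite prodr_const (_ : #|_| = n.-1)// -[in RHS](card_ord n) -(cardC1 i).
  by apply: eq_card => j; rewrite !inE.
Qed.

Lemma cone_kernel_ge0 r x y : 0 < r -> 0 <= cone_kernel r x y.
Proof. by move=> r0; apply: prodr_ge0 => j _; exact: bump_ge0. Qed.

Lemma cone_kernel_le r x y : 0 < r ->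
  cone_kernel r x y <= (cone_slope / r) ^+ n * (\1_(cube x (2 * r)) y).
Proof.
move=> r0; have [->|kN0] := eqVneq (cone_kernel r x y) 0.
  by rewrite mulr_ge0// exprn_ge0// divr_ge0 ?cone_slope_ge0// ltW.
have lrr : lam * r <= r by rewrite ler_piMl ?(ltW r0)// ltW// cone_ratio_lt1.
rewrite indicE mem_set ?mulr1.
  rewrite -[n in X in _ <= X]card_ord -prodr_const; apply: ler_prod => j _.
  by rewrite bump_ge0//= (le_trans (bump_le _ _ _ r0)) ?slope_ge.
move: kN0; rewrite prodf_seq_neq0 => /allP H.
apply/rV_norm_leP => [|j]; first by rewrite mulr_ge0// ltW.
have [h1 h2] := hull j r0 lrr (lexx r).
have := H j; rewrite mem_index_enum => /(_ isT) /= /(bump_neq0 r0)/andP[H1 H2].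
have [b1 b2] := hull_bound j r0.
by rewrite !mxE ler_norml; apply/andP; split; lra.
Qed.

Definition cone_floor : R := A * smooth_step_min.

Lemma cone_floor_gt0 : 0 < cone_floor.
Proof. by rewrite mulr_gt0// smooth_step_min_gt0. Qed.

(** On the central half of the support the argument of every smooth step stays in [1/4, 3/4]. The
    resulting lower bound for the mass of the kernel takes the place of a normalisation. *)
Lemma cone_kernel_ge r x y : 0 < r -> cube (x + r *: e) (r * (tau / 8)) y ->
  (cone_floor / r) ^+ n <= cone_kernel r x y.
Proof.
move=> r0; have rt0 : 0 <= r * (tau / 8) by rewrite mulr_ge0 ?divr_ge0// ltW.
move=> /(rV_norm_leP _ rt0) H.
rewrite -[n in X in X <= _]card_ord -prodr_const; apply: ler_prod => j _.
rewrite divr_ge0 ?(ltW cone_floor_gt0) ?(ltW r0)//=.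
apply: bump_ge => //; have := H j; rewrite !mxE opprD addrA.
by rewrite (_ : a / 2 = tau / 8)// /a; field.
Qed.

Lemma smooth_cone_kernel r x : smooth (cone_kernel r x).
Proof. exact: smooth_tensor. Qed.

End cone_kernels.

(** * Masses in cubes and Tonelli's theorem *)

Section local_average.
Context {R : realType} {n : nat}.
Variable D : set 'rV[R]_n.
Hypothesis mD : measurable D.
Local Notation mu := (lebesgue_rV n : {sigma_finite_measure set 'rV[R]_n -> \bar R}).
Implicit Types (x y : 'rV[R]_n) (r : R) (g : 'rV[R]_n -> R) (E : set 'rV[R]_n).

Lemma cube_sym x y r : cube x r y <-> cube y r x.
Proof. by rewrite /cube/= distrC. Qed.

Definition local_mass g r x : \bar R :=
  (\int[mu]_(y in D) (`|g y| * \1_(cube x r) y)%:E)%E.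

Let rel r : set ('rV[R]_n * 'rV[R]_n) := [set z | cube z.1 r z.2].

Let mrel r : measurable (rel r).
Proof.
have [r0|r0] := leP 0 r; last first.
  rewrite (_ : rel r = set0)//; apply/seteqP; split => // z; rewrite /rel/cube/= => yr.
  by move: r0; rewrite ltNge (le_trans _ yr).
rewrite (_ : rel r = \bigcap_(i in [set: 'I_n])
  ((fun z : 'rV[R]_n * 'rV[R]_n => z.2 ord0 i - z.1 ord0 i) @^-1` `[- r, r])).
  apply: fin_bigcap_measurable => // i _; rewrite -[X in measurable X]setTI.
  have : measurable_fun setT (fun z : 'rV[R]_n * 'rV[R]_n => z.2 ord0 i - z.1 ord0 i).
    apply: measurable_funB.
      exact: (measurableT_comp (measurable_coord i) measurable_snd).
    exact: (measurableT_comp (measurable_coord i) measurable_fst).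
  by apply.
apply/seteqP; split => z; rewrite /rel/cube/=.
  by move=> /(rV_norm_leP _ r0) H i _; have := H i; rewrite /= in_itv/= !mxE ler_norml.
move=> H; apply/(rV_norm_leP _ r0) => i; have := H i I.
by rewrite /= in_itv/= !mxE ler_norml.
Qed.

Let ker g r (z : 'rV[R]_n * 'rV[R]_n) : \bar R :=
  (((fun y => `|g y|) \_ D) z.2 * \1_(rel r) z)%:E.

Let mker g r : measurable_fun D g -> measurable_fun setT (ker g r).
Proof.
move=> mg; apply/measurable_EFinP; apply: measurable_funM.
  have : measurable_fun setT ((fun y => `|g y|) \_ D).
    apply/(measurable_restrictT _ mD).
    exact: (measurableT_comp (@normr_measurable R setT) mg).
  by move=> h; exact: (measurableT_comp h measurable_snd).
exact: measurable_indic.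
Qed.

Let ker0 g r z : (0 <= ker g r z)%E.
Proof.
by rewrite lee_fin mulr_ge0// patchE; case: ifPn.
Qed.

Let local_massE g r x : local_mass g r x = fubini_F mu (ker g r) x.
Proof.
rewrite /local_mass integral_mkcond; apply: eq_integral => y _.
rewrite /ker !patchE; case: ifPn => _ /=; last by rewrite mul0r.
by congr (_ * _)%:E; rewrite !indicE; congr (_ _)%:R; apply/idP/idP => /set_mem H; exact/mem_set.
Qed.

Lemma measurable_local_mass g r : measurable_fun D g ->
  measurable_fun setT (local_mass g r).
Proof.
move=> mg; rewrite (_ : local_mass g r = fubini_F mu (ker g r)).
  apply: measurable_fun_fubini_tonelli_F; first exact: mker.
  by move=> z; exact: ker0.
by apply/funext => x; exact: local_massE.
Qed.

Lemma local_mass_ge0 g r x : (0 <= local_mass g r x)%E.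
Proof. by apply: integral_ge0 => y _; rewrite lee_fin mulr_ge0. Qed.

(** Tonelli together with the symmetry of the relation |x - y| <= r. The information on E is now a
    weight on g. *)
Lemma integral_local_mass E g r : measurable E -> measurable_fun D g ->
  (\int[mu]_(x in E) local_mass g r x =
   \int[mu]_(y in D) (`|g y|%:E * mu (E `&` cube y r)))%E.
Proof.
move=> mE mg.
pose k (z : 'rV[R]_n * 'rV[R]_n) : \bar R := (ker g r z * (\1_E z.1)%:E)%E.
have mk : measurable_fun setT k.
  apply: emeasurable_funM; first exact: mker.
  apply/measurable_EFinP.
  have mi : measurable_fun setT (\1_E : 'rV[R]_n -> R) by exact: measurable_indic.
  exact: (measurableT_comp mi measurable_fst).
have k0 z : (0 <= k z)%E by rewrite mule_ge0// lee_fin.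
transitivity (\int[mu]_x fubini_F mu k x)%E.
  rewrite integral_mkcond; apply: eq_integral => x _.
  rewrite patchE; case: ifPn => xE /=.
    by rewrite local_massE; apply: eq_integral => y _; rewrite /k /= indicE xE mule1.
  by rewrite /fubini_F integral0_eq// => y _; rewrite /k /= indicE (negbTE xE) mule0.
rewrite fubini_tonelli// [RHS]integral_mkcond; apply: eq_integral => y _.
rewrite /fubini_G /k /ker !patchE /=; case: ifPn => yD /=; last first.
  by rewrite integral0_eq// => x _; rewrite patchE (negbTE yD) mul0r mul0e.
transitivity (\int[mu]_x (`|g y|%:E * (\1_(E `&` cube y r) x)%:E))%E.
  apply: eq_integral => x _; rewrite patchE yD.
  have -> : \1_(rel r) (x, y) = \1_(cube y r) x :> R.
    by rewrite !indicE; congr (_ _)%:R; apply/idP/idP => /set_mem /cube_sym H; exact/mem_set.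
  by rewrite -!EFinM indicI /=; congr EFin; ring.
have mEy : measurable (E `&` cube y r).
  by apply: measurableI => //; exact: measurable_cube.
rewrite ge0_integralZl//; first by rewrite integral_indic ?setIT.
by apply/measurable_EFinP; exact: measurable_indic.
Qed.

Lemma local_mass_le g r x : measurable_fun D g ->
  (local_mass g r x <= \int[mu]_(y in D) `|g y|%:E)%E.
Proof.
move=> mg; apply: ge0_le_integral => //.
- apply/measurable_EFinP; apply: measurable_funM.
    exact: (measurableT_comp (@normr_measurable R setT) mg).
  by apply: measurable_funTS; apply: measurable_indic; exact: measurable_cube.
- apply/measurable_EFinP; exact: (measurableT_comp (@normr_measurable R setT) mg).
- by move=> y _; rewrite lee_fin ler_piMr// indicE; case: (_ \in _).
Qed.

(** The factor (2r)^n compensates the r^(-n) in the size of the kernel: averaging is bounded on L^1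
    uniformly in the scale. *)
Lemma integral_local_mass_le E g r : 0 <= r -> measurable E -> measurable_fun D g ->
  (\int[mu]_(x in E) local_mass g r x <=
   ((2 * r) ^+ n)%:E * \int[mu]_(y in D) `|g y|%:E)%E.
Proof.
move=> r0 mE mg; have mng : measurable_fun D (fun y => `|g y|%:E).
  apply/measurable_EFinP; exact: (measurableT_comp (@normr_measurable R setT) mg).
rewrite integral_local_mass// -ge0_integralZl//; last first.
  by rewrite lee_fin exprn_ge0// mulr_ge0.
have mm : measurable_fun setT (fun y => mu (E `&` cube y r)).
  have H : measurable (rel r `&` (snd @^-1` E)).
    apply: measurableI => //; rewrite -[X in measurable X]setTI; exact: measurable_snd.
  have := @measurable_fun_xsection _ _ _ _ _ mu _ H.
  congr measurable_fun; apply/funext => y /=; congr (mu _); apply/seteqP; split => x.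
    by rewrite /xsection/= inE /rel/= => -[? ?].
  by rewrite /xsection/= inE /rel/= => -[? ?].
apply: ge0_le_integral => //.
- by move=> *; rewrite mule_ge0.
- by apply: emeasurable_funM => //; exact: measurable_funTS.
- by apply: emeasurable_funM.
- move=> y _; rewrite muleC lee_wpmul2r// -(lebesgue_rV_cube y r0).
  apply: le_measure; rewrite ?inE; [|exact: measurable_cube|by move=> x []].
  by apply: measurableI => //; exact: measurable_cube.
Qed.

End local_average.

Section integrable_mul.
Context d (T : measurableType d) (R : realType).
Variables (mu : {measure set T -> \bar R}) (D : set T).
Hypothesis mD : measurable D.
Implicit Types (f g : T -> R).

Lemma integrable_mul_bounded f g (M : R) : mu.-integrable D (EFin \o f) ->
  measurable_fun D g -> (forall x, D x -> `|g x| <= M) ->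
  mu.-integrable D (EFin \o (fun x => f x * g x)).
Proof.
move=> if_ mg gM; have mf : measurable_fun D f.
  by apply/measurable_EFinP; exact: measurable_int if_.
apply: (le_integrable mD _ _ (integrableZl mD M (integrable_abse if_))).
  by apply/measurable_EFinP; exact: measurable_funM.
move=> x Dx; rewrite /= lee_fin !normrM normr_id mulrC ler_wpM2r//.
by rewrite (le_trans (gM x Dx))// ler_norm.
Qed.

Lemma Rintegral_sum (I : Type) (s : seq I) (F : I -> T -> R) :
  (forall i, mu.-integrable D (EFin \o F i)) ->
  \int[mu]_(x in D) (\sum_(i <- s) F i x) = \sum_(i <- s) \int[mu]_(x in D) F i x.
Proof.
move=> iF; elim: s => [|i s IH].
  by under eq_Rintegral do rewrite big_nil; rewrite big_nil Rintegral_cst// mul0r.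
rewrite big_cons -IH -RintegralD//; first by apply: eq_Rintegral => x _; rewrite big_cons.
rewrite (_ : EFin \o _ = (fun x => \sum_(j <- s) (EFin \o F j) x)%E).
  exact: integrable_sum.
by apply/funext => x /=; rewrite sumEFin.
Qed.

Lemma normr_Rintegral_le f : mu.-integrable D (EFin \o f) ->
  (`|\int[mu]_(x in D) f x|%:E <= \int[mu]_(x in D) `|f x|%:E)%E.
Proof.
move=> if_; rewrite EFin_normr_Rintegral//.
by apply: le_abse_integral => //; exact: measurable_int if_.
Qed.

End integrable_mul.

Section test_functions.
Context {R : realType} {n : nat}.
Variable Omega : set 'rV[R]_n.
Implicit Types (phi : 'rV[R]_n -> R).

Lemma test_function_bounded phi : test_function Omega phi ->
  exists M : R, forall x, `|phi x| <= M.
Proof.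
move=> [sphi cphi _]; have cf := smooth_continuous sphi.
have /compact_bounded[M [Mr HM]] : compact (phi @` closure [set x | phi x != 0]).
  by apply: continuous_compact => //; exact: continuous_subspaceT.
exists (`|M| + 1) => x; have [->|nz] := eqVneq (phi x) 0.
  by rewrite normr0 addr_ge0.
apply: (HM (`|M| + 1)); first by rewrite (le_lt_trans (ler_norm M))// ltrDl.
by exists x => //; exact: subset_closure.
Qed.

Lemma test_function_partial phi i : test_function Omega phi ->
  test_function Omega (partial i phi).
Proof.
move=> [sphi cphi phiO].
have sub : closure [set x | partial i phi x != 0] `<=` closure [set x | phi x != 0].
  rewrite [X in _ `<=` X]((closure_id _).1 (@closed_closure _ _)).
  apply: closureS => x /= px; apply: contrapT => nx; move: px; apply/negP; rewrite negbK.
  have : \forall y \near x, phi y = 0.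
    have oC : open (~` closure [set x | phi x != 0]).
      by apply: closed_openC; exact: closed_closure.
    have : \forall y \near x, (~` closure [set x | phi x != 0]) y by exact: open_nbhs_nbhs.
    apply: filterS => y ny; apply/eqP; apply: contrapT => /negP phiy.
    by apply: ny; apply: subset_closure.
  move=> H; rewrite /partial (near_eq_derive _ (g := cst 0))//.
  by rewrite derive_cst.
split; [exact: smooth_partial| |exact: subset_trans sub phiO].
by apply: subclosed_compact sub => //; exact: closed_closure.
Qed.

Lemma test_function_measurable phi (D : set 'rV[R]_n) : test_function Omega phi ->
  measurable_fun D phi.
Proof.
move=> [sphi _ _]; apply: measurable_funTS; apply: rV_continuous_measurable.
exact: smooth_continuous.
Qed.

End test_functions.

(** * Cone averages at consecutive scales *)

Section local_estimate.
Context {R : realType} {n : nat}.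
Variables (Omega : set 'rV[R]_n) (x0 : 'rV[R]_n) (r0 tau h : R) (e : 'rV[R]_n).
Hypothesis oOmega : open Omega.
Local Notation mu := (lebesgue_rV n : {sigma_finite_measure set 'rV[R]_n -> \bar R}).
Hypothesis finO : (mu Omega < +oo)%E.
Hypothesis cO : cone_condition Omega x0 r0 tau h e.
Local Notation lam := (cone_ratio tau).
Local Notation cs := (cone_slope tau).

Let mO : measurable Omega. Proof. exact: rV_open_measurable. Qed.
Let tau01 : 0 < tau <= 1. Proof. by case: cO. Qed.
Let h0 : 0 < h. Proof. by case: cO. Qed.
Let e1 : `|e| <= 1. Proof. by case: cO. Qed.
Let tau0 : 0 < tau. Proof. by case/andP: tau01. Qed.

Definition cone_average (u : 'rV[R]_n -> R) r x : R :=
  \int[mu]_(y in Omega) (u y * cone_kernel e tau r x y).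

Lemma measurable_cone_kernel r x (A : set 'rV[R]_n) : measurable_fun A (cone_kernel e tau r x).
Proof.
apply: measurable_funTS; apply: rV_continuous_measurable.
by apply: smooth_continuous; exact: smooth_cone_kernel.
Qed.

Lemma normr_cone_kernel_le r x y : 0 < r -> `|cone_kernel e tau r x y| <= (cs / r) ^+ n.
Proof.
move=> r_gt0; rewrite ger0_norm ?cone_kernel_ge0// (le_trans (cone_kernel_le tau01 e1 x y r_gt0))//.
have c0 : 0 <= (cs / r) ^+ n.
  by rewrite exprn_ge0// divr_ge0 ?(cone_slope_ge0 tau01)// ltW.
by rewrite ler_piMr// indicE; case: (_ \in _).
Qed.

Lemma integrable_cone_kernel u r x : 0 < r -> mu.-integrable Omega (EFin \o u) ->
  mu.-integrable Omega (EFin \o (fun y => u y * cone_kernel e tau r x y)).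
Proof.
move=> r_gt0 iu; apply: (integrable_mul_bounded mO iu (M := (cs / r) ^+ n)).
  exact: measurable_cone_kernel.
by move=> y _; exact: normr_cone_kernel_le.
Qed.

Let integral_kernel_le (f g : 'rV[R]_n -> R) (k r : R) x : 0 <= k ->
  mu.-integrable Omega (EFin \o f) -> measurable_fun Omega g ->
  (forall y, `|g y| <= k * \1_(cube x r) y) ->
  (`|\int[mu]_(y in Omega) (f y * g y)|%:E <= k%:E * local_mass Omega f r x)%E.
Proof.
move=> k0 if_ mg gk; have mf : measurable_fun Omega f.
  by apply/measurable_EFinP; exact: measurable_int if_.
have mi : measurable_fun Omega (\1_(cube x r) : _ -> R).
  by apply: measurable_funTS; apply: measurable_indic; exact: measurable_cube.
have mnf : measurable_fun Omega (fun y => `|f y|).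
  exact: (measurableT_comp (@normr_measurable R setT) mf).
have ifg : mu.-integrable Omega (EFin \o (fun y => f y * g y)).
  apply: (integrable_mul_bounded mO if_ (M := k)) => // y _.
  by rewrite (le_trans (gk y))// ler_piMr// indicE; case: (_ \in _).
apply: (le_trans (normr_Rintegral_le mO ifg)).
have mli : measurable_fun Omega (fun y => (`|f y| * \1_(cube x r) y)%:E).
  by apply/measurable_EFinP; exact: measurable_funM.
rewrite /local_mass -(ge0_integralZl mu mO mli)//.
apply: ge0_le_integral => //.
- apply/measurable_EFinP.
  apply: (measurableT_comp (@normr_measurable R setT)).
  exact: measurable_funM.
- exact: measurable_funeM.
- by move=> y _; rewrite -EFinM lee_fin normrM mulrCA ler_wpM2l.
Qed.

Lemma cone_average_le u r x : 0 < r -> mu.-integrable Omega (EFin \o u) ->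
  (`|cone_average u r x|%:E <= ((cs / r) ^+ n)%:E * local_mass Omega u (2 * r) x)%E.
Proof.
move=> r_gt0 iu; apply: integral_kernel_le => //.
- by rewrite exprn_ge0// divr_ge0 ?(cone_slope_ge0 tau01)// ltW.
- exact: measurable_cone_kernel.
by move=> y; rewrite ger0_norm ?cone_kernel_ge0//; exact: cone_kernel_le.
Qed.

(** The difference of the two kernels is the divergence of [cone_field]; testing the weak
    derivatives with its components replaces u by Du, and the size r^(1-n) of the field gives the
    bound. *)
Lemma cone_average_step u (Du : 'I_n -> 'rV[R]_n -> R) r x :
  mu.-integrable Omega (EFin \o u) ->
  (forall i, mu.-integrable Omega (EFin \o Du i)) ->
  (forall i, weak_partial Omega i u (Du i)) ->
  Omega x -> `|x - x0| < r0 -> 0 < r -> r <= h ->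
  (`|cone_average u r x - cone_average u (lam * r) x|%:E <=
   ((cs / r) ^+ n.-1)%:E * \sum_(i < n) local_mass Omega (Du i) (2 * r) x)%E.
Proof.
move=> iu iDu wDu Ox xx0 r_gt0 rh.
have lr0 : 0 < lam * r by rewrite mulr_gt0// cone_ratio_gt0.
have T i : test_function Omega (cone_field e tau r x i).
  exact: (cone_field_test tau01 e1 i cO Ox xx0 r_gt0 rh).
have ifld i : mu.-integrable Omega (EFin \o (fun y => Du i y * cone_field e tau r x i y)).
  have [M HM] := test_function_bounded (T i).
  apply: (integrable_mul_bounded mO (iDu i) (M := M)) => //.
  exact: test_function_measurable (T i).
have iupart i : mu.-integrable Omega (EFin \o (fun y => u y * partial i (cone_field e tau r x i) y)).
  have [M HM] := test_function_bounded (test_function_partial i (T i)).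
  apply: (integrable_mul_bounded mO iu (M := M)) => //.
  exact: test_function_measurable (test_function_partial i (T i)).
have -> : cone_average u r x - cone_average u (lam * r) x =
    \sum_(i < n) - \int[mu]_(y in Omega) (Du i y * cone_field e tau r x i y).
  rewrite -RintegralB//; try exact: integrable_cone_kernel.
  rewrite (@eq_Rintegral _ _ _ _ _
    (fun y => \sum_(i < n) u y * partial i (cone_field e tau r x i) y)).
    rewrite Rintegral_sum//; apply: eq_bigr => i _.
    by have [_ _] := wDu i; apply.
  by move=> y _; rewrite -mulr_sumr sum_partial_cone_field// mulrBr.
apply: (@le_trans _ _ (\sum_(i < n) `|\int[mu]_(y in Omega) (Du i y * cone_field e tau r x i y)|%:E)%E).
  rewrite sumEFin lee_fin (le_trans (ler_norm_sum _ _ _))//.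
  by apply: ler_sum => i _; rewrite normrN.
have c0 : 0 <= (cs / r) ^+ n.-1.
  by rewrite exprn_ge0// divr_ge0 ?(cone_slope_ge0 tau01)// ltW.
rewrite ge0_sume_distrr; last by move=> i _; exact: local_mass_ge0.
apply: lee_sum => i _; apply: integral_kernel_le => //.
  exact: test_function_measurable (T i).
by move=> y; exact: cone_field_le.
Qed.

End local_estimate.

(** * Potential estimates and embeddings *)

Section geometric_sums.
Context {R : realType}.
Implicit Types (lam y t Q th : R).

(** With z = y lam^k, the terms with z <= 1 form a decreasing geometric sum and those with z >= 1 an
    increasing one. Both are at most 1/(1 - lam), independently of y and of the number of terms. *)
Lemma sum_min_geometric lam y N : 0 < lam < 1 -> 0 < y ->
  \sum_(k < N) Num.min (y * lam ^+ k) (y * lam ^+ k)^-1 <= 2 / (1 - lam).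
Proof.
move=> /andP[l0 l1] y0; have ul0 : 0 < 1 - lam by rewrite subr_gt0.
have small z M : 0 < z -> \sum_(k < M) Num.min (z * lam ^+ k) (z * lam ^+ k)^-1 <= z / (1 - lam).
  elim: M z => [|M IH] z z0; first by rewrite big_ord0 divr_ge0// ltW.
  rewrite big_ord_recl expr0 mulr1.
  under eq_bigr do rewrite /= /bump/= add1n exprS mulrA.
  have lz : 0 < z * lam by rewrite mulr_gt0.
  apply: (@le_trans _ _ (z + z * lam / (1 - lam))).
    by apply: lerD; [rewrite ge_min lexx|exact: IH].
  rewrite le_eqVlt; apply/orP; left; apply/eqP.
  by field; rewrite gt_eqF.
(* The subtracted term makes the induction close: passing from y to [y * lam] lowers the bound by
   exactly the first term 1/y. *)
suff H : 1 <= y -> \sum_(k < N) Num.min (y * lam ^+ k) (y * lam ^+ k)^-1 <=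
    2 / (1 - lam) - lam / (1 - lam) * y^-1.
  have [y1|y1] := leP 1 y.
    by rewrite (le_trans (H y1))// gerBl mulr_ge0// ?divr_ge0 ?invr_ge0// ltW.
  by rewrite (le_trans (small _ _ y0))// ler_pM2r ?invr_gt0//; lra.
elim: N y y0 => [|M IH] y y0 y1.
  rewrite big_ord0 subr_ge0 (le_trans (y := lam / (1 - lam)))//.
    by rewrite ler_piMr ?invf_le1// divr_ge0// ltW.
  by rewrite ler_pM2r ?invr_gt0//; lra.
rewrite big_ord_recl expr0 mulr1.
under eq_bigr do rewrite /= /bump/= add1n exprS mulrA.
have ly : 0 < y * lam by rewrite mulr_gt0.
apply: (@le_trans _ _ (y^-1 + \sum_(i < M) Num.min (y * lam * lam ^+ i) (y * lam * lam ^+ i)^-1)).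
  by rewrite lerD2r ge_min lexx orbT.
have [ly1|ly1] := leP 1 (y * lam).
  rewrite (le_trans (lerD (lexx _) (IH _ ly ly1)))//.
  rewrite le_eqVlt; apply/orP; left; apply/eqP; field.
  by rewrite !gt_eqF.
rewrite (le_trans (lerD (lexx _) (small _ _ ly)))//.
have iy : y^-1 <= 1 by rewrite invf_le1.
have -> : 2 / (1 - lam) - lam / (1 - lam) / y =
    y^-1 + (1 / (1 - lam) + (1 - y^-1) / (1 - lam)).
  by field; rewrite !gt_eqF.
rewrite lerD2l (le_trans (y := 1 / (1 - lam)))//.
  by rewrite ler_pM2r ?invr_gt0// ltW.
by rewrite lerDl divr_ge0// ?subr_ge0// ltW.
Qed.

(** The two bounds cross at the scale t, and a > 0 gives decay on both sides of it, so the sum is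
    comparable to the crossing value Q t. *)
Lemma sum_le_geometric lam h t Q a N (f : nat -> R) : 0 < lam < 1 -> 0 < h -> 0 < t ->
  0 <= Q -> (0 < a)%N -> (forall k, f k <= Q * (h * lam ^+ k)) ->
  (forall k, f k <= Q * t * (t / (h * lam ^+ k)) ^+ a) ->
  \sum_(k < N) f k <= 2 * Q * t / (1 - lam).
Proof.
move=> l01 h0 t0 Q0 a0 f1 f2; have /andP[l0 l1] := l01.
have ht : 0 < h / t by rewrite divr_gt0.
have := sum_min_geometric N l01 ht; move=> /(ler_wpM2l (mulr_ge0 Q0 (ltW t0))) H.
apply: (le_trans _ (le_trans H _)); last first.
  by rewrite le_eqVlt; apply/orP; left; apply/eqP; ring.
rewrite mulr_sumr; apply: ler_sum => k _.
have r0 : 0 < h * lam ^+ k by rewrite mulr_gt0// exprn_gt0.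
have E : h / t * lam ^+ k = h * lam ^+ k / t by ring.
have EQ : Q * (h * lam ^+ k) = Q * t * (h * lam ^+ k / t).
  by field; rewrite gt_eqF.
rewrite E minr_pMr; last by rewrite mulr_ge0// ltW.
rewrite invf_div le_min -EQ f1/=.
have [rt|rt] := leP t (h * lam ^+ k).
  rewrite (le_trans (f2 k))// ler_wpM2l ?mulr_ge0 ?(ltW t0)//.
  have q0 : 0 <= t / (h * lam ^+ k) by rewrite divr_ge0// ltW.
  by rewrite -[leRHS]expr1 ler_wiXn2l// ler_pdivrMr// mul1r.
rewrite (le_trans (f1 k))// EQ ler_wpM2l ?mulr_ge0 ?(ltW t0)//.
by rewrite (le_trans (y := 1))// ?ler_pdivrMr ?ler_pdivlMr// mul1r ltW.
Qed.

Lemma sum_powR_geometric lam th N : 0 < lam < 1 -> 0 < th ->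
  \sum_(k < N) (lam ^+ k) `^ th <= (1 - lam `^ th)^-1.
Proof.
move=> /andP[l0 l1] th0.
have q0 : 0 < lam `^ th by rewrite powR_gt0.
have q1 : lam `^ th < 1.
  have <- : 1 `^ th = 1 by rewrite powR1.
  by rewrite gt0_ltr_powR// nnegrE ltW.
have uq : 0 < 1 - lam `^ th by rewrite subr_gt0.
rewrite (eq_bigr (fun k : 'I_N => (lam `^ th) ^+ k)); last first.
  by move=> k _; rewrite -powR_mulrn ?(ltW l0)// -!powRrM mulrC powRrM powR_mulrn// ltW.
elim: N => [|N IH]; first by rewrite big_ord0 invr_ge0 ltW.
rewrite big_ord_recl expr0.
under eq_bigr do rewrite /= /bump/= add1n exprS.
rewrite -mulr_sumr (le_trans (lerD (lexx _) (ler_wpM2l (ltW q0) IH)))//.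
rewrite le_eqVlt; apply/orP; left; apply/eqP; field.
by rewrite gt_eqF.
Qed.

End geometric_sums.

(** * Recovering a function from its cone averages *)

Section approximate_identity.
Context {R : realType} {n : nat}.
Variables (Omega : set 'rV[R]_n) (x0 : 'rV[R]_n) (r0 tau h : R) (e : 'rV[R]_n).
Hypothesis oOmega : open Omega.
Local Notation mu := (lebesgue_rV n : {sigma_finite_measure set 'rV[R]_n -> \bar R}).
Hypothesis finO : (mu Omega < +oo)%E.
Hypothesis cO : cone_condition Omega x0 r0 tau h e.
Local Notation lam := (cone_ratio tau).
Local Notation cs := (cone_slope tau).

Let mO : measurable Omega. Proof. exact: rV_open_measurable. Qed.
Let tau01 : 0 < tau <= 1. Proof. by case: cO. Qed.
Let h0 : 0 < h. Proof. by case: cO. Qed.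
Let e1 : `|e| <= 1. Proof. by case: cO. Qed.
Let tau0 : 0 < tau. Proof. by case/andP: tau01. Qed.
Let cs0 : 0 <= cs. Proof. exact: (cone_slope_ge0 tau01). Qed.

(** The lower bound ([cone_floor tau] / r)^n of the kernel times the volume (r tau/4)^n of the cube
    where it holds; r cancels. *)
Definition cone_mass : R := (cone_floor tau * tau / 4) ^+ n.

Lemma cone_mass_gt0 : 0 < cone_mass.
Proof. by rewrite exprn_gt0// divr_gt0// mulr_gt0// cone_floor_gt0. Qed.

Lemma integrable_nice_fun (g : 'rV[R]_n -> R) : nice g -> mu.-integrable Omega (EFin \o g).
Proof.
move=> ng; apply: (measurable_bounded_integrable mO finO) => //.
  exact: nice_measurable ng.
have [_ [M [_ gM _ _]]] := ng.
exists M; split; first exact: num_real.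
by move=> K MK x _; rewrite /= (le_trans (gM x))// ltW.
Qed.

Lemma cone_mass_le x r : Omega x -> `|x - x0| < r0 -> 0 < r -> r <= h ->
  cone_mass <= \int[mu]_(y in Omega) cone_kernel e tau r x y.
Proof.
move=> Ox xx0 r_gt0 rh.
pose Q := cube (x + r *: e) (r * (tau / 8)).
have mQ : measurable Q by exact: measurable_cube.
have QO : Q `<=` Omega.
  move=> y Qy; have [_ _ _ _ H] := cO.
  have -> : y = x + r *: (e + r^-1 *: (y - (x + r *: e))).
    by rewrite scalerDr scalerA mulfV ?gt_eqF// scale1r addrA subrKC.
  apply: H => //; first by rewrite r_gt0.
  rewrite normrZ gtr0_norm ?invr_gt0// ler_pdivrMl// (le_trans Qy)//.
  by rewrite ler_pM2l//; move: tau0; lra.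
pose a := (cone_floor tau / r) ^+ n.
have a0 : 0 <= a by rewrite exprn_ge0// divr_ge0// ltW// cone_floor_gt0.
have iK : mu.-integrable Omega (EFin \o cone_kernel e tau r x).
  have := integrable_cone_kernel oOmega cO x r_gt0 (integrable_nice_fun (nice_cst 1)).
  by under [X in EFin \o X]eq_fun do rewrite mul1r.
have iQ : mu.-integrable Omega (EFin \o (fun y => a * \1_Q y)).
  apply: (measurable_bounded_integrable mO finO) => //.
    apply: measurable_funM => //; apply: measurable_funTS; exact: measurable_indic.
  exists a; split; first exact: num_real.
  move=> K aK y _; rewrite /= normrM ger0_norm// (le_trans _ (ltW aK))// ler_piMr//.
  by rewrite indicE; case: (_ \in _); rewrite ?normr0 ?normr1.
apply: (@le_trans _ _ (\int[mu]_(y in Omega) (a * \1_Q y))); last first.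
  apply: le_Rintegral => // y Oy; rewrite indicE.
  have [Qy|nQy] := boolP (y \in Q).
    by rewrite mulr1 cone_kernel_ge//; rewrite inE in Qy.
  by rewrite mulr0 cone_kernel_ge0.
rewrite RintegralZl//; last first.
  apply: (measurable_bounded_integrable mO finO) => //.
  exists 1; split; first exact: num_real.
  move=> K K1 y _; rewrite /= (le_trans _ (ltW K1))//.
  by rewrite indicE; case: (_ \in _); rewrite ?normr0 ?normr1.
rewrite /Rintegral integral_indic// setIidl//.
rewrite (_ : fine _ = (2 * (r * (tau / 8))) ^+ n); last first.
  transitivity (fine (((2 * (r * (tau / 8))) ^+ n)%:E : \bar R)) => //; congr fine.
  by apply: lebesgue_rV_cube; rewrite mulr_ge0 ?divr_ge0 ?(ltW r_gt0) ?(ltW tau0).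
rewrite -exprMn /cone_mass le_eqVlt; apply/orP; left; apply/eqP; congr (_ ^+ _).
by field; rewrite gt_eqF.
Qed.

(** On the support of the kernel g differs from g(x) by at most 2rL, and the kernel is at most
    (cs/r)^n on a cube of volume (4r)^n. *)
Lemma cone_average_lipschitz g L x r : nice g -> 0 <= L ->
  (forall x y, `|g x - g y| <= L * `|x - y|) ->
  Omega x -> `|x - x0| < r0 -> 0 < r -> r <= h ->
  cone_mass * `|g x| <= `|cone_average Omega tau e g r x| + 2 * L * (4 * cs) ^+ n * r.
Proof.
move=> ng L0 gL Ox xx0 r_gt0 rh.
have iK : mu.-integrable Omega (EFin \o cone_kernel e tau r x).
  have := integrable_cone_kernel oOmega cO x r_gt0 (integrable_nice_fun (nice_cst 1)).
  by under [X in EFin \o X]eq_fun do rewrite mul1r.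
have iA := integrable_cone_kernel oOmega cO x r_gt0 (integrable_nice_fun ng).
have igK : mu.-integrable Omega (EFin \o (fun y => g x * cone_kernel e tau r x y)).
  exact: integrableZl iK.
pose K := cone_kernel e tau r x.
have -> : cone_average Omega tau e g r x =
    g x * \int[mu]_(y in Omega) K y + \int[mu]_(y in Omega) ((g y - g x) * K y).
  rewrite -RintegralZl// -RintegralD//.
    by apply: eq_Rintegral => y _; rewrite -mulrDl subrKC.
  have := integrableB mO iA igK; apply: eq_integrable => // y _.
  by rewrite /= -EFinB -mulrBl.
have m0 := cone_mass_le Ox xx0 r_gt0 rh.
have H : cone_mass * `|g x| <= `|g x * \int[mu]_(y in Omega) K y|.
  rewrite normrM mulrC ler_wpM2l// (le_trans m0)//; exact: ler_norm.
apply: (le_trans H); rewrite -lerBlDl.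
set I1 := g x * _; set I2 := (\int[mu]_(y in Omega) _).
suff I2b : `|I2| <= 2 * L * (4 * cs) ^+ n * r.
  apply: le_trans I2b; rewrite lerBlDr.
  rewrite -[X in `|X| <= _](addrK I2) (le_trans (ler_normB _ _))//.
  by rewrite addrC.
rewrite -lee_fin; apply: (le_trans (normr_Rintegral_le mO _)).
  have := integrableB mO iA igK; apply: eq_integrable => // y _.
  by rewrite /= -EFinB -mulrBl.
pose b := 2 * r * L * (cs / r) ^+ n.
have csr0 : 0 <= (cs / r) ^+ n by rewrite exprn_ge0// divr_ge0// ltW.
have b0 : 0 <= b by rewrite !mulr_ge0// ltW.
have mi : measurable_fun Omega (fun y => (\1_(cube x (2 * r)) y : R)%:E).
  apply/measurable_EFinP; apply: measurable_funTS.
  by apply: measurable_indic; exact: measurable_cube.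
apply: (@le_trans _ _ (\int[mu]_(y in Omega) (b%:E * (\1_(cube x (2 * r)) y)%:E))%E).
  apply: ge0_le_integral => //.
  - apply/measurable_EFinP; apply: (measurableT_comp (@normr_measurable R setT)).
    apply: measurable_funM; last exact: measurable_cone_kernel.
    by apply: measurable_funB => //; exact: nice_measurable.
  - exact: measurable_funeM.
  move=> y _; rewrite -EFinM lee_fin normrM [`|K y|]ger0_norm ?cone_kernel_ge0//.
  have := cone_kernel_le tau01 e1 x y r_gt0; rewrite -/K indicE.
  have [|_] := boolP (y \in cube x (2 * r)).
    rewrite inE => cy; rewrite !mulr1 => Kle; apply: ler_pM => //.
      exact: cone_kernel_ge0.
    by rewrite (le_trans (gL _ _))// [leRHS]mulrC ler_wpM2l.
  by rewrite !mulr0 => K0; apply: mulr_ge0_le0.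
rewrite (ge0_integralZl mu mO mi)// integral_indic//; last exact: measurable_cube.
apply: (@le_trans _ _ (b%:E * mu (cube x (2 * r)))%E).
  rewrite lee_wpmul2l ?lee_fin//; apply: le_measure; rewrite ?inE//.
  - by apply: measurableI => //; exact: measurable_cube.
  - exact: measurable_cube.
rewrite lebesgue_rV_cube ?mulr_ge0 ?(ltW r_gt0)// -EFinM lee_fin.
have -> : 4 * cs = cs / r * (2 * (2 * r)) by field; rewrite gt_eqF.
by rewrite /b (exprMn n (cs / r) (2 * (2 * r))) le_eqVlt; apply/orP; left; apply/eqP; ring.
Qed.

End approximate_identity.

Section local_estimate_limit.
Context {R : realType} {n : nat}.
Variables (Omega : set 'rV[R]_n) (x0 : 'rV[R]_n) (r0 tau h : R) (e : 'rV[R]_n).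
Hypothesis oOmega : open Omega.
Local Notation mu := (lebesgue_rV n : {sigma_finite_measure set 'rV[R]_n -> \bar R}).
Hypothesis finO : (mu Omega < +oo)%E.
Hypothesis cO : cone_condition Omega x0 r0 tau h e.
Local Notation lam := (cone_ratio tau).
Local Notation cs := (cone_slope tau).
Local Notation kappa := (@cone_mass R n tau).

Let mO : measurable Omega. Proof. exact: rV_open_measurable. Qed.
Let tau01 : 0 < tau <= 1. Proof. by case: cO. Qed.
Let h0 : 0 < h. Proof. by case: cO. Qed.
Let e1 : `|e| <= 1. Proof. by case: cO. Qed.
Let cs0 : 0 <= cs. Proof. exact: (cone_slope_ge0 tau01). Qed.
Let lam01 : 0 < lam < 1. Proof. by rewrite cone_ratio_gt0//= cone_ratio_lt1. Qed.
Let kappa0 : 0 < kappa. Proof. exact: (cone_mass_gt0 cO). Qed.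

(** The limit of the averages is taken in L^1 instead of pointwise. Writing u = f + g with g
    Lipschitz and f small in L^1, the averages of g converge uniformly and those of f stay small in
    L^1 uniformly in the scale. *)
Lemma approximate_identity (E : set 'rV[R]_n) (Phi : nat -> 'rV[R]_n -> \bar R)
    (M : \bar R) (u : 'rV[R]_n -> R) :
  measurable E -> (forall x, E x -> Omega x /\ `|x - x0| < r0) ->
  mu.-integrable Omega (EFin \o u) -> (forall N, measurable_fun E (Phi N)) ->
  (forall N x, E x -> (`|cone_average Omega tau e u (h * lam ^+ N) x|%:E <= Phi N x)%E) ->
  (forall N, (\int[mu]_(x in E) Phi N x <= M)%E) ->
  (kappa%:E * \int[mu]_(x in E) `|u x|%:E <= M)%E.
Proof.
move=> mE EO iu mPhi uPhi PhiM; apply/lee_addgt0Pr => eps eps0.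
have EsubO : E `<=` Omega by move=> x /EO[].
have mu_ : measurable_fun Omega u by apply/measurable_EFinP; exact: measurable_int iu.
pose S := (4 * cs) ^+ n.
have S0 : 0 <= S by rewrite exprn_ge0// mulr_ge0.
have kS0 : 0 < kappa + S by rewrite ltr_pwDl.
(* The remainder f enters twice, once with factor kappa and once through its average with factor S;
   together they cost (kappa + S) dl = eps/2. *)
pose dl := eps / 2 / (kappa + S).
have dl0 : 0 < dl by rewrite !divr_gt0.
have Nu : (layer_norm mu Omega 1 u < +oo)%E.
  rewrite -integral_layer//; by have /integrableP[_] := iu.
have [g ng ug] := finite_layer_norm_approx mO finO (@ltr01 R) (lexx 1) mu_ Nu dl0.
have [_ [L [L0 _ _ gL]]] := ng.
have mg : measurable_fun Omega g by exact: nice_measurable.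
pose f x := u x - g x.
have mf : measurable_fun Omega f by exact: measurable_funB.
have if_ : mu.-integrable Omega (EFin \o f).
  have := integrableB mO iu (integrable_nice_fun oOmega finO ng).
  by apply: eq_integrable => // x _ /=; rewrite EFinB.
move: ug; rewrite -integral_layer// => ug.
have muE : (mu E < +oo)%E.
  by apply: le_lt_trans finO; apply: le_measure; rewrite ?inE.
pose m := fine (mu E).
have m0 : 0 <= m by rewrite fine_ge0.
(* The scale is chosen after g, since the Lipschitz constant L depends on g. *)
have [N HN] : exists N, 2 * L * S * (h * lam ^+ N) * m < eps / 2.
  have /andP[l0 l1] := lam01.
  have /cvgr_lt : geometric (2 * L * S * h * m) lam k @[k --> \oo] --> (0 : R).
    by apply: cvg_geometric; rewrite gtr0_norm.
  move=> /(_ (eps / 2)); rewrite divr_gt0// => /(_ isT)[N _ HN].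
  exists N; apply: le_lt_trans (HN N (leqnn N)); rewrite /geometric/=.
  by rewrite le_eqVlt; apply/orP; left; apply/eqP; ring.
pose r := h * lam ^+ N.
have r_gt0 : 0 < r by rewrite mulr_gt0// exprn_gt0//; case/andP: lam01.
have rh : r <= h.
  have /andP[l0 l1] := lam01.
  by rewrite /r ler_piMr ?(ltW h0)// exprn_ile1// ltW.
have csr0 : 0 <= (cs / r) ^+ n by rewrite exprn_ge0// divr_ge0// ltW.
have cr0 : 0 <= 2 * L * S * r by rewrite mulr_ge0 ?(ltW r_gt0)// mulr_ge0// mulr_ge0.
have pt x : E x -> (kappa%:E * `|u x|%:E <= kappa%:E * `|f x|%:E + Phi N x +
    ((cs / r) ^+ n)%:E * local_mass Omega f (2 * r) x + (2 * L * S * r)%:E)%E.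
  move=> Ex; have [Ox xx0] := EO x Ex.
  have H1 := cone_average_lipschitz oOmega finO cO ng L0 gL Ox xx0 r_gt0 rh.
  have H2 := cone_average_le oOmega cO x r_gt0 if_.
  have H3 := uPhi N x Ex; rewrite -/r in H3.
  have E3 : cone_average Omega tau e g r x =
      cone_average Omega tau e u r x - cone_average Omega tau e f r x.
    rewrite /cone_average -RintegralB//; try exact: (integrable_cone_kernel oOmega cO).
    by apply: eq_Rintegral => y _; rewrite /f; ring.
  have H4 : kappa * `|u x| <= kappa * `|f x| + `|cone_average Omega tau e u r x| +
      `|cone_average Omega tau e f r x| + 2 * L * S * r.
    apply: (@le_trans _ _ (kappa * (`|f x| + `|g x|))).
      by rewrite ler_pM2l// (le_trans _ (ler_normD _ _))// /f subrK.
    rewrite mulrDr -!addrA lerD2l (le_trans H1)// addrA lerD2r E3.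
    exact: ler_normB.
  rewrite -!EFinM; apply: (@le_trans _ _ ((kappa * `|f x|)%:E +
      `|cone_average Omega tau e u r x|%:E + `|cone_average Omega tau e f r x|%:E +
      (2 * L * S * r)%:E)%E); first by rewrite -!EFinD lee_fin.
  by rewrite leeD2r// leeD// leeD2l.
have mfE : measurable_fun E (fun x => kappa%:E * `|f x|%:E)%E.
  apply: measurable_funeM; apply/measurable_EFinP.
  apply: (measurableT_comp (@normr_measurable R setT)).
  exact: measurable_funS mf.
have mlm : measurable_fun E (fun x => ((cs / r) ^+ n)%:E * local_mass Omega f (2 * r) x)%E.
  by apply: measurable_funeM; apply: measurable_funTS; exact: measurable_local_mass.
have Phi0 x : E x -> (0 <= Phi N x)%E.
  by move=> Ex; apply: le_trans (uPhi N x Ex); rewrite lee_fin.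
have f0 x : E x -> (0 <= kappa%:E * `|f x|%:E)%E.
  by move=> _; rewrite -EFinM lee_fin mulr_ge0// ltW.
have l0 x : E x -> (0 <= ((cs / r) ^+ n)%:E * local_mass Omega f (2 * r) x)%E.
  by move=> _; rewrite mule_ge0 ?lee_fin//; exact: local_mass_ge0.
have mnu : measurable_fun E (fun x => `|u x|%:E).
  apply/measurable_EFinP; apply: (measurableT_comp (@normr_measurable R setT)).
  exact: measurable_funS mu_.
have m1 := emeasurable_funD mfE (mPhi N).
have m2 := emeasurable_funD m1 mlm.
rewrite -(ge0_integralZl mu mE mnu)//; last by rewrite lee_fin ltW.
apply: (@le_trans _ _ (\int[mu]_(x in E) (kappa%:E * `|f x|%:E + Phi N x +
    ((cs / r) ^+ n)%:E * local_mass Omega f (2 * r) x + (2 * L * S * r)%:E))%E).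
  apply: ge0_le_integral => //.
  - by move=> x _; rewrite -EFinM lee_fin mulr_ge0// ltW.
  - exact: measurable_funeM.
  - exact: emeasurable_funD.
rewrite ge0_integralD//; last by move=> x Ex; rewrite !adde_ge0 ?f0 ?Phi0 ?l0.
rewrite ge0_integralD//; last by move=> x Ex; rewrite adde_ge0 ?f0 ?Phi0.
rewrite ge0_integralD// integral_cst//.
have I1 : (\int[mu]_(x in E) (kappa%:E * `|f x|%:E) <= (kappa * dl)%:E)%E.
  rewrite ge0_integralZl//; last 2 first.
  - apply/measurable_EFinP; apply: (measurableT_comp (@normr_measurable R setT)).
    exact: measurable_funS mf.
  - by rewrite lee_fin ltW.
  rewrite EFinM lee_wpmul2l ?lee_fin ?(ltW kappa0)//.
  apply: (le_trans _ (ltW ug)); apply: ge0_subset_integral => //.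
  apply/measurable_EFinP; exact: (measurableT_comp (@normr_measurable R setT)).
have I2 : (\int[mu]_(x in E) (((cs / r) ^+ n)%:E * local_mass Omega f (2 * r) x) <=
    (S * dl)%:E)%E.
  rewrite ge0_integralZl//; last 2 first.
  - by apply: measurable_funTS; exact: measurable_local_mass.
  - by move=> x _; exact: local_mass_ge0.
  have -> : S = (cs / r) ^+ n * (2 * (2 * r)) ^+ n.
    by rewrite -exprMn /S; congr (_ ^+ _); field; rewrite gt_eqF.
  rewrite -mulrA EFinM lee_wpmul2l ?lee_fin//.
  apply: (le_trans (integral_local_mass_le mO _ mE mf)).
    by rewrite mulr_ge0// ltW.
  rewrite EFinM; apply: lee_wpmul2l; last exact: ltW.
  by rewrite lee_fin exprn_ge0// mulr_ge0// mulr_ge0// ltW.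
have I3 : ((2 * L * S * r)%:E * mu E <= (eps / 2)%:E)%E.
  by rewrite -[mu E]fineK ?ge0_fin_numE// -EFinM lee_fin ltW.
apply: (le_trans (leeD (leeD (leeD I1 (PhiM N)) I2) I3)).
rewrite -addeA [X in (X + _)%E]addeC -addeA leeD2l// -!EFinD lee_fin.
rewrite addrA -mulrDl [(kappa + S) * dl]mulrC divfK ?gt_eqF//.
by rewrite -splitr.
Qed.

End local_estimate_limit.

(** * The telescoped estimate near one point *)

Section chart_estimate.
Context {R : realType} {n : nat}.
Variables (Omega : set 'rV[R]_n) (x0 : 'rV[R]_n) (r0 tau h : R) (e : 'rV[R]_n).
Hypothesis oOmega : open Omega.
Local Notation mu := (lebesgue_rV n : {sigma_finite_measure set 'rV[R]_n -> \bar R}).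
Hypothesis finO : (mu Omega < +oo)%E.
Hypothesis cO : cone_condition Omega x0 r0 tau h e.
Local Notation lam := (cone_ratio tau).
Local Notation cs := (cone_slope tau).
Local Notation kappa := (@cone_mass R n tau).

Let mO : measurable Omega. Proof. exact: rV_open_measurable. Qed.
Let tau01 : 0 < tau <= 1. Proof. by case: cO. Qed.
Let h0 : 0 < h. Proof. by case: cO. Qed.
Let cs0 : 0 <= cs. Proof. exact: (cone_slope_ge0 tau01). Qed.
Let lam01 : 0 < lam < 1. Proof. by rewrite cone_ratio_gt0//= cone_ratio_lt1. Qed.

(** The average at scale h lam^N is the one at scale h plus N differences. The coarse average costs
    mu(E) times the L^1 norm of u, the differences cost the sum over the scales, whose bound B is
    supplied separately for each embedding. *)
Lemma chart_estimate (E : set 'rV[R]_n) (B : \bar R) u (Du : 'I_n -> 'rV[R]_n -> R) :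
  measurable E -> (forall x, E x -> Omega x /\ `|x - x0| < r0) ->
  mu.-integrable Omega (EFin \o u) ->
  (forall i, mu.-integrable Omega (EFin \o Du i)) ->
  (forall i, weak_partial Omega i u (Du i)) ->
  (forall N, (\sum_(k < N) ((h * lam ^+ k) ^- n.-1)%:E *
     \sum_(i < n) \int[mu]_(x in E) local_mass Omega (Du i) (2 * (h * lam ^+ k)) x <= B)%E) ->
  (kappa%:E * \int[mu]_(x in E) `|u x|%:E <=
   ((cs / h) ^+ n)%:E * (mu E * \int[mu]_(x in Omega) `|u x|%:E) +
   (cs ^+ n.-1)%:E * B)%E.
Proof.
move=> mE EO iu iDu wDu HB.
have EsubO : E `<=` Omega by move=> x /EO[].
have mu_ : measurable_fun Omega u by apply/measurable_EFinP; exact: measurable_int iu.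
have mDu i : measurable_fun Omega (Du i).
  by apply/measurable_EFinP; exact: measurable_int (iDu i).
have r_gt0 k : 0 < h * lam ^+ k.
  by have /andP[l0 _] := lam01; rewrite mulr_gt0// exprn_gt0.
have rh k : h * lam ^+ k <= h.
  have /andP[l0 l1] := lam01.
  by rewrite ler_piMr ?(ltW h0)// exprn_ile1// ltW.
pose c k : R := (cs / (h * lam ^+ k)) ^+ n.-1.
have c0 k : 0 <= c k by rewrite exprn_ge0// divr_ge0// ltW.
pose l k i x := local_mass Omega (Du i) (2 * (h * lam ^+ k)) x.
have l0 k i x : (0 <= l k i x)%E by exact: local_mass_ge0.
have ml k i (A : set 'rV[R]_n) : measurable_fun A (l k i).
  by apply: measurable_funTS; exact: measurable_local_mass.
pose S k x : \bar R := (\sum_(i < n) l k i x)%E.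
have S0 k x : (0 <= S k x)%E by exact: sume_ge0.
have mS k (A : set 'rV[R]_n) : measurable_fun A (S k) by exact: emeasurable_sum.
have ch0 : 0 <= (cs / h) ^+ n by rewrite exprn_ge0// divr_ge0// ltW.
pose Phi N x := (((cs / h) ^+ n)%:E * local_mass Omega u (2 * h) x +
  \sum_(k < N) ((c k)%:E * S k x))%E.
have mu0 (A : set 'rV[R]_n) :
    measurable_fun A (fun x => ((cs / h) ^+ n)%:E * local_mass Omega u (2 * h) x)%E.
  by apply: measurable_funeM; apply: measurable_funTS; exact: measurable_local_mass.
have msum N (A : set 'rV[R]_n) :
    measurable_fun A (fun x => \sum_(k < N) ((c k)%:E * S k x))%E.
  by apply: emeasurable_sum => k; exact: measurable_funeM.
have lu0 x : (0 <= ((cs / h) ^+ n)%:E * local_mass Omega u (2 * h) x)%E.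
  by rewrite mule_ge0 ?lee_fin//; exact: local_mass_ge0.
apply: (@approximate_identity R n Omega x0 r0 tau h e oOmega finO cO E Phi _ u mE EO iu).
- by move=> N; exact: emeasurable_funD.
- move=> N x Ex; have [Ox xx0] := EO x Ex; elim: N => [|N IH].
    by rewrite /Phi big_ord0 adde0 expr0 mulr1; exact: (cone_average_le oOmega cO).
  have := cone_average_step oOmega cO iu iDu wDu Ox xx0 (r_gt0 N) (rh N).
  rewrite mulrCA -exprS => IH'.
  rewrite /Phi big_ord_recr/= addeA.
  apply: (le_trans _ (leeD IH IH')); rewrite -EFinD lee_fin.
  by apply: le_trans (ler_normB _ _); rewrite subKr.
- move=> N; rewrite /Phi ge0_integralD//; last first.
    by move=> x Ex; apply: sume_ge0 => k _; rewrite mule_ge0 ?lee_fin.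
  apply: leeD.
    rewrite ge0_integralZl//; last 2 first.
    + by apply: measurable_funTS; exact: measurable_local_mass.
    + by move=> x _; exact: local_mass_ge0.
    rewrite lee_wpmul2l ?lee_fin//.
    apply: (@le_trans _ _ (\int[mu]_(x in E) (\int[mu]_(y in Omega) `|u y|%:E))%E).
      apply: ge0_le_integral => //.
      * by move=> x _; exact: local_mass_ge0.
      * by apply: measurable_funTS; exact: measurable_local_mass.
      * by move=> x _; exact: local_mass_le.
    by rewrite integral_cst// muleC.
  rewrite ge0_integral_sum//; last 2 first.
  + by move=> k; exact: measurable_funeM.
  + by move=> k x _; rewrite mule_ge0 ?lee_fin.
  apply: le_trans (lee_wpmul2l _ (HB N)); last by rewrite lee_fin exprn_ge0.
  rewrite ge0_sume_distrr; last first.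
    move=> k _; rewrite mule_ge0 ?lee_fin ?invr_ge0 ?exprn_ge0 ?(ltW (r_gt0 k))//.
    by apply: sume_ge0 => i _; apply: integral_ge0 => x _; exact: local_mass_ge0.
  have IS k : (\int[mu]_(x in E) S k x = \sum_(i < n) \int[mu]_(x in E) l k i x)%E.
    by apply: ge0_integral_sum.
  apply: lee_sum => k _; rewrite ge0_integralZl ?lee_fin// IS.
  by rewrite muleA -EFinM /c expr_div_n.
Qed.

End chart_estimate.

(** * Layer norms of bounded functions *)

Section layer_norm_bounded.
Context d (T : measurableType d) (R : realType).
Variables (mu : {sigma_finite_measure set T -> \bar R}) (D : set T).
Hypothesis mD : measurable D.
Hypothesis finD : (mu D < +oo)%E.
Local Notation leb := (@lebesgue_measure R).

(** If x <= t the second term suffices; otherwise x^(s-1) <= t^(s-1) and the first one does. *)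
Lemma powR_le_tangent (s t x : R) : 0 <= s <= 1 -> 0 < t -> 0 <= x ->
  x `^ s <= t `^ (s - 1) * x + t `^ s.
Proof.
move=> /andP[s0 s1] t0 x0; have [xt|tx] := leP x t.
  rewrite (le_trans (y := t `^ s))//; last by rewrite lerDr mulr_ge0// powR_ge0.
  by apply: ge0_ler_powR; rewrite // nnegrE// ltW.
rewrite (le_trans (y := t `^ (s - 1) * x))//; last by rewrite lerDl powR_ge0.
have x1 := lt_trans t0 tx.
have : x `^ (s - 1 + 1) = x `^ (s - 1) * x.
  by rewrite powRD ?(gt_eqF x1) ?implybT// powRr1// ltW.
rewrite subrK => ->; rewrite ler_wpM2r ?(ltW x1)//.
rewrite -[s - 1]opprB !powRN lef_pV2 ?posrE ?powR_gt0//.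
by apply: ge0_ler_powR; rewrite ?nnegrE ?subr_ge0// ltW.
Qed.

(** Linearises the power s of the level measures at a reference measure t, left free for later
    choice; the second term only concerns heights below the bound S. *)
Lemma layer_norm_le_bounded (s t S : R) (f : T -> R) : 0 < s -> s <= 1 -> 0 < t -> 0 <= S ->
  measurable_fun D f -> (forall x, D x -> `|f x| <= S) ->
  (layer_norm mu D s f <=
   (t `^ (s - 1))%:E * \int[mu]_(x in D) `|f x|%:E + (t `^ s * S)%:E)%E.
Proof.
move=> s0 s1 t0 S0 mf fS; have s0' := ltW s0.
have m1 (A : set (measurableTypeR R)) :
    measurable_fun A (fun a : measurableTypeR R => mu (suplevel D f a)).
  have := @measurable_layer _ _ _ mu D mD 1 f A ler01 mf.
  by apply: eq_measurable_fun => a _; rewrite poweRe1.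
have m2 (A : set (measurableTypeR R)) :
    measurable_fun A (fun a : measurableTypeR R => (\1_(`]0, S[%classic) a : R)%:E).
  by apply/measurable_EFinP; apply: measurable_funTS; exact: measurable_indic.
rewrite integral_layer// /layer_norm.
apply: (@le_trans _ _ (\int[leb]_(a in `]0%R, +oo[)
    ((t `^ (s - 1))%:E * mu (suplevel D f a) + (t `^ s)%:E * (\1_(`]0, S[%classic) a)%:E))%E).
  apply: ge0_le_integral => //.
  - by move=> *; exact: poweR_ge0.
  - exact: measurable_layer.
  - by apply: emeasurable_funD; [exact: measurable_funeM (m1 _)|exact: measurable_funeM (m2 _)].
  move=> a; rewrite /= in_itv/= andbT => a0; rewrite indicE.
  have fin : mu (suplevel D f a) \is a fin_num.
    by rewrite ge0_fin_numE//; exact: measure_suplevel_lty.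
  have [aS|Sa] := ltP a S.
    rewrite mem_set ?mule1; last by rewrite /= in_itv/= a0.
    rewrite -(fineK fin) poweR_EFin -EFinM -EFinD lee_fin.
    by apply: powR_le_tangent; rewrite ?s0' ?fine_ge0.
  rewrite (_ : suplevel D f a = set0).
    by rewrite measure0 poweR0r ?gt_eqF// mule0 add0e -EFinM lee_fin mulr_ge0 ?powR_ge0.
  apply/seteqP; split => // x [Dx ax].
  by move: ax; rewrite ltNge (le_trans (fS x Dx)).
have n1 A := @measurable_funeM _ _ _ A _ (t `^ (s - 1))%:E (m1 A).
have n2 A := @measurable_funeM _ _ _ A _ (t `^ s)%:E (m2 A).
rewrite ge0_integralD//; try by move=> a _; rewrite mule_ge0// lee_fin powR_ge0.
rewrite (ge0_integralZl _ _ (m1 _))//; try by rewrite lee_fin powR_ge0.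
rewrite (ge0_integralZl _ _ (m2 _))//; try by rewrite lee_fin powR_ge0.
rewrite integral_indic//= EFinM; apply: leeD; last first.
  rewrite lee_wpmul2l ?lee_fin ?powR_ge0//.
  apply: (@le_trans _ _ (leb `]0%R, S[%classic)).
    by apply: le_measure; rewrite ?inE//; exact: measurableI.
  rewrite lebesgue_measure_itv/= lte_fin; case: ifP => // _.
  by rewrite -EFinB subr0.
rewrite lee_wpmul2l ?lee_fin ?powR_ge0// le_eqVlt; apply/orP; left; apply/eqP.
by apply: eq_integral => a _; rewrite poweRe1.
Qed.

End layer_norm_bounded.

(** * The measure of a set inside a moving cube *)

Section overlap.
Context {R : realType} {n : nat}.
Variable Omega : set 'rV[R]_n.
Local Notation mu := (lebesgue_rV n : {sigma_finite_measure set 'rV[R]_n -> \bar R}).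
Hypothesis mO : measurable Omega.
Hypothesis finO : (mu Omega < +oo)%E.
Variable E : set 'rV[R]_n.
Hypothesis mE : measurable E.
Hypothesis EO : E `<=` Omega.

Let finE : (mu E < +oo)%E.
Proof. by apply: le_lt_trans finO; apply: le_measure; rewrite ?inE. Qed.

Definition overlap r (y : 'rV[R]_n) : R := fine (mu (E `&` cube y r)).

Lemma overlapE r y : (overlap r y)%:E = mu (E `&` cube y r).
Proof.
rewrite fineK// ge0_fin_numE//; apply: le_lt_trans finE.
by apply: le_measure; rewrite ?inE//; apply: measurableI => //; exact: measurable_cube.
Qed.

Lemma overlap_ge0 r y : 0 <= overlap r y.
Proof. exact: fine_ge0. Qed.

Lemma overlap_local_mass r : EFin \o overlap r = local_mass E (cst 1) r.
Proof.
apply/funext => y /=; rewrite overlapE /local_mass.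
under eq_integral do rewrite /= normr1 mul1r.
by rewrite integral_indic// 1?setIC//; exact: measurable_cube.
Qed.

Lemma measurable_overlap r (A : set 'rV[R]_n) : measurable_fun A (overlap r).
Proof.
apply: measurable_funTS; apply/measurable_EFinP; rewrite overlap_local_mass.
by apply: measurable_local_mass.
Qed.

Lemma overlap_le r y : overlap r y <= fine (mu E).
Proof.
rewrite -lee_fin overlapE fineK ?ge0_fin_numE//; apply: le_measure; rewrite ?inE//.
by apply: measurableI => //; exact: measurable_cube.
Qed.

Lemma overlap_le_cube r y : 0 <= r -> overlap r y <= (2 * r) ^+ n.
Proof.
move=> r0; rewrite -lee_fin overlapE -(lebesgue_rV_cube y r0).
by apply: le_measure; rewrite ?inE//; try apply: measurableI => //; exact: measurable_cube.
Qed.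

(** A second use of Tonelli: for y in E the cube meets F in measure at most min(mu(F), (2r)^n). *)
Lemma integral_overlap_le r F : 0 <= r -> measurable F -> F `<=` Omega ->
  (\int[mu]_(y in F) (overlap r y)%:E <=
   (fine (mu E) * Num.min (fine (mu F)) ((2 * r) ^+ n))%:E)%E.
Proof.
move=> r0 mF FO; have finF : (mu F < +oo)%E.
  by apply: le_lt_trans finO; apply: le_measure; rewrite ?inE.
have cube0 : 0 <= (2 * r) ^+ n by rewrite exprn_ge0// mulr_ge0.
rewrite (_ : (fun y => (overlap r y)%:E) = local_mass E (cst 1) r); last exact: overlap_local_mass.
rewrite integral_local_mass//.
apply: (@le_trans _ _ (\int[mu]_(y in E) (Num.min (fine (mu F)) ((2 * r) ^+ n))%:E)%E).
  under eq_integral do rewrite /= normr1 mul1e.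
  apply: ge0_le_integral => //.
  - have := @measurable_local_mass R n F mF (cst 1) r (measurable_cst _).
    move=> /(measurable_funTS (D := E)); apply: eq_measurable_fun => y _.
    rewrite /local_mass; under eq_integral do rewrite /= normr1 mul1r.
    by rewrite integral_indic// 1?setIC//; exact: measurable_cube.
  - move=> y Ey; have mc : measurable (F `&` cube y r).
      by apply: measurableI => //; exact: measurable_cube.
    rewrite /Num.min; case: ifP => _.
      by rewrite fineK ?ge0_fin_numE//; apply: le_measure; rewrite ?inE.
    rewrite -(lebesgue_rV_cube y r0); apply: le_measure; rewrite ?inE//.
    exact: measurable_cube.
by rewrite integral_cst// EFinM fineK ?ge0_fin_numE// muleC.
Qed.

End overlap.

Lemma powRD_gt0 (R : realType) (x r s : R) : 0 < x -> x `^ (r + s) = x `^ r * x `^ s.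
Proof. by move=> x0; rewrite powRD// (gt_eqF x0) implybT. Qed.

(** * Sums over all scales *)

Section potentials.
Context {R : realType} {n : nat}.
Hypothesis n2 : (2 <= n)%N.
Variable Omega : set 'rV[R]_n.
Local Notation mu := (lebesgue_rV n : {sigma_finite_measure set 'rV[R]_n -> \bar R}).
Hypothesis mO : measurable Omega.
Hypothesis finO : (mu Omega < +oo)%E.
Variables (lam h : R).
Hypothesis lam01 : 0 < lam < 1.
Hypothesis h0 : 0 < h.
Implicit Types (E F : set 'rV[R]_n).
Local Notation r k := (h * lam ^+ k).
Local Notation "p %:i" := (p%:R^-1 : R) (at level 2).

Let r_gt0 k : 0 < r k.
Proof. by have /andP[l0 _] := lam01; rewrite mulr_gt0// exprn_gt0. Qed.

Let n0 : (0 < n)%N. Proof. exact: leq_trans n2. Qed.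

Let nr0 : n%:R != 0 :> R. Proof. by rewrite pnatr_eq0 -lt0n. Qed.

Let in01 : 0 < n%:i <= 1.
Proof. by rewrite invr_gt0 ltr0n n0/= invf_le1 ?ltr0n// ler1n. Qed.

Let ul0 : 0 < 1 - lam. Proof. by have /andP[_] := lam01; rewrite subr_gt0. Qed.

Lemma powR_invn m : 0 <= m -> (m `^ n%:i) ^+ n = m.
Proof. by move=> m0; rewrite -powR_mulrn ?powR_ge0// -powRrM mulVf// powRr1. Qed.

Definition potential_cst : R := 2 * 4 ^+ n / (1 - lam).

Lemma potential_cst_ge0 : 0 <= potential_cst.
Proof. by rewrite divr_ge0 ?(ltW ul0)// mulr_ge0// exprn_ge0. Qed.

(** With t = m^(1/n) the terms are at most 4^n r, and at most t (t/r)^(n-1); n >= 2 makes the second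
    bound decay, so the sum is governed by the scale r = t. *)
Lemma sum_min_expn m N : 0 <= m ->
  \sum_(k < N) (r k) ^- n.-1 * Num.min m ((2 * (2 * r k)) ^+ n) <=
  potential_cst * m `^ n%:i.
Proof.
rewrite le_eqVlt => /predU1P[<-|m0].
  rewrite big1 => [|k _]; last first.
    by rewrite min_l ?mulr0// exprn_ge0// mulr_ge0// mulr_ge0// ltW.
  by rewrite mulr_ge0 ?powR_ge0// potential_cst_ge0.
have t0 : 0 < m `^ n%:i by rewrite powR_gt0.
have r1 k : 0 < (r k) ^+ n.-1 by rewrite exprn_gt0.
have q0 : 0 <= (4 : R) ^+ n by rewrite exprn_ge0.
have S n' : (0 < n')%N -> forall x : R, x ^+ n' = x * x ^+ n'.-1 by case: n' => // p _ x; rewrite exprS.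
have := @sum_le_geometric _ lam h (m `^ n%:i) (4 ^+ n) n.-1 N
  (fun k => (r k) ^- n.-1 * Num.min m ((2 * (2 * r k)) ^+ n)) lam01 h0 t0 q0.
move=> H; apply: (le_trans (H _ _ _)).
- by case: n n2 => [|[]].
- move=> k; rewrite ler_pdivrMl// (le_trans (y := (2 * (2 * r k)) ^+ n)) ?ge_min ?lexx ?orbT//.
  rewrite le_eqVlt; apply/orP; left; apply/eqP.
  rewrite mulrA -natrM exprMn (S n n0 (r k)); ring.
- move=> k; rewrite ler_pdivrMl// (le_trans (y := m)) ?ge_min ?lexx//.
  rewrite expr_div_n mulrCA [X in _ <= _ * X]mulrCA divff ?gt_eqF// mulr1.
  rewrite -mulrA -(S n n0) powR_invn ?(ltW m0)// ler_peMl ?(ltW m0)//.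
  by rewrite exprn_ege1// ler1n.
by rewrite /potential_cst le_eqVlt; apply/orP; left; apply/eqP; ring.
Qed.

Section fixed_set.
Variable E : set 'rV[R]_n.
Hypothesis mE : measurable E.
Hypothesis EO : E `<=` Omega.

Let finE : (mu E < +oo)%E.
Proof. by apply: le_lt_trans finO; apply: le_measure; rewrite ?inE. Qed.

(** The sum of overlaps plays the role of the Riesz potential of order 1 of the indicator of E. Its
    norm in weak L^{n/(n-1)} is proportional to mu(E), uniformly in N. *)
Lemma potential_avg_bounded N :
  avg_bounded mu Omega n%:i (potential_cst * fine (mu E))
    (fun y => \sum_(k < N) (r k) ^- n.-1 * overlap E (2 * r k) y).
Proof.
move=> F mF FO; have finF : (mu F < +oo)%E.
  by apply: le_lt_trans finO; apply: le_measure; rewrite ?inE.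
have c0 k : 0 <= (r k) ^- n.-1 by rewrite invr_ge0 exprn_ge0// ltW.
have mov k : measurable_fun F (fun y => (overlap E (2 * r k) y)%:E).
  by apply/measurable_EFinP; exact: (measurable_overlap mO finO mE EO).
rewrite (_ : (\int[mu]_(x in F) _)%E =
    (\int[mu]_(y in F) (\sum_(k < N) (((r k) ^- n.-1)%:E * (overlap E (2 * r k) y)%:E)))%E); last first.
  apply: eq_integral => y _; rewrite ger0_norm; last first.
    by apply: sumr_ge0 => k _; rewrite mulr_ge0// overlap_ge0.
  by rewrite -sumEFin; apply: eq_bigr => k _; rewrite EFinM.
rewrite (ge0_integral_sum mu mF); last 2 first.
- by move=> k; exact: measurable_funeM.
- by move=> k y _; rewrite -EFinM lee_fin mulr_ge0// overlap_ge0.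
apply: (@le_trans _ _ (\sum_(k < N) (fine (mu E) *
    ((r k) ^- n.-1 * Num.min (fine (mu F)) ((2 * (2 * r k)) ^+ n)))%:E)%E).
  apply: lee_sum => k _; rewrite (ge0_integralZl mu mF (mov k))//; last 2 first.
  - by move=> y _; rewrite lee_fin overlap_ge0.
  - by rewrite lee_fin.
  rewrite [fine (mu E) * _]mulrCA [X in (_ <= X)%E]EFinM; apply: lee_wpmul2l; first by rewrite lee_fin.
  by apply: (integral_overlap_le mO finO mE EO) => //; rewrite mulr_ge0// ltW.
rewrite sumEFin -mulr_sumr -[mu F]fineK ?ge0_fin_numE// poweR_EFin -EFinM lee_fin.
rewrite [potential_cst * _]mulrC -mulrA ler_wpM2l ?fine_ge0//.
by apply: sum_min_expn; rewrite fine_ge0// lee_fin fine_ge0.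
Qed.

(** Tonelli turns the left side into the integral of |g| against the potential of E, which is then
    paired with g in L^{n,1}. *)
Lemma potential_layer_norm_le (g : 'rV[R]_n -> R) N : measurable_fun Omega g ->
  (\sum_(k < N) ((r k) ^- n.-1)%:E * \int[mu]_(x in E) local_mass Omega g (2 * r k) x <=
   (potential_cst * fine (mu E))%:E * layer_norm mu Omega n%:i g)%E.
Proof.
move=> mg; have c0 k : 0 <= (r k) ^- n.-1 by rewrite invr_ge0 exprn_ge0// ltW.
have mng : measurable_fun Omega (fun y => `|g y|%:E).
  apply/measurable_EFinP; exact: (measurableT_comp (@normr_measurable R setT)).
have mov k : measurable_fun Omega (fun y => (overlap E (2 * r k) y)%:E).
  by apply/measurable_EFinP; exact: (measurable_overlap mO finO mE EO).
have mgov k : measurable_fun Omega (fun y => `|g y|%:E * (overlap E (2 * r k) y)%:E)%E.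
  exact: emeasurable_funM.
have gov0 k y : (0 <= `|g y|%:E * (overlap E (2 * r k) y)%:E)%E.
  by rewrite -EFinM lee_fin mulr_ge0// overlap_ge0.
have mK : measurable_fun Omega (fun y => \sum_(k < N) (r k) ^- n.-1 * overlap E (2 * r k) y).
  apply: measurable_sum => k; apply: measurable_funM => //.
  exact: (measurable_overlap mO finO mE EO).
have [i0 i1] := andP in01.
have pE0 : 0 <= potential_cst * fine (mu E).
  by rewrite mulr_ge0 ?fine_ge0// potential_cst_ge0.
apply: le_trans (avg_bounded_integral_layer mO (ltW i0) pE0 mg mK (potential_avg_bounded N)).
rewrite (_ : (\int[mu]_(x in Omega) _)%E = (\int[mu]_(y in Omega)
    (\sum_(k < N) (((r k) ^- n.-1)%:E * (`|g y|%:E * (overlap E (2 * r k) y)%:E))))%E); last first.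
  apply: eq_integral => y _; rewrite [X in (_ * X)%R]ger0_norm; last first.
    by apply: sumr_ge0 => k _; rewrite mulr_ge0// overlap_ge0.
  rewrite mulr_sumr -sumEFin; apply: eq_bigr => k _.
  by rewrite -!EFinM; congr EFin; ring.
rewrite (ge0_integral_sum mu mO); last 2 first.
- by move=> k; exact: measurable_funeM.
- by move=> k y _; rewrite mule_ge0// lee_fin.
apply: lee_sum => k _; rewrite (ge0_integralZl mu mO (mgov k))//; last by rewrite lee_fin.
rewrite lee_wpmul2l ?lee_fin// integral_local_mass//.
rewrite le_eqVlt; apply/orP; left; apply/eqP; apply: eq_integral => y _.
by rewrite (overlapE mO finO mE EO).
Qed.

Lemma overlap_layer_norm_le rho t : 0 < rho -> 0 < t ->
  (layer_norm mu Omega n%:i (overlap E rho) <=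
   (t `^ (n%:i - 1) * (fine (mu E) * (2 * rho) ^+ n) +
    t `^ n%:i * Num.min (fine (mu E)) ((2 * rho) ^+ n))%:E)%E.
Proof.
move=> rho0 t0; have [i0 i1] := andP in01.
have c0 : 0 <= (2 * rho) ^+ n by rewrite exprn_ge0// mulr_ge0// ltW.
have S0 : 0 <= Num.min (fine (mu E)) ((2 * rho) ^+ n) by rewrite le_min fine_ge0.
have mov := measurable_overlap mO finO mE EO rho (A := Omega).
have bd y : Omega y -> `|overlap E rho y| <= Num.min (fine (mu E)) ((2 * rho) ^+ n).
  move=> _; rewrite ger0_norm ?overlap_ge0// le_min (overlap_le mO finO mE EO)/=.
  by rewrite (overlap_le_cube mO finO mE EO)// ltW.
apply: (le_trans (layer_norm_le_bounded mO finO i0 i1 t0 S0 mov bd)).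
rewrite EFinD leeD2r// EFinM lee_wpmul2l ?lee_fin ?powR_ge0//.
under eq_integral do rewrite ger0_norm ?overlap_ge0//.
apply: (le_trans (integral_overlap_le mO finO mE EO (ltW rho0) mO (@subset_refl _ _))).
by rewrite lee_fin ler_wpM2l ?fine_ge0// ge_min lexx orbT.
Qed.

Lemma integral_local_mass_avg_le (g : 'rV[R]_n -> R) A rho : 0 <= A -> 0 < rho ->
  measurable_fun Omega g -> avg_bounded mu Omega n%:i A g ->
  (\int[mu]_(x in E) local_mass Omega g rho x <=
   A%:E * layer_norm mu Omega n%:i (overlap E rho))%E.
Proof.
move=> A0 rho0 mg gA; have [i0 i1] := andP in01.
have mov := measurable_overlap mO finO mE EO rho (A := Omega).
rewrite integral_local_mass//.
apply: le_trans (avg_bounded_integral_layer mO (ltW i0) A0 mov mg gA).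
rewrite le_eqVlt; apply/orP; left; apply/eqP; apply: eq_integral => y _.
by rewrite [X in (X * _)%R]ger0_norm ?overlap_ge0// mulrC EFinM (overlapE mO finO mE EO).
Qed.

(** Both bounds come from [overlap_layer_norm_le] at radius 2r, with reference measure t equal to
    the volume (4r)^n of the cube for the first, and to mu(E) for the second. For n = 2 the first
    has no decay in r. *)
Lemma local_potential_le (g : 'rV[R]_n -> R) A k : 0 <= A ->
  measurable_fun Omega g -> avg_bounded mu Omega n%:i A g ->
  (((r k) ^- n.-1)%:E * \int[mu]_(x in E) local_mass Omega g (2 * r k) x <=
   (8 * A * fine (mu E) / r k ^+ n.-2)%:E)%E /\
  (((r k) ^- n.-1)%:E * \int[mu]_(x in E) local_mass Omega g (2 * r k) x <=
   (2 * 4 ^+ n * A * (fine (mu E)) `^ n%:i * r k)%:E)%E.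
Proof.
move=> A0 mg gA; have c0 : 0 < (r k) ^+ n.-1 by rewrite exprn_gt0.
have rho0 : 0 < 2 * r k by rewrite mulr_gt0.
have H := integral_local_mass_avg_le A0 rho0 mg gA.
have S n' : (0 < n')%N -> forall x : R, x ^+ n' = x * x ^+ n'.-1 by case: n' => // p _ x; rewrite exprS.
have n1 : (0 < n.-1)%N by case: n n2 => [|[]].
have E4 : 2 * (2 * r k) = 4 * r k by rewrite mulrA -natrM.
have q0 : 0 < 4 * r k by rewrite mulr_gt0.
have N0 x : layer_norm mu Omega n%:i (overlap E (2 * r k)) = x -> (0 <= x)%E.
  by move=> <-; exact: layer_norm_ge0.
have key (B C : R) : (layer_norm mu Omega n%:i (overlap E (2 * r k)) <= B%:E)%E ->
    (r k) ^- n.-1 * (A * B) <= C ->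
    (((r k) ^- n.-1)%:E * \int[mu]_(x in E) local_mass Omega g (2 * r k) x <= C%:E)%E.
  move=> HB BC; apply: (@le_trans _ _ ((r k) ^- n.-1 * (A * B))%:E); last by rewrite lee_fin.
  rewrite !EFinM; apply: lee_wpmul2l; first by rewrite lee_fin invr_ge0 ltW.
  by apply: (le_trans H); apply: lee_wpmul2l; rewrite ?lee_fin.
have m0 : 0 <= fine (mu E) by exact: fine_ge0.
split.
  have T0 : 0 < (4 * r k) ^+ n by rewrite exprn_gt0.
  apply: (key _ _ (overlap_layer_norm_le rho0 T0)).
  have Tn : ((4 * r k) ^+ n) `^ n%:i = 4 * r k.
    by rewrite -powR_mulrn ?(ltW q0)// -powRrM mulfV// powRr1// ltW.
  have Tn1 : ((4 * r k) ^+ n) `^ (n%:i - 1) = (4 * r k) / (4 * r k) ^+ n.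
    by rewrite (powRD_gt0 _ _ T0) Tn powRN powRr1// ltW.
  apply: (@le_trans _ _ ((r k) ^- n.-1 * (A * (8 * (fine (mu E) * r k))))).
    rewrite ler_wpM2l ?invr_ge0 ?(ltW c0)// ler_wpM2l// Tn Tn1 E4.
    apply: (@le_trans _ _ (4 * r k * fine (mu E) + 4 * r k * fine (mu E))).
      rewrite lerD//; last by rewrite ler_wpM2l ?(ltW q0)// ge_min lexx.
      by rewrite mulrCA divfK ?gt_eqF// mulrC.
    by rewrite le_eqVlt; apply/orP; left; apply/eqP; ring.
  have -> : (r k) ^+ n.-1 = r k * (r k) ^+ n.-2 by rewrite (S n.-1 n1 (r k)).
  have : (r k) ^+ n.-2 != 0 by rewrite gt_eqF// exprn_gt0.
  have := r_gt0 k; move: (r k) ((r k) ^+ n.-2) => y q y0 q0'.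
  rewrite le_eqVlt; apply/orP; left; apply/eqP; field.
  by rewrite q0' gt_eqF.
have [m1|m1] := ltP 0 (fine (mu E)); last first.
  have mE0 : fine (mu E) = 0 by apply/eqP; rewrite eq_le m1.
  have T0 : 0 < (1 : R) by [].
  apply: (key _ _ (overlap_layer_norm_le rho0 T0)); rewrite mE0 mul0r mulr0 add0r.
  rewrite min_l; last by rewrite exprn_ge0// mulr_ge0// ltW.
  by rewrite !mulr0 powR0 ?gt_eqF ?invr_gt0 ?ltr0n// mulr0 mul0r.
apply: (key _ _ (overlap_layer_norm_le rho0 m1)).
set t := _ `^ n%:i.
have t0 : 0 < t by rewrite powR_gt0.
have -> : fine (mu E) `^ (n%:i - 1) = t / fine (mu E).
  by rewrite (powRD_gt0 _ _ m1) powRN powRr1.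
apply: (@le_trans _ _ ((r k) ^- n.-1 * (A * (2 * t * (4 * r k) ^+ n)))).
  rewrite ler_wpM2l ?invr_ge0 ?(ltW c0)// ler_wpM2l// E4.
  apply: (@le_trans _ _ (t * (4 * r k) ^+ n + t * (4 * r k) ^+ n)).
    rewrite lerD//; last by rewrite ler_wpM2l ?(ltW t0)// ge_min lexx orbT.
    by rewrite [leLHS]mulrA divfK ?gt_eqF.
  by rewrite le_eqVlt; apply/orP; left; apply/eqP; ring.
rewrite (exprMn n 4 (r k)) (S n n0 (r k)) le_eqVlt; apply/orP; left; apply/eqP; field.
by rewrite gt_eqF.
Qed.

End fixed_set.

(* In dimension 2 the borderline s = 1 would be W^{1,2,oo} in L^oo, which fails. *)
Definition embedding_exponent (s : R) : Prop :=
  (2 < n)%N /\ s = 2 / n%:R \/ n = 2 /\ 2^-1 <= s < 1.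

Lemma potential_avg_bounded_le s : embedding_exponent s ->
  exists2 C : R, 0 <= C & forall E, measurable E -> E `<=` Omega ->
  forall (A : R) (g : 'rV[R]_n -> R) N, 0 <= A -> measurable_fun Omega g ->
    avg_bounded mu Omega n%:i A g ->
    (\sum_(k < N) ((r k) ^- n.-1)%:E * \int[mu]_(x in E) local_mass Omega g (2 * r k) x <=
     (C * A)%:E * (mu E) `^ s)%E.
Proof.
move=> hs; have s0 : 0 < s.
  case: hs => [[_ ->]|[_ /andP[H _]]]; last exact: lt_le_trans H.
  by rewrite divr_gt0// ltr0n.
(* What remains concerns a real sequence with two bounds. A null set E is set aside, so that m >
   0. *)
suff [C C0 HC] : exists2 C : R, 0 <= C & forall (A m : R) N (f : nat -> R), 0 <= A -> 0 < m ->
    (forall k, f k <= 8 * A * m / r k ^+ n.-2) ->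
    (forall k, f k <= 2 * 4 ^+ n * A * m `^ n%:i * r k) ->
    \sum_(k < N) f k <= C * A * m `^ s.
  exists C => // E mE EO A g N A0 mg gA.
  have finE : (mu E < +oo)%E by apply: le_lt_trans finO; apply: le_measure; rewrite ?inE.
  have H k := local_potential_le mE EO k A0 mg gA.
  pose f k := fine (((r k) ^- n.-1)%:E * \int[mu]_(x in E) local_mass Omega g (2 * r k) x)%E.
  have fE k : (((r k) ^- n.-1)%:E * \int[mu]_(x in E) local_mass Omega g (2 * r k) x)%E = (f k)%:E.
    rewrite fineK// ge0_fin_numE; first by have [H1 _] := H k; exact: le_lt_trans H1 (ltry _).
    rewrite mule_ge0 ?lee_fin ?invr_ge0 ?exprn_ge0 ?(ltW (r_gt0 k))//.
    by apply: integral_ge0 => x _; exact: local_mass_ge0.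
  under eq_bigr do rewrite fE; rewrite sumEFin.
  have H1 k : f k <= 8 * A * fine (mu E) / r k ^+ n.-2.
    by have [H1 _] := H k; move: H1; rewrite fE lee_fin.
  have H2 k : f k <= 2 * 4 ^+ n * A * (fine (mu E)) `^ n%:i * r k.
    by have [_] := H k; rewrite fE lee_fin.
  rewrite -[mu E]fineK ?ge0_fin_numE// poweR_EFin -EFinM lee_fin.
  have [m0|m0] := ltP 0 (fine (mu E)); first exact: HC.
  have mE0 : fine (mu E) = 0 by apply/eqP; rewrite eq_le m0 fine_ge0.
  rewrite mE0 powR0 ?gt_eqF// mulr0; apply: sumr_le0 => k _.
  by apply: (le_trans (H1 k)); rewrite mE0 mulr0 mul0r.
case: hs => [[n3 sE]|[nE /andP[s12 s1]]].
  exists (4 * 4 ^+ n / (1 - lam)).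
    by rewrite divr_ge0 ?(ltW ul0)// mulr_ge0// exprn_ge0.
  move=> A m N f A0 m0 f1 f2; set t := m `^ n%:i in f2 *.
  have t0 : 0 < t by rewrite powR_gt0.
  have Q0 : 0 <= 2 * 4 ^+ n * A * t.
    by rewrite mulr_ge0 ?(ltW t0)// mulr_ge0// mulr_ge0// exprn_ge0.
  have a0 : (0 < n.-2)%N by case: n n3 => [|[|[]]].
  have := @sum_le_geometric _ lam h t _ n.-2 N f lam01 h0 t0 Q0 a0 f2.
  move=> H; apply: (le_trans (H _)) => [k|].
    apply: (le_trans (f1 k)); have rk := r_gt0 k.
    have mt : m = t * t * t ^+ n.-2.
      rewrite -{1}(powR_invn (ltW m0)) -/t.
      by case: n n3 => [|[|p]]// _; rewrite !exprS mulrA.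
    rewrite expr_div_n mt; set q := t ^+ n.-2.
    have q0 : 0 <= q by rewrite exprn_ge0// ltW.
    have P0 : 0 <= A * (t * (t * (q / r k ^+ n.-2))).
      do 3 (apply: mulr_ge0; first by rewrite // ltW).
      by rewrite divr_ge0// exprn_ge0// ltW.
    have -> : 8 * A * (t * t * q) / r k ^+ n.-2 = 8 * (A * (t * (t * (q / r k ^+ n.-2)))).
      by ring.
    have -> : 2 * 4 ^+ n * A * t * t * (q / r k ^+ n.-2) =
      (2 * 4 ^+ n) * (A * (t * (t * (q / r k ^+ n.-2)))) by ring.
    rewrite ler_wpM2r//.
    have : 4 ^+ 1 <= 4 ^+ n :> R by rewrite ler_weXn2l// ler1n.
    by rewrite expr1; lra.
  have -> : m `^ s = t * t.
    by rewrite sE (_ : 2 / n%:R = n%:i + n%:i) ?(powRD_gt0 _ _ m0)//; ring.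
  by rewrite le_eqVlt; apply/orP; left; apply/eqP; ring.
(* With q = r/t and t = m^(1/2), the bounds amount to a multiple of t^2 min(1, q), and min(1, q) <=
   q^th for 0 < th <= 1. The powers of lam then sum, and t^(2 - th) = m^s. The condition s < 1 is th
   > 0, s >= 1/2 is th <= 1. *)
pose th := 2 - 2 * s.
have th0 : 0 < th by rewrite /th; lra.
have th1 : th <= 1 by rewrite /th; lra.
have lth : 0 < 1 - lam `^ th.
  have /andP[l0 l1] := lam01; rewrite subr_gt0.
  have <- : 1 `^ th = 1 by rewrite powR1.
  by rewrite gt0_ltr_powR// nnegrE ltW.
exists (32 * h `^ th * (1 - lam `^ th)^-1).
  by rewrite mulr_ge0 ?invr_ge0 ?(ltW lth)// mulr_ge0// powR_ge0.
move=> A m N f A0 m0 f1 f2; set t := m `^ n%:i in f2.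
have t0 : 0 < t by rewrite powR_gt0.
have mt : m = t * t by rewrite -expr2 -{1}(powR_invn (ltW m0)) -/t nE.
have P0 : 0 <= 32 * A * (t * t) * (h / t) `^ th.
  by rewrite mulr_ge0 ?powR_ge0// mulr_ge0 ?mulr_ge0 ?(ltW t0).
have fk k : f k <= 32 * A * (t * t) * (h / t) `^ th * (lam ^+ k) `^ th.
  have lk : 0 <= lam ^+ k by have /andP[l0 _] := lam01; rewrite exprn_ge0// ltW.
  rewrite -[leRHS]mulrA -powRM ?divr_ge0 ?(ltW t0) ?(ltW h0)//.
  have -> : h / t * lam ^+ k = r k / t by ring.
  have P1 : 0 <= 32 * A * (t * t) by rewrite mulr_ge0 ?mulr_ge0 ?(ltW t0).
  have q0 : 0 < r k / t by rewrite divr_gt0.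
  have [q1|q1] := leP 1 (r k / t).
    apply: (le_trans (f1 k)); rewrite nE expr0 divr1 mt.
    apply: (@le_trans _ _ (32 * A * (t * t))).
      by rewrite !ler_wpM2r ?mulr_ge0 ?(ltW t0)//; lra.
    rewrite ler_peMr//.
    have <- : 1 `^ th = 1 by rewrite powR1.
    by apply: ge0_ler_powR; rewrite ?nnegrE// ltW.
  apply: (le_trans (f2 k)); apply: (@le_trans _ _ (32 * A * (t * t) * (r k / t))).
    rewrite nE le_eqVlt; apply/orP; left; apply/eqP; field.
    by rewrite gt_eqF.
  by rewrite ler_wpM2l// ger1_powR// q0 ltW.
apply: (@le_trans _ _ (\sum_(k < N) 32 * A * (t * t) * (h / t) `^ th * (lam ^+ k) `^ th)).
  by apply: ler_sum => k _.
rewrite -mulr_sumr.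
apply: (le_trans (ler_wpM2l P0 (sum_powR_geometric N lam01 th0))).
have -> : (h / t) `^ th = h `^ th * t `^ (- th).
  rewrite powRM ?invr_ge0 ?(ltW t0) ?(ltW h0)//.
  by rewrite -(powR_inv1 (ltW t0)) -powRrM mulN1r.
have -> : m `^ s = (t * t) * t `^ (- th).
  rewrite -{1}[t]powRr1 ?(ltW t0)// -{2}[t]powRr1 ?(ltW t0)//.
  rewrite -!(powRD_gt0 _ _ t0).
  rewrite mt powRM ?(ltW t0)// -(powRD_gt0 _ _ t0); congr (_ `^ _).
  by rewrite /th; ring.
move: (h `^ th) (t `^ (- th)) (_^-1) => x y z.
by rewrite le_eqVlt; apply/orP; left; apply/eqP; ring.
Qed.

End potentials.

(** * From local estimates to the whole domain by compactness *)

Section gluing.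
Context {R : realType} {n : nat}.
Variable Omega : set 'rV[R]_n.
Local Notation mu := (lebesgue_rV n : {sigma_finite_measure set 'rV[R]_n -> \bar R}).
Hypothesis mO : measurable Omega.
Hypothesis bO : bounded_set Omega.

(** The predicate Q couples a function with its right-hand side, so that one argument serves both
    embeddings. The radius and the constant at x0 are fixed before f, hence the final constant is
    uniform over Q. *)
Lemma glue_estimates (Q : ('rV[R]_n -> R) -> (set 'rV[R]_n -> \bar R) -> Prop) :
  (forall f nu, Q f nu -> measurable_fun Omega f /\
     forall E F, measurable E -> measurable F -> E `<=` F -> F `<=` Omega ->
       (0 <= nu E)%E /\ (nu E <= nu F)%E) ->
  (forall x0, closure Omega x0 -> exists r C : R, [/\ 0 < r, 0 <= C &
     forall f nu, Q f nu -> forall E, measurable E ->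
       (forall x, E x -> Omega x /\ `|x - x0| < r) ->
       (\int[mu]_(x in E) `|f x|%:E <= C%:E * nu E)%E]) ->
  exists2 C : R, 0 <= C & forall f nu, Q f nu -> forall E, measurable E ->
    E `<=` Omega -> (\int[mu]_(x in E) `|f x|%:E <= C%:E * nu E)%E.
Proof.
move=> Qmono loc.
have /choice[rC HrC] x0 : exists rC : R * R, closure Omega x0 -> [/\ 0 < rC.1, 0 <= rC.2 &
     forall f nu, Q f nu -> forall E, measurable E ->
       (forall x, E x -> Omega x /\ `|x - x0| < rC.1) ->
       (\int[mu]_(x in E) `|f x|%:E <= rC.2%:E * nu E)%E].
  have [cx|ncx] := pselect (closure Omega x0); last by exists (0, 0).
  by have [r [C H]] := loc x0 cx; exists (r, C).
have coO : compact (closure Omega).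
  apply: bounded_closed_compact; last exact: closed_closure.
  have [M [Mr HM]] := bO; exists (M + 1); split; first exact: num_real.
  move=> K MK x cx; have : closed [set x : 'rV[R]_n | `|x| <= K].
    apply: (@closed_comp _ _ (fun x : 'rV[R]_n => `|x|) [set t | t <= K]).
      by move=> y _; exact: norm_continuous.
    exact: closed_le.
  move=> /closure_id cE; have : closure Omega `<=` closure [set x : 'rV[R]_n | `|x| <= K].
    by apply: closureS => y Oy; apply: HM => //; rewrite (le_lt_trans _ MK)// lerDl.
  by rewrite -cE; apply.
rewrite compact_cover in coO.
have [|x cx|D DO cov] := coO _ (closure Omega) (fun x => ball x (rC x).1).
- by move=> x _; exact: ball_open.
- exists x => //; apply: ballxx; by have [] := HrC x cx.
suff H (s : seq 'rV[R]_n) : (forall x, x \in s -> closure Omega x) ->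
    exists2 C : R, 0 <= C & forall f nu, Q f nu -> forall E, measurable E ->
    (forall x, E x -> Omega x /\ exists2 y, y \in s & `|y - x| < (rC y).1) ->
    (\int[mu]_(x in E) `|f x|%:E <= C%:E * nu E)%E.
  have [|C C0 HC] := H (finmap.enum_fset D); first by move=> x xD; have := DO x xD; rewrite inE.
  exists C => // f nu Qf E mE EO; apply: HC => // x Ex; split; first exact: EO.
  by have [y yD /ball_rVE] := cov x (subset_closure (EO x Ex)); exists y.
(* One ball of the finite cover is removed at a time: E splits into its part in the ball and the
   rest, and monotonicity of nu bounds both right-hand sides by nu E. *)
elim: s => [_|y s IH sO].
  exists 0 => // f nu Qf E mE EO; rewrite mul0e (_ : E = set0) ?integral_set0//.
  by apply/seteqP; split => // x /EO[_ []].
have [|C C0 HC] := IH; first by move=> x xs; apply: sO; rewrite in_cons xs orbT.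
have [r0 K0 HK] := HrC y (sO y (mem_head _ _)).
exists (C + (rC y).2); first exact: addr_ge0.
move=> f nu Qf E mE EO; have [mf mono] := Qmono f nu Qf.
have EsubO : E `<=` Omega by move=> x /EO[].
have mB : measurable (ball y (rC y).1) by apply: rV_open_measurable; exact: ball_open.
have mEB : measurable (E `&` ball y (rC y).1) by exact: measurableI.
have mEnB : measurable (E `\` ball y (rC y).1) by exact: measurableD.
have mnf (A : set 'rV[R]_n) : A `<=` Omega -> measurable_fun A (fun x => `|f x|%:E).
  move=> AO; apply/measurable_EFinP; apply: (measurableT_comp (@normr_measurable R setT)).
  exact: measurable_funS mf.
have EE : E = (E `\` ball y (rC y).1) `|` (E `&` ball y (rC y).1).
  by rewrite setUC setUIDK.
rewrite {1}EE ge0_integral_setU//; last 2 first.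
- by rewrite -EE; exact: mnf.
- by apply/disj_setPS => x [[_ nb] [_ b]]; exact: nb.
have [nu1 nu1'] := mono _ _ mEnB mE (@subDsetl _ _ _) EsubO.
have [nu2 nu2'] := mono _ _ mEB mE (@subIsetl _ _ _) EsubO.
have nuE : (0 <= nu E)%E by exact: le_trans nu1'.
rewrite EFinD ge0_muleDl ?lee_fin//; apply: leeD.
  apply: (@le_trans _ _ (C%:E * nu (E `\` ball y (rC y).1))%E); last first.
    by apply: lee_wpmul2l; rewrite ?lee_fin.
  apply: (HC _ _ Qf _ mEnB) => x [Ex nb]; have [Ox [z]] := EO x Ex.
  rewrite in_cons => /predU1P[->|zs] zx; split => //; last by exists z.
  by exfalso; apply: nb; apply/ball_rVE.
apply: (@le_trans _ _ ((rC y).2%:E * nu (E `&` ball y (rC y).1))%E); last first.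
  by apply: lee_wpmul2l; rewrite ?lee_fin.
apply: (HK _ _ Qf _ mEB) => x [Ex /ball_rVE b]; split; first exact: EsubO.
by rewrite distrC.
Qed.

End gluing.

(** * The two embeddings on a Lipschitz domain *)

Section sobolev_embedding.
Context {R : realType} {n : nat}.
Hypothesis n2 : (2 <= n)%N.
Variable Omega : set 'rV[R]_n.
Hypothesis dO : bounded_lipschitz_domain Omega.
Local Notation mu := (lebesgue_rV n : {sigma_finite_measure set 'rV[R]_n -> \bar R}).
Implicit Types (u : 'rV[R]_n -> R) (Du : 'I_n -> 'rV[R]_n -> R).

Let oO : open Omega. Proof. by case: dO. Qed.
Let bO : bounded_set Omega. Proof. by case: dO. Qed.

Lemma measurable_domain : measurable Omega.
Proof. exact: rV_open_measurable. Qed.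

Lemma domain_lty : (mu Omega < +oo)%E.
Proof. exact: lebesgue_rV_bounded measurable_domain bO. Qed.

Let mO := measurable_domain.
Let finO := domain_lty.

Let i01 : 0 < (n%:R^-1 : R) /\ (n%:R^-1 : R) <= 1.
Proof.
have n0 : (0 < n)%N by exact: leq_trans n2.
by split; [rewrite invr_gt0 ltr0n|rewrite invf_le1 ?ltr0n// ler1n].
Qed.

Let scale_sum (k a b : R) (X P Q : \bar R) : 0 < k -> 0 <= a -> 0 <= b ->
  (0 <= P)%E -> (0 <= Q)%E -> (k%:E * X <= a%:E * P + b%:E * Q)%E ->
  (X <= ((a + b) / k)%:E * (P + Q))%E.
Proof.
move=> k0 a0 b0 P0 Q0 H.
have -> : X = ((k^-1)%:E * (k%:E * X))%E by rewrite muleA -EFinM mulVf ?gt_eqF// mul1e.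
rewrite mulrC EFinM -muleA; apply: lee_wpmul2l; first by rewrite lee_fin invr_ge0 ltW.
apply: (le_trans H); rewrite EFinD ge0_muleDl ?lee_fin// !ge0_muleDr//.
by apply: leeD; [rewrite leeDl|rewrite leeDr]; rewrite ?mule_ge0 ?lee_fin.
Qed.

Let weighted_exchange N (c : nat -> R) (X : nat -> 'I_n -> \bar R) :
  (forall k, 0 <= c k) -> (forall k i, (0 <= X k i)%E) ->
  (\sum_(k < N) (c k)%:E * \sum_(i < n) X k i = \sum_(i < n) \sum_(k < N) (c k)%:E * X k i)%E.
Proof.
move=> c0 X0; rewrite exchange_big/=; apply: eq_bigr => k _.
by rewrite ge0_sume_distrr.
Qed.

Lemma layer_norm_integrable s g : 0 < s -> s <= 1 -> measurable_fun Omega g ->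
  (layer_norm mu Omega s g < +oo)%E -> mu.-integrable Omega (EFin \o g).
Proof.
move=> s0 s1 mg Ng; apply/integrableP; split; first exact/measurable_EFinP.
rewrite (_ : (\int[mu]_(x in Omega) _)%E = (\int[mu]_(x in Omega) `|g x|%:E)%E)//.
rewrite integral_layer//; apply: (le_lt_trans (le_layer_norm_exponent mO finO s0 s1 mg)).
rewrite lte_mul_pinfty ?poweR_ge0// ge0_fin_numE ?poweR_ge0//.
by rewrite -(fineK (_ : mu Omega \is a fin_num)) ?ge0_fin_numE// poweR_EFin ltry.
Qed.

Lemma avg_bounded_integrable s A g : measurable_fun Omega g ->
  avg_bounded mu Omega s A g -> mu.-integrable Omega (EFin \o g).
Proof.
move=> mg gA; apply/integrableP; split; first exact/measurable_EFinP.
apply: (le_lt_trans (gA Omega mO (@subset_refl _ _))).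
by rewrite -(fineK (_ : mu Omega \is a fin_num)) ?ge0_fin_numE// poweR_EFin -EFinM ltry.
Qed.

(** The embedding of W^{1,n,1} in L^oo: a bound of the averages over all sets E by one number. The
    sum over the scales is supplied by [potential_layer_norm_le]. *)
Lemma sobolev_bounded : exists2 C : R, 0 <= C & forall u Du,
  mu.-integrable Omega (EFin \o u) ->
  (forall i, weak_partial Omega i u (Du i)) ->
  (forall i, (layer_norm mu Omega n%:R^-1 (Du i) < +oo)%E) ->
  forall E, measurable E -> E `<=` Omega ->
  (\int[mu]_(x in E) `|u x|%:E <= C%:E * (mu E * (\int[mu]_(x in Omega) `|u x|%:E +
     \sum_(i < n) layer_norm mu Omega n%:R^-1 (Du i))))%E.
Proof.
have [i0 i1] := i01.
pose Q u (nu : set 'rV[R]_n -> \bar R) := exists Du,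
  [/\ mu.-integrable Omega (EFin \o u), forall i, weak_partial Omega i u (Du i),
    forall i, (layer_norm mu Omega n%:R^-1 (Du i) < +oo)%E &
    nu = fun E => (mu E * (\int[mu]_(x in Omega) `|u x|%:E +
     \sum_(i < n) layer_norm mu Omega n%:R^-1 (Du i)))%E].
suff [C C0 HC] : exists2 C : R, 0 <= C & forall f nu, Q f nu -> forall E, measurable E ->
    E `<=` Omega -> (\int[mu]_(x in E) `|f x|%:E <= C%:E * nu E)%E.
  exists C => // u Du iu wDu NDu E mE EO.
  by apply: (HC u (fun E => (mu E * (\int[mu]_(x in Omega) `|u x|%:E +
     \sum_(i < n) layer_norm mu Omega n%:R^-1 (Du i)))%E)) => //; exists Du.
have S0 u Du : (0 <= \int[mu]_(x in Omega) `|u x|%:E +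
     \sum_(i < n) layer_norm mu Omega n%:R^-1 (Du i))%E.
  by rewrite adde_ge0 ?integral_ge0// sume_ge0// => i _; exact: layer_norm_ge0.
apply: (glue_estimates mO bO) => [f nu [Du [iu wDu NDu ->]]|x0 cx0].
  split; first by apply/measurable_EFinP; exact: measurable_int iu.
  move=> E F mE mF EF FO; split; first by rewrite mule_ge0.
  by rewrite lee_wpmul2r//; apply: le_measure; rewrite ?inE.
have [r [tau [h [e cO]]]] := cone_condition_lipschitz dO cx0.
have [r0 /[dup]tau01 /andP[tau0 tau1] h0 e1 _] := cO.
have k0 := cone_mass_gt0 cO.
have lam01 : 0 < cone_ratio tau < 1 by rewrite cone_ratio_gt0//= cone_ratio_lt1.
have cs0 := cone_slope_ge0 tau01.
have p0 := potential_cst_ge0 (n := n) lam01.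
set a := (cone_slope tau / h) ^+ n.
set b := cone_slope tau ^+ n.-1 * @potential_cst R n (cone_ratio tau).
have a0 : 0 <= a by rewrite exprn_ge0// divr_ge0// ltW.
have b0 : 0 <= b by rewrite mulr_ge0 ?exprn_ge0.
exists r, ((a + b) / @cone_mass R n tau); split => //.
  by rewrite divr_ge0 ?(ltW k0)// addr_ge0.
move=> f nu [Du [iu wDu NDu ->]] E mE EOr.
have EO : E `<=` Omega by move=> x /EOr[].
have finE : (mu E < +oo)%E by apply: le_lt_trans finO; apply: le_measure; rewrite ?inE.
have mDu i : measurable_fun Omega (Du i) by have [_ [] ] := wDu i.
have iDu i : mu.-integrable Omega (EFin \o Du i).
  exact: layer_norm_integrable i0 i1 (mDu i) (NDu i).
have Nsum0 : (0 <= \sum_(i < n) layer_norm mu Omega n%:R^-1 (Du i))%E.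
  by apply: sume_ge0 => i _; exact: layer_norm_ge0.
rewrite ge0_muleDr ?integral_ge0//; apply: scale_sum => //.
- by rewrite mule_ge0// integral_ge0.
- by rewrite mule_ge0.
have := @chart_estimate R n Omega x0 r tau h e oO finO cO E
  ((@potential_cst R n (cone_ratio tau))%:E *
   (mu E * \sum_(i < n) layer_norm mu Omega n%:R^-1 (Du i)))%E f Du mE EOr iu iDu wDu.
move=> H; rewrite /b EFinM -[X in (_ <= _ + X)%E]muleA; apply: H => N.
pose c k : R := (h * cone_ratio tau ^+ k) ^- n.-1.
pose X k i := (\int[mu]_(x in E) local_mass Omega (Du i) (2 * (h * cone_ratio tau ^+ k)) x)%E.
have c0 k : 0 <= c k.
  rewrite invr_ge0 exprn_ge0// mulr_ge0 ?(ltW h0)// exprn_ge0// ltW//.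
  by case/andP: lam01.
have X0 k i : (0 <= X k i)%E by apply: integral_ge0 => x _; exact: local_mass_ge0.
apply: (@le_trans _ _ (\sum_(i < n) \sum_(k < N) (c k)%:E * X k i)%E).
  by rewrite -weighted_exchange.
rewrite ge0_sume_distrr; last by move=> i _; exact: layer_norm_ge0.
rewrite ge0_sume_distrr; last by move=> i _; rewrite mule_ge0//; exact: layer_norm_ge0.
apply: lee_sum => i _; rewrite muleA -[mu E]fineK ?ge0_fin_numE// -EFinM.
exact: (potential_layer_norm_le n2 mO finO lam01 h0 mE EO).
Qed.

(** The embedding of W^{1,n/(n-1),oo} in weak L^{1/(1-s)}, from [potential_avg_bounded_le];
    [avg_bounded] with exponent 1/n encodes that Du is in L^{n/(n-1),oo}. *)
Lemma sobolev_weak_bounded s : @embedding_exponent R n s -> exists2 C : R, 0 <= C &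
  forall u Du (A : R), 0 <= A -> mu.-integrable Omega (EFin \o u) ->
  (forall i, weak_partial Omega i u (Du i)) ->
  (forall i, avg_bounded mu Omega n%:R^-1 A (Du i)) ->
  forall E, measurable E -> E `<=` Omega ->
  (\int[mu]_(x in E) `|u x|%:E <=
   C%:E * (A%:E * (mu E) `^ s + mu E * \int[mu]_(x in Omega) `|u x|%:E))%E.
Proof.
move=> hs; have s0 : 0 <= s.
  case: hs => [[_ ->]|[_ /andP[H _]]]; last exact: le_trans H.
  by rewrite divr_ge0.
pose Q u (nu : set 'rV[R]_n -> \bar R) := exists Du (A : R),
  [/\ 0 <= A, mu.-integrable Omega (EFin \o u), forall i, weak_partial Omega i u (Du i),
    forall i, avg_bounded mu Omega n%:R^-1 A (Du i) &
    nu = fun E => (A%:E * (mu E) `^ s + mu E * \int[mu]_(x in Omega) `|u x|%:E)%E].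
suff [C C0 HC] : exists2 C : R, 0 <= C & forall f nu, Q f nu -> forall E, measurable E ->
    E `<=` Omega -> (\int[mu]_(x in E) `|f x|%:E <= C%:E * nu E)%E.
  exists C => // u Du A A0 iu wDu DuA E mE EO.
  apply: (HC u (fun E => (A%:E * (mu E) `^ s + mu E * \int[mu]_(x in Omega) `|u x|%:E)%E)) => //.
  by exists Du, A.
have I0 u : (0 <= \int[mu]_(x in Omega) `|u x|%:E)%E by exact: integral_ge0.
apply: (glue_estimates mO bO) => [f nu [Du [A [A0 iu wDu DuA ->]]]|x0 cx0].
  split; first by apply/measurable_EFinP; exact: measurable_int iu.
  move=> E F mE mF EF FO; have EFmu : (mu E <= mu F)%E by apply: le_measure; rewrite ?inE.
  split; first by rewrite adde_ge0// mule_ge0// ?poweR_ge0.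
  apply: leeD; last by rewrite lee_wpmul2r.
  by rewrite lee_wpmul2l ?lee_fin// poweR_mono.
have [r [tau [h [e cO]]]] := cone_condition_lipschitz dO cx0.
have [r0 /[dup]tau01 /andP[tau0 tau1] h0 e1 _] := cO.
have k0 := cone_mass_gt0 cO.
have lam01 : 0 < cone_ratio tau < 1 by rewrite cone_ratio_gt0//= cone_ratio_lt1.
have cs0 := cone_slope_ge0 tau01.
have [p p0 Hp] := potential_avg_bounded_le n2 mO finO lam01 h0 hs.
set a := (cone_slope tau / h) ^+ n.
set b := cone_slope tau ^+ n.-1 * (n%:R * p).
have a0 : 0 <= a by rewrite exprn_ge0// divr_ge0// ltW.
have b0 : 0 <= b by rewrite mulr_ge0 ?exprn_ge0// mulr_ge0.
exists r, ((b + a) / @cone_mass R n tau); split => //.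
  by rewrite divr_ge0 ?(ltW k0)// addr_ge0.
move=> f nu [Du [A [A0 iu wDu DuA ->]]] E mE EOr.
have EO : E `<=` Omega by move=> x /EOr[].
have mDu i : measurable_fun Omega (Du i) by have [_ [] ] := wDu i.
have iDu i : mu.-integrable Omega (EFin \o Du i).
  exact: avg_bounded_integrable (mDu i) (DuA i).
apply: scale_sum => //; rewrite ?mule_ge0 ?poweR_ge0//.
have H := @chart_estimate R n Omega x0 r tau h e oO finO cO E
  ((n%:R * p)%:E * (A%:E * (mu E) `^ s))%E f Du mE EOr iu iDu wDu.
rewrite addeC /b EFinM -[X in (_ <= _ + X)%E]muleA; apply: H => N.
pose c k : R := (h * cone_ratio tau ^+ k) ^- n.-1.
pose X k i := (\int[mu]_(x in E) local_mass Omega (Du i) (2 * (h * cone_ratio tau ^+ k)) x)%E.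
have c0 k : 0 <= c k.
  rewrite invr_ge0 exprn_ge0// mulr_ge0 ?(ltW h0)// exprn_ge0// ltW//.
  by case/andP: lam01.
have X0 k i : (0 <= X k i)%E by apply: integral_ge0 => x _; exact: local_mass_ge0.
apply: (@le_trans _ _ (\sum_(i < n) \sum_(k < N) (c k)%:E * X k i)%E).
  by rewrite -weighted_exchange.
apply: (@le_trans _ _ (\sum_(i < n) ((p * A)%:E * (mu E) `^ s))%E).
  by apply: lee_sum => i _; exact: Hp.
have -> : (n%:R * p)%:E = (\sum_(i < n) p%:E)%E.
  by rewrite sumEFin sumr_const card_ord mulr_natl.
rewrite ge0_sume_distrl; last by move=> i _; rewrite lee_fin.
by apply: lee_sum => i _; rewrite EFinM muleA.
Qed.

End sobolev_embedding.

(** * Products with Sobolev functions *)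

Section bounded_multiplier.
Context d (T : measurableType d) (R : realType).
Variables (mu : {sigma_finite_measure set T -> \bar R}) (D : set T).
Hypothesis mD : measurable D.
Hypothesis finD : (mu D < +oo)%E.
Implicit Types (f g c u : T -> R) (s K : R).
Local Notation N := (layer_norm mu D).

Lemma avg_bounded_null K e u : 0 <= K -> 0 < e -> measurable_fun D u ->
  avg_bounded mu D 1 K u -> mu (suplevel D u (K + e)) = 0%E.
Proof.
move=> K0 e0 mu_ uK; set Z := suplevel D u (K + e).
have mZ : measurable Z by exact: measurable_suplevel.
have fZ : mu Z \is a fin_num by rewrite ge0_fin_numE// measure_suplevel_lty.
have := uK Z mZ (@subset_suplevel _ _ _ _ _ _); rewrite poweRe1// => H.
have : ((K + e)%:E * mu Z <= K%:E * mu Z)%E.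
  apply: le_trans H; rewrite -integral_cst//.
  apply: ge0_le_integral => //.
  - by move=> *; rewrite lee_fin addr_ge0// ltW.
  - apply/measurable_EFinP; apply: (measurableT_comp (@normr_measurable R setT)).
    by apply: measurable_funS mu_ => //; exact: subset_suplevel.
  - by move=> x [_ /ltW]; rewrite lee_fin.
rewrite -(fineK fZ) -!EFinM lee_fin mulrDl gerDl pmulr_rle0// => Z0.
by congr EFin; apply/eqP; rewrite eq_le Z0 fine_ge0.
Qed.

(** For each e > 0, |u| <= K + e off a null set, which does not affect the level measures; then e
    tends to 0. A vanishing norm of f is treated apart because e is divided by it. *)
Lemma layer_normM_bounded s K f u : 0 < s -> s <= 1 -> 0 <= K ->
  measurable_fun D f -> measurable_fun D u -> avg_bounded mu D 1 K u ->
  (N s f < +oo)%E -> (N s (fun x => f x * u x)%R <= K%:E * N s f)%E.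
Proof.
move=> s0 s1 K0 mf mu_ uK Nf.
have fN : N s f \is a fin_num by rewrite ge0_fin_numE// layer_norm_ge0.
have main e : 0 < e -> (N s (fun x => f x * u x)%R <= (K + e)%:E * N s f)%E.
  move=> e0; have Ke : 0 < K + e by rewrite ltr_wpDl.
  rewrite -layer_normZ//; apply: le_layer_norm => //; first exact: ltW.
  - exact: measurable_funM.
  - exact: measurable_funM.
  move=> a a0; pose Z := suplevel D u (K + e).
  have mZ : measurable Z by exact: measurable_suplevel.
  have mS : measurable (suplevel D (fun x => (K + e) * f x) a).
    by apply: measurable_suplevel => //; exact: measurable_funM.
  apply: (@le_trans _ _ (mu (suplevel D (fun x => (K + e) * f x)%R a `|` Z))).
    apply: le_measure; rewrite ?inE//.
    - by apply: measurable_suplevel => //; exact: measurable_funM.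
    - exact: measurableU.
    move=> x [Dx ax]; case: (leP `|u x| (K + e)) => ux; [left|right] => //.
    split => //; apply: (lt_le_trans ax); rewrite !normrM (ger0_norm (ltW Ke)) mulrC.
    exact: ler_wpM2r.
  apply: (le_trans (measureU2 _ mS mZ)).
  by rewrite [X in (_ + X)%E](avg_bounded_null K0 e0 mu_ uK) adde0.
have [N0|N0] := eqVneq (N s f) 0%E.
  by rewrite N0 mule0; have := main 1 ltr01; rewrite N0 mule0.
have Npos : 0 < fine (N s f).
  by rewrite fine_gt0// lt_neqAle eq_sym N0 layer_norm_ge0.
apply/lee_addgt0Pr => e e0.
have := main (e / fine (N s f)) (divr_gt0 e0 Npos).
rewrite EFinD ge0_muleDl ?lee_fin ?divr_ge0 ?(ltW e0) ?(ltW Npos)//.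
by rewrite -[X in (_ + _ * X)%E]fineK// -EFinM divfK// gt_eqF.
Qed.

Lemma layer_normM_le s (M : R) f g : 0 < s -> s <= 1 -> 0 < M ->
  measurable_fun D f -> measurable_fun D g -> (forall x, D x -> `|g x| <= M) ->
  (N s (fun x => g x * f x)%R <= M%:E * N s f)%E.
Proof.
move=> s0 s1 M0 mf mg gM; rewrite -layer_normZ//.
apply: le_layer_norm_norm => //; [exact: ltW|exact: measurable_funM|exact: measurable_funM|].
by move=> x Dx; rewrite !normrM ler_wpM2r// (le_trans (gM x Dx))// ler_norm.
Qed.

(** The part of c above M has small norm and is multiplied by the sup bound of u, the part below M
    by the norm of u. The truncation uses e/2 and the constant is 2M because the quasi-triangle
    inequality costs a factor 2. *)
Lemma layer_normM_split s c e : 0 < s -> s <= 1 -> measurable_fun D c ->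
  (N s c < +oo)%E -> 0 < e -> exists2 M : R, 0 <= M & forall K u, 0 <= K ->
    measurable_fun D u -> avg_bounded mu D 1 K u ->
    (N s (fun x => c x * u x)%R <= (e * K)%:E + M%:E * N s u)%E.
Proof.
move=> s0 s1 mc Nc e0.
have [M M0 HM] := layer_norm_truncation mD finD s0 mc Nc (divr_gt0 e0 (ltr0Sn R 1)).
exists (2 * M); first by rewrite mulr_ge0// ltW.
move=> K u K0 mu_ uK.
pose c1 x := if `|c x| <= M then 0 else c x; pose c2 x := if `|c x| <= M then c x else 0.
have mset : measurable_fun D (fun x => `|c x| <= M).
  apply: measurable_fun_ler => //.
  exact: (measurableT_comp (@normr_measurable R setT) mc).
have mc1 : measurable_fun D c1 by apply: measurable_fun_if => //; apply: measurable_funS mc.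
have mc2 : measurable_fun D c2 by apply: measurable_fun_if => //; apply: measurable_funS mc.
have -> : (fun x => c x * u x) = (fun x => (c1 x * u x) + (c2 x * u x)).
  by apply/funext => x; rewrite /c1 /c2; case: ifP => _; rewrite mul0r ?addr0 ?add0r.
have m1 : measurable_fun D (fun x => c1 x * u x) by exact: measurable_funM.
have m2 : measurable_fun D (fun x => c2 x * u x) by exact: measurable_funM.
apply: (le_trans (layer_normD mu mD s0 s1 m1 m2)).
rewrite ge0_muleDr ?layer_norm_ge0//; apply: leeD.
  apply: (@le_trans _ _ (2%:E * (K%:E * N s c1))%E).
    rewrite lee_wpmul2l//; apply: layer_normM_bounded => //.
    by apply: (lt_trans HM); rewrite ltry.
  have -> : (e * K)%:E = (2%:E * (K%:E * (e / 2)%:E))%E by rewrite -!EFinM; congr EFin; lra.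
  by rewrite lee_wpmul2l// lee_wpmul2l ?lee_fin// ltW.
rewrite EFinM -muleA lee_wpmul2l//; apply: layer_normM_le => // x _.
by rewrite /c2; case: ifP => // _; rewrite normr0 ltW.
Qed.

End bounded_multiplier.

(** * The four products, in the norms of the theorem *)

Section sobolev_lorentz_estimates.
Context {R : realType} {n : nat}.
Hypothesis n2 : (2 <= n)%N.
Variable Omega : set 'rV[R]_n.
Hypothesis dO : bounded_lipschitz_domain Omega.
Local Notation mu := (lebesgue_rV n : {sigma_finite_measure set 'rV[R]_n -> \bar R}).
Local Notation N := (layer_norm mu Omega).
Local Notation i_n := (n%:R^-1 : R).
Local Notation p := (n%:R%:E : \bar R).
Local Notation p' := ((n%:R / (n%:R - 1))%:E : \bar R).
Implicit Types (c f g u v w : 'rV[R]_n -> R) (b Du Dv Dw : 'rV[R]_n -> 'rV[R]_n).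
Implicit Types (K s e eps : R).

Let mO := measurable_domain dO.
Let finO := domain_lty dO.

Lemma dim_gt1 : 1 < n%:R :> R.
Proof. by rewrite (ltr_nat R 1 n). Qed.

Lemma dim_gt0 : 0 < n%:R :> R.
Proof. exact: lt_trans dim_gt1. Qed.

Lemma invdim_gt0 : 0 < i_n.
Proof. by rewrite invr_gt0 dim_gt0. Qed.

Lemma invdim_lt1 : i_n < 1.
Proof. by rewrite invf_lt1 ?dim_gt1 ?dim_gt0. Qed.

Let n1 := dim_gt1.
Let n0 := dim_gt0.
Let i0 := invdim_gt0.
Let i1 := invdim_lt1.

Lemma poweR_measure_fin s : ((mu Omega) `^ s)%E \is a fin_num.
Proof.
have f : mu Omega \is a fin_num by rewrite ge0_fin_numE.
by rewrite -(fineK f) poweR_EFin.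
Qed.

Lemma norm_L_ge0 (P Q : \bar R) f : (0 <= norm_L Omega P Q f)%E.
Proof.
rewrite /norm_L /lorentz_norm; case: Q => [s| |]; first exact: poweR_ge0.
  apply: (@le_trans _ _ ((1 `^ (fine P)^-1)%:E * rearrangement mu Omega f 1)%E).
    by rewrite mule_ge0 ?lee_fin ?powR_ge0// rearrangement_ge0.
  by apply: ereal_sup_ubound; exists 1 => //=; rewrite in_itv/= andbT.
apply: (@le_trans _ _ ((1 `^ (fine P)^-1)%:E * rearrangement mu Omega f 1)%E).
  by rewrite mule_ge0 ?lee_fin ?powR_ge0// rearrangement_ge0.
by apply: ereal_sup_ubound; exists 1 => //=; rewrite in_itv/= andbT.
Qed.

Lemma norm_W_ge0 (P Q : \bar R) u Du : (0 <= norm_W Omega P Q u Du)%E.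
Proof. by rewrite adde_ge0 ?norm_L_ge0// sume_ge0// => i _; exact: norm_L_ge0. Qed.

Lemma norm_L_le_W (P Q : \bar R) u Du :
  (norm_L Omega P Q u <= norm_W Omega P Q u Du)%E.
Proof. by rewrite leeDl// sume_ge0// => i _; exact: norm_L_ge0. Qed.

Lemma norm_L_partial_le_W (P Q : \bar R) u Du i :
  (norm_L Omega P Q (fun x => Du x ord0 i) <= norm_W Omega P Q u Du)%E.
Proof.
rewrite /norm_W (bigD1 i)//= addeCA leeDl// adde_ge0 ?norm_L_ge0//.
by rewrite sume_ge0// => j _; exact: norm_L_ge0.
Qed.

Lemma sobolev_norm_W_lty (P Q : \bar R) u Du : sobolev Omega P Q u Du ->
  (norm_W Omega P Q u Du < +oo)%E.
Proof.
move=> [[_ Nu] HD]; rewrite lte_add_pinfty//; apply: lte_sum_pinfty => i _.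
by have [_ []] := HD i.
Qed.

Lemma norm_L1E f : measurable_fun Omega f ->
  norm_L Omega p 1%E f = (n%:R%:E * N i_n f)%E.
Proof. by move=> mf; rewrite /norm_L lorentz_norm1E// dim_gt0. Qed.

Lemma layer_norm_le_norm_L f : measurable_fun Omega f ->
  (N i_n f <= norm_L Omega p 1%E f)%E.
Proof.
move=> mf; rewrite norm_L1E// -[leLHS]mul1e lee_wpmul2r ?layer_norm_ge0//.
by rewrite lee_fin ltW// dim_gt1.
Qed.

(** The exponent n/(n-1) is 1/(1 - 1/n), so the constant K/s of [avg_bounded_weak_type] is nK with s
    = 1/n. *)
Lemma norm_Ly_avg_bounded f K : 0 <= K -> measurable_fun Omega f ->
  (norm_L Omega p' +oo%E f <= K%:E)%E -> avg_bounded mu Omega i_n (n%:R * K) f.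
Proof.
move=> K0 mf fK.
have p0 : 0 < n%:R / (n%:R - 1) :> R by rewrite divr_gt0// subr_gt0.
rewrite mulrC -[X in K * X]invrK; apply: avg_bounded_weak_type => //.
move=> a a0; have -> : (1 - i_n)^-1 = n%:R / (n%:R - 1).
  have h : n%:R - 1 != 0 :> R by rewrite gt_eqF// subr_gt0.
  rewrite -[X in X - _](divff (_ : n%:R != 0)) ?gt_eqF// -[X in _ - X]mul1r -mulrBl.
  by rewrite invf_div.
exact: (lorentz_normy_weak_type mO finO p0 mf fK a0).
Qed.

Lemma sobolev_sup_bounded : exists2 C : R, 0 <= C & forall u Du K,
  sobolev Omega p 1%E u Du -> (norm_W Omega p 1%E u Du <= K%:E)%E ->
  avg_bounded mu Omega 1 (C * K) u.
Proof.
have [C C0 HC] := sobolev_bounded n2 dO.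
pose a := fine ((mu Omega) `^ (1 - i_n))%E.
have a0 : 0 <= a by rewrite fine_ge0// poweR_ge0.
exists (C * (a + 1)); first by rewrite mulr_ge0// addr_ge0.
move=> u Du K [[mu_ Nu] HD] uK E mE EO; rewrite poweRe1//.
have mD i : measurable_fun Omega (fun x => Du x ord0 i) by have [_ []] := HD i.
have ND i : (N i_n (fun x => Du x ord0 i) < +oo)%E.
  apply: (le_lt_trans (layer_norm_le_norm_L (mD i))).
  by have [_ []] := HD i.
have Nu' : (N i_n u < +oo)%E by apply: (le_lt_trans (layer_norm_le_norm_L mu_)).
have iu : mu.-integrable Omega (EFin \o u).
  by apply: (layer_norm_integrable dO invdim_gt0 (ltW invdim_lt1)).
have K0 : (0 <= K%:E)%E := le_trans (norm_W_ge0 _ _ _ _) uK.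
apply: (le_trans (HC u (fun i x => Du x ord0 i) iu _ ND E mE EO)).
  by move=> i; have [] := HD i.
rewrite -mulrA !EFinM -muleA lee_wpmul2l ?lee_fin// muleC lee_wpmul2r//.
rewrite EFinD ge0_muleDl ?lee_fin// mul1e; apply: leeD.
  rewrite integral_layer//.
  apply: (le_trans (le_layer_norm_exponent mO finO invdim_gt0 (ltW invdim_lt1) mu_)).
  rewrite -[X in (X * _)%E]fineK ?poweR_measure_fin// lee_wpmul2l//.
  apply: (le_trans (layer_norm_le_norm_L mu_)).
  by apply: le_trans uK; exact: norm_L_le_W.
apply: le_trans uK; apply: (@le_trans _ _ (\sum_(i < n) norm_L Omega p 1%E (fun x => Du x ord0 i))%E).
  by apply: lee_sum => i _; exact: layer_norm_le_norm_L.
by rewrite leeDr// norm_L_ge0.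
Qed.

(** In the lower order term of [sobolev_weak_bounded], mu(E) is at most mu(Omega)^(1-s) mu(E)^s
    since s <= 1, and the L^1 norm of w is controlled by its weak norm on Omega. *)
Lemma sobolev_weak_sup_bounded s : s <= 1 -> @embedding_exponent R n s ->
  exists2 C : R, 0 <= C & forall w Dw K,
  sobolev Omega p' +oo%E w Dw -> (norm_W Omega p' +oo%E w Dw <= K%:E)%E ->
  avg_bounded mu Omega s (C * K) w.
Proof.
move=> s1 hs; have s0 : 0 < s.
  case: hs => [[_ ->]|[_ /andP[H _]]]; first by rewrite divr_gt0// dim_gt0.
  by apply: lt_le_trans H; rewrite invr_gt0.
have [C C0 HC] := sobolev_weak_bounded n2 dO hs.
pose a := fine ((mu Omega) `^ i_n)%E; pose a' := fine ((mu Omega) `^ (1 - s))%E.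
have a0 : 0 <= a by rewrite fine_ge0// poweR_ge0.
have a'0 : 0 <= a' by rewrite fine_ge0// poweR_ge0.
exists (C * n%:R * (1 + a' * a)).
  by rewrite mulr_ge0 ?addr_ge0 ?mulr_ge0// ltW.
move=> w Dw K [[mw Nw] HD] wK E mE EO.
have K0 : 0 <= K by rewrite -lee_fin; exact: le_trans (norm_W_ge0 _ _ _ _) wK.
have mD i : measurable_fun Omega (fun x => Dw x ord0 i) by have [_ []] := HD i.
have AD i : avg_bounded mu Omega i_n (n%:R * K) (fun x => Dw x ord0 i).
  by apply: norm_Ly_avg_bounded => //; apply: le_trans wK; exact: norm_L_partial_le_W.
have Aw : avg_bounded mu Omega i_n (n%:R * K) w.
  by apply: norm_Ly_avg_bounded => //; apply: le_trans wK; exact: norm_L_le_W.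
have nK0 : 0 <= n%:R * K by rewrite mulr_ge0// ltW.
have iw : mu.-integrable Omega (EFin \o w) := avg_bounded_integrable dO mw Aw.
apply: (le_trans (HC w (fun i x => Dw x ord0 i) _ nK0 iw _ AD E mE EO)).
  by move=> i; have [] := HD i.
have finE : mu E \is a fin_num.
  by rewrite ge0_fin_numE//; apply: le_lt_trans finO; apply: le_measure; rewrite ?inE.
have IW : (\int[mu]_(x in Omega) `|w x|%:E <= (n%:R * K * a)%:E)%E.
  by apply: (le_trans (Aw Omega mO (@subset_refl _ _))); rewrite -[X in (_ * X)%E]fineK ?poweR_measure_fin.
have EE : (mu E <= a'%:E * (mu E) `^ s)%E.
  apply: (@le_trans _ _ ((mu E) `^ (1 - s) * (mu E) `^ s)%E).
    rewrite -(fineK finE) !poweR_EFin -EFinM lee_fin -powRD subrK ?oner_eq0//.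
    by rewrite powRr1// fine_ge0.
  rewrite lee_wpmul2r ?poweR_ge0//.
  rewrite /a' fineK ?poweR_measure_fin// poweR_mono ?subr_ge0//.
  by apply: le_measure; rewrite ?inE.
have -> : C * n%:R * (1 + a' * a) * K = C * (n%:R * K + (a' * (n%:R * K * a))) by ring.
rewrite (EFinM C) -[in leRHS]muleA lee_wpmul2l ?lee_fin//.
rewrite EFinD ge0_muleDl ?lee_fin ?mulr_ge0 ?(ltW n0)// leeD2l// (EFinM a') muleAC.
by apply: lee_pmul => //; exact: integral_ge0.
Qed.

(** The extension of the functional is integration against g over the whole space; integrability of
    each product g w makes it linear. *)
Lemma norm_Wm1_le (P Q : \bar R) g (M : R) : 0 <= M ->
  mu.-integrable Omega (EFin \o g) ->
  (forall w Dw, sobolev0 Omega (hoelder_conjugate P) (hoelder_conjugate Q) w Dw ->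
    mu.-integrable Omega (EFin \o (fun x => g x * w x)) /\
    (`|\int[mu]_(x in Omega) (g x * w x)|%:E <=
      M%:E * norm_W Omega (hoelder_conjugate P) (hoelder_conjugate Q) w Dw)%E) ->
  (norm_Wm1 Omega P Q g <= M%:E)%E.
Proof.
move=> M0 ig H; apply: ereal_inf_lbound; exists M => //; split => //.
  split; first by apply/measurable_EFinP; exact: measurable_int ig.
  move=> K cK KO; apply: (integrableS mO) => //; exact: rV_compact_measurable.
exists (fun w => \int[mu]_(x in Omega) (g x * w x)) => //; split; last first.
  by move=> w Dw /H[].
move=> a u Du w Dw /H[iu _] /H[iw _].
have -> : (fun x => g x * (a * u x + w x)) = (fun x => a * (g x * u x) + g x * w x).
  by apply/funext => x; rewrite mulrDr mulrCA.
rewrite RintegralD//; first by rewrite RintegralZl.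
rewrite (_ : _ \o _ = (fun x => a%:E * (EFin \o (fun x => g x * u x)%R) x)%E)//.
exact: integrableZl.
Qed.

Lemma hoelder_conjugate_dim : hoelder_conjugate p = p'.
Proof.
by rewrite /hoelder_conjugate/= eqe gt_eqF//= inver gt_eqF ?subr_gt0.
Qed.

Lemma hoelder_conjugate_dim' : hoelder_conjugate p' = p.
Proof. by rewrite -hoelder_conjugate_dim hoelder_conjugateK. Qed.

Lemma measurable_coords (F : 'rV[R]_n -> 'rV[R]_n) : measurable_fun Omega F ->
  forall i, measurable_fun Omega (fun x => F x ord0 i).
Proof. by move=> mF i; exact: (measurableT_comp (@measurable_coord R n i) mF). Qed.

Lemma measurable_enorm (F : 'rV[R]_n -> 'rV[R]_n) :
  (forall i, measurable_fun Omega (fun x => F x ord0 i)) ->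
  measurable_fun Omega (fun x => enorm (F x)).
Proof.
move=> mF; rewrite /enorm /dotp.
apply: (@measurableT_comp _ _ _ _ _ _ (@Num.sqrt R)).
  by apply: continuous_measurable_fun; exact: sqrt_continuous.
by apply: measurable_sum => i; exact: measurable_funM.
Qed.

Lemma enorm_ge0 (y : 'rV[R]_n) : 0 <= enorm y.
Proof. exact: sqrtr_ge0. Qed.

Lemma enormZ (a : R) (y : 'rV[R]_n) : enorm (a *: y) = `|a| * enorm y.
Proof.
rewrite /enorm (_ : dotp _ _ = a ^+ 2 * dotp y y); last first.
  by rewrite /dotp mulr_sumr; apply: eq_bigr => i _; rewrite !mxE; ring.
by rewrite sqrtrM ?sqr_ge0// sqrtr_sqr.
Qed.

Lemma le_norm_L1 f g : measurable_fun Omega f -> measurable_fun Omega g ->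
  (forall x, Omega x -> `|f x| <= `|g x|) ->
  (norm_L Omega p 1%E f <= norm_L Omega p 1%E g)%E.
Proof.
move=> mf mg fg; rewrite !norm_L1E// lee_wpmul2l ?lee_fin ?(ltW n0)//.
by apply: le_layer_norm_norm => //; exact: ltW.
Qed.

Lemma le_norm_Ly (P : \bar R) f g : measurable_fun Omega f -> measurable_fun Omega g ->
  (forall x, Omega x -> `|f x| <= `|g x|) ->
  (norm_L Omega P +oo%E f <= norm_L Omega P +oo%E g)%E.
Proof.
move=> mf mg fg; apply: ge_ereal_sup => _ [t t0 <-].
apply: (@le_trans _ _ ((t `^ (fine P)^-1)%:E * rearrangement mu Omega g t)%E); last first.
  by apply: ereal_sup_ubound; exists t.
rewrite lee_wpmul2l ?lee_fin ?powR_ge0//; apply: ereal_inf_le_tmp => _ [a [a0 ga] <-].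
exists a => //; split => //; apply: le_trans ga.
apply: le_measure; rewrite ?inE; [exact: (measurable_suplevel mO)|exact: (measurable_suplevel mO)|].
by move=> x [Ox ax]; split => //; exact: lt_le_trans ax (fg _ Ox).
Qed.

Lemma norm_L_coord_le_vnorm (P Q : \bar R) (F : 'rV[R]_n -> 'rV[R]_n) i :
  (P, Q) \in [:: (p, 1%E); (p', +oo%E)] ->
  (forall i, measurable_fun Omega (fun x => F x ord0 i)) ->
  (norm_L Omega P Q (fun x => F x ord0 i) <= vnorm_L Omega P Q F)%E.
Proof.
rewrite !inE => PQ mF; have mE := measurable_enorm mF.
have le x : Omega x -> `|F x ord0 i| <= `|enorm (F x)|.
  by move=> _; rewrite (ger0_norm (enorm_ge0 _)) coord_le_enorm.
case/orP: PQ => /eqP[-> ->]; [exact: le_norm_L1|exact: le_norm_Ly].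
Qed.

Lemma norm_W_le_vnorm (P Q : \bar R) u Du :
  (P, Q) \in [:: (p, 1%E); (p', +oo%E)] -> sobolev Omega P Q u Du ->
  (norm_W Omega P Q u Du <= norm_L Omega P Q u + n%:R%:E * vnorm_L Omega P Q Du)%E.
Proof.
move=> PQ [_ HD]; rewrite leeD2l//.
have mD i : measurable_fun Omega (fun x => Du x ord0 i) by have [_ []] := HD i.
have -> : n%:R%:E = (\sum_(i < n) 1%:E)%E :> \bar R by rewrite sumEFin sumr_const card_ord.
rewrite ge0_sume_distrl//; apply: lee_sum => i _; rewrite mul1e.
exact: norm_L_coord_le_vnorm.
Qed.

(** Reduces to real X and Y. An infinite X makes the right side infinite because e > 0; this
    disposes of the norm of the gradient without a separate proof that it is finite. *)
Lemma lee_affine e (C : R) (T X Y : \bar R) : 0 < e -> 0 <= C ->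
  (0 <= X)%E -> (0 <= Y)%E -> (Y < +oo)%E ->
  (forall x y, 0 <= x -> 0 <= y -> X = x%:E -> Y = y%:E -> (T <= (e * x + C * y)%:E)%E) ->
  (T <= e%:E * X + C%:E * Y)%E.
Proof.
move=> e0 C0; case: X => [x| |] //; case: Y => [y| |] //.
  by rewrite !lee_fin => x0 y0 _ H; rewrite -!EFinM -EFinD; exact: H.
by move=> _ y0 _ _; rewrite gt0_muley ?lte_fin// -EFinM addye// leey.
Qed.

Lemma pairing_bound s (A r : R) f w : 0 <= s -> 0 <= A -> measurable_fun Omega f ->
  measurable_fun Omega w -> avg_bounded mu Omega s A w -> (N s f <= r%:E)%E ->
  mu.-integrable Omega (EFin \o (fun x => f x * w x)) /\
  (`|\int[mu]_(x in Omega) (f x * w x)|%:E <= (A * r)%:E)%E.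
Proof.
move=> s0 A0 mf mw wA fr.
have H : (\int[mu]_(x in Omega) `|f x * w x|%:E <= (A * r)%:E)%E.
  under eq_integral do rewrite normrM.
  apply: (le_trans (avg_bounded_integral_layer mO s0 A0 mf mw wA)).
  by rewrite EFinM lee_wpmul2l.
have int : mu.-integrable Omega (EFin \o (fun x => f x * w x)).
  apply/integrableP; split; first by apply/measurable_EFinP; exact: measurable_funM.
  by apply: (le_lt_trans H); rewrite ltry.
by split => //; apply: le_trans H; exact: normr_Rintegral_le.
Qed.

Lemma vnorm_mul_le b eps : vlorentz Omega p 1%E b -> 0 < eps ->
  exists2 C : R, 0 <= C & forall u Du, sobolev Omega p 1%E u Du ->
  (vnorm_L Omega p 1 (fun x => u x *: b x) <=
   eps%:E * vnorm_L Omega p 1 Du + C%:E * norm_L Omega p 1 u)%E.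
Proof.
move=> [mb Nb] eps0; have [A A0 HA] := sobolev_sup_bounded.
have mcb := measurable_coords mb; have meb := measurable_enorm mcb.
have Nb' : (N i_n (fun x => enorm (b x)) < +oo)%E.
  exact: (le_lt_trans (layer_norm_le_norm_L meb) Nb).
have k0 : 0 < n%:R * (n%:R * (A + 1)) :> R by rewrite !mulr_gt0// ltr_wpDl.
(* One factor n relates the Lorentz norm to [layer_norm], the other bounds the n components of Du by
   its Euclidean norm; [A + 1] keeps the denominator positive. *)
pose e := eps / (n%:R * (n%:R * (A + 1))).
have e0 : 0 < e by rewrite divr_gt0.
have [M M0 HM] := layer_normM_split mO finO i0 (ltW i1) meb Nb' e0.
have C0 : 0 <= n%:R * e * A + M.
  apply: addr_ge0 (mulr_ge0 (mulr_ge0 (ltW n0) (ltW e0)) A0) M0.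
exists (n%:R * e * A + M) => //.
move=> u Du sob; have [[mu_ Nu] HD] := sob.
apply: lee_affine => //; [exact: norm_L_ge0|exact: norm_L_ge0|].
move=> x y x0 y0 Xx Yy.
have K0 : 0 <= y + n%:R * x by exact: (addr_ge0 y0 (mulr_ge0 (ltW n0) x0)).
have uK : avg_bounded mu Omega 1 (A * (y + n%:R * x)) u.
  apply: (HA _ _ _ sob); apply: (le_trans (norm_W_le_vnorm _ sob)).
    by rewrite inE eqxx.
  by rewrite Xx Yy -EFinM -EFinD.
have mub : measurable_fun Omega (fun x => enorm (u x *: b x)).
  apply: measurable_enorm => i; under eq_fun do rewrite mxE.
  exact: measurable_funM.
rewrite /vnorm_L norm_L1E//.
have NuE : N i_n u = (y / n%:R)%:E.
  move: Yy; rewrite norm_L1E// => Yy.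
  by rewrite mulrC EFinM -Yy muleA -EFinM mulVf ?gt_eqF// mul1e.
apply: (@le_trans _ _ (n%:R%:E * ((e * (A * (y + n%:R * x)))%:E + M%:E * N i_n u))%E).
  rewrite lee_wpmul2l ?lee_fin ?(ltW n0)//.
  apply: le_trans (HM _ _ (mulr_ge0 A0 K0) mu_ uK).
  apply: le_layer_norm_norm => //; [exact: measurable_funM|].
  by move=> z _; rewrite enormZ !normrM normr_id mulrC.
rewrite NuE -[X in (_ * (_ + X))%E]EFinM -EFinD -EFinM lee_fin.
have ee : e * (n%:R * (n%:R * (A + 1))) = eps by rewrite divfK// gt_eqF.
have nn : n%:R * (M * (y / n%:R)) = M * y.
  by rewrite mulrCA (mulrC y) mulVKf ?gt_eqF.
rewrite -ee mulrDr nn -subr_ge0.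
rewrite (_ : _ - _ = e * (n%:R * n%:R) * x); last by ring.
exact: (mulr_ge0 (mulr_ge0 (ltW e0) (mulr_ge0 (ltW n0) (ltW n0))) x0).
Qed.

(** The dual test functions w lie in W^{1,n/(n-1),oo}, hence are [avg_bounded] with exponent s, and
    it remains to bound the layer norm of c u with the same exponent. There u is bounded, so
    [layer_normM_split] applies to c. *)
Lemma norm_Wm1_mul_le c s eps : s <= 1 -> @embedding_exponent R n s -> i_n <= s ->
  measurable_fun Omega c -> (N s c < +oo)%E -> 0 < eps ->
  exists2 C : R, 0 <= C & forall u Du, sobolev Omega p 1%E u Du ->
  (norm_Wm1 Omega p 1 (fun x => c x * u x)%R <=
   eps%:E * vnorm_L Omega p 1 Du + C%:E * norm_L Omega p 1 u)%E.
Proof.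
move=> s1 hs is_ mc Nc eps0; have s0 : 0 < s := lt_le_trans i0 is_.
have [A A0 HA] := sobolev_sup_bounded.
have [B B0 HB] := sobolev_weak_sup_bounded s1 hs.
pose a := fine ((mu Omega) `^ (s - i_n))%E.
have a0 : 0 <= a by rewrite fine_ge0// poweR_ge0.
have AB0 : 0 <= A * B by exact: mulr_ge0.
have k0 : 0 < n%:R * (A * B + 1) by rewrite mulr_gt0// ltr_wpDl.
pose e := eps / (n%:R * (A * B + 1)).
have e0 : 0 < e by rewrite divr_gt0.
have [M M0 HM] := layer_normM_split mO finO s0 s1 mc Nc e0.
have C0 : 0 <= B * (e * A) + B * (M * a).
  apply: addr_ge0 (mulr_ge0 B0 (mulr_ge0 (ltW e0) A0)) (mulr_ge0 B0 (mulr_ge0 M0 a0)).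
exists (B * (e * A) + B * (M * a)) => //.
move=> u Du sob; have [[mu_ Nu] HD] := sob.
apply: lee_affine => //; [exact: norm_L_ge0|exact: norm_L_ge0|].
move=> x y x0 y0 Xx Yy.
have K0 : 0 <= y + n%:R * x by exact: (addr_ge0 y0 (mulr_ge0 (ltW n0) x0)).
have uK : avg_bounded mu Omega 1 (A * (y + n%:R * x)) u.
  apply: (HA _ _ _ sob); apply: (le_trans (norm_W_le_vnorm _ sob)).
    by rewrite inE eqxx.
  by rewrite Xx Yy -EFinM -EFinD.
have mcu : measurable_fun Omega (fun x => c x * u x) by exact: measurable_funM.
pose r := e * (A * (y + n%:R * x)) + M * (a * y).
have Ncu : (N s (fun x => c x * u x)%R <= r%:E)%E.
  apply: (le_trans (HM _ _ (mulr_ge0 A0 K0) mu_ uK)).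
  rewrite /r EFinD leeD2l// EFinM lee_wpmul2l ?lee_fin//.
  apply: (le_trans (le_layer_norm_exponent mO finO i0 is_ mu_)).
  rewrite EFinM /a fineK ?poweR_measure_fin// lee_wpmul2l ?poweR_ge0//.
  by rewrite -Yy; exact: (layer_norm_le_norm_L mu_).
have r0 : 0 <= r by rewrite -lee_fin; apply: le_trans Ncu; exact: layer_norm_ge0.
apply: (@le_trans _ _ (B * r)%:E); last first.
  have ee : e * (n%:R * (A * B + 1)) = eps by rewrite divfK// gt_eqF.
  rewrite lee_fin -ee -subr_ge0 /r (_ : _ - _ = e * n%:R * x); last by ring.
  exact: (mulr_ge0 (mulr_ge0 (ltW e0) (ltW n0)) x0).
apply: (norm_Wm1_le); first exact: mulr_ge0.
  apply: (layer_norm_integrable dO s0 s1 mcu).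
  by apply: (le_lt_trans Ncu); rewrite ltry.
move=> w Dw; rewrite hoelder_conjugate_dim hoelder_conjugate1 => -[sw _].
have kf : norm_W Omega p' +oo w Dw \is a fin_num.
  by rewrite ge0_fin_numE ?norm_W_ge0// sobolev_norm_W_lty.
have k0' : 0 <= fine (norm_W Omega p' +oo w Dw) by rewrite fine_ge0// norm_W_ge0.
have wB := HB w Dw _ sw (_ : (_ <= (fine (norm_W Omega p' +oo w Dw))%:E)%E).
have {}wB : avg_bounded mu Omega s (B * fine (norm_W Omega p' +oo w Dw)) w.
  by apply: wB; rewrite fineK.
have mw : measurable_fun Omega w by case: sw => -[].
have [] := pairing_bound (ltW s0) (mulr_ge0 B0 k0') mcu mw wB Ncu.
move=> int le; split => //; apply: (le_trans le).
by rewrite -[X in (_ <= _ * X)%E](fineK kf) -EFinM lee_fin mulrAC.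
Qed.

Lemma RintegralD_norm_le f g (a r : R) :
  mu.-integrable Omega (EFin \o f) /\ (`|\int[mu]_(x in Omega) f x|%:E <= a%:E)%E ->
  mu.-integrable Omega (EFin \o g) /\ (`|\int[mu]_(x in Omega) g x|%:E <= r%:E)%E ->
  mu.-integrable Omega (EFin \o (fun x => f x + g x)) /\
  (`|\int[mu]_(x in Omega) (f x + g x)|%:E <= (a + r)%:E)%E.
Proof.
move=> [fi fa] [gi ga]; split.
  rewrite (_ : _ \o _ = (EFin \o f) \+ (EFin \o g))%E//.
  exact: integrableD.
rewrite RintegralD// lee_fin; apply: (le_trans (ler_normD _ _)).
by rewrite lerD// -lee_fin.
Qed.

(** The roles are exchanged: now the test function w is bounded. The small part of c, times w, pairs
    with v through the weak embedding with exponent s; the bounded part pairs with v at exponent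
    1/n, which costs only the norm of v. *)
Lemma norm_Wm1_mul_weak_le c s eps : s <= 1 -> @embedding_exponent R n s -> i_n <= s ->
  measurable_fun Omega c -> (N s c < +oo)%E -> 0 < eps ->
  exists2 C : R, 0 <= C & forall v Dv, sobolev Omega p' +oo%E v Dv ->
  (norm_Wm1 Omega p' +oo (fun x => c x * v x)%R <=
   eps%:E * vnorm_L Omega p' +oo Dv + C%:E * norm_L Omega p' +oo v)%E.
Proof.
move=> s1 hs is_ mc Nc eps0; have s0 : 0 < s := lt_le_trans i0 is_.
have [A A0 HA] := sobolev_sup_bounded.
have [B B0 HB] := sobolev_weak_sup_bounded s1 hs.
have AB0 : 0 <= A * B by exact: mulr_ge0.
have k0 : 0 < n%:R * (A * B + 1) by rewrite mulr_gt0// ltr_wpDl.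
pose e := eps / (n%:R * (A * B + 1)).
have e0 : 0 < e by rewrite divr_gt0.
have [M M0 HM] := layer_norm_truncation mO finO s0 mc Nc e0.
have C0 : 0 <= B * A * e + n%:R * M.
  exact: (addr_ge0 (mulr_ge0 (mulr_ge0 B0 A0) (ltW e0)) (mulr_ge0 (ltW n0) (ltW M0))).
exists (B * A * e + n%:R * M) => //.
move=> v Dv sob; have [[mv Nv] HD] := sob.
apply: lee_affine => //; [exact: norm_L_ge0|exact: norm_L_ge0|].
move=> x y x0 y0 Xx Yy.
have K0 : 0 <= y + n%:R * x by exact: (addr_ge0 y0 (mulr_ge0 (ltW n0) x0)).
have vK : avg_bounded mu Omega s (B * (y + n%:R * x)) v.
  apply: (HB _ _ _ sob); apply: (le_trans (norm_W_le_vnorm _ sob)).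
    by rewrite !inE eqxx orbT.
  by rewrite Xx Yy -EFinM -EFinD.
have vy : avg_bounded mu Omega i_n (n%:R * y) v.
  by apply: norm_Ly_avg_bounded => //; rewrite Yy.
have BK0 := mulr_ge0 B0 K0.
pose m := B * (y + n%:R * x) * (A * e) + n%:R * y * M.
have ee : e * (n%:R * (A * B + 1)) = eps by rewrite divfK// gt_eqF.
apply: (@le_trans _ _ m%:E); last first.
  rewrite lee_fin -ee -subr_ge0 /m (_ : _ - _ = e * n%:R * x); last by ring.
  exact: (mulr_ge0 (mulr_ge0 (ltW e0) (ltW n0)) x0).
have fNc : N s c \is a fin_num by rewrite ge0_fin_numE// layer_norm_ge0.
apply: (norm_Wm1_le).
- exact: (addr_ge0 (mulr_ge0 BK0 (mulr_ge0 A0 (ltW e0))) (mulr_ge0 (mulr_ge0 (ltW n0) y0) (ltW M0))).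
- have [|//] := @pairing_bound s _ (fine (N s c)) c v (ltW s0) BK0 mc mv vK.
  by rewrite fineK.
move=> w Dw; rewrite hoelder_conjugate_dim' hoelder_conjugatey => -[sw _].
have kf : norm_W Omega p 1 w Dw \is a fin_num.
  by rewrite ge0_fin_numE ?norm_W_ge0// sobolev_norm_W_lty.
set k := fine (norm_W Omega p 1 w Dw).
have kE : norm_W Omega p 1 w Dw = k%:E by rewrite fineK.
have k0' : 0 <= k by rewrite fine_ge0// norm_W_ge0.
have wA : avg_bounded mu Omega 1 (A * k) w by apply: (HA _ _ _ sw); rewrite kE.
have mw : measurable_fun Omega w by case: sw => -[].
pose c1 x := if `|c x| <= M then 0 else c x; pose c2 x := if `|c x| <= M then c x else 0.
have mset : measurable_fun Omega (fun x => `|c x| <= M).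
  apply: measurable_fun_ler => //.
  exact: (measurableT_comp (@normr_measurable R setT) mc).
have mc1 : measurable_fun Omega c1 by apply: measurable_fun_if => //; apply: measurable_funS mc.
have mc2 : measurable_fun Omega c2 by apply: measurable_fun_if => //; apply: measurable_funS mc.
have -> : (fun x => c x * v x * w x) = (fun x => (c1 x * w x) * v x + (c2 x * w x) * v x).
  by apply/funext => z; rewrite /c1 /c2; case: ifP => _; ring.
have m1 : measurable_fun Omega (fun x => c1 x * w x) by exact: measurable_funM.
have m2 : measurable_fun Omega (fun x => c2 x * w x) by exact: measurable_funM.
rewrite kE -EFinM (_ : m * k = B * (y + n%:R * x) * (A * k * e) + n%:R * y * (M * k)); last first.
  by rewrite /m; ring.
have Ak0 := mulr_ge0 A0 k0'.
apply: RintegralD_norm_le.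
  apply: (pairing_bound (ltW s0) BK0 m1 mv vK).
  have Nc1 : (N s c1 < +oo)%E by apply: (lt_trans HM); rewrite ltry.
  apply: (le_trans (layer_normM_bounded mO finO s0 s1 Ak0 mc1 mw wA Nc1)).
  by rewrite (EFinM (A * k)) lee_wpmul2l ?lee_fin// ltW.
apply: (pairing_bound (ltW i0) (mulr_ge0 (ltW n0) y0) m2 mv vy).
apply: (le_trans (layer_normM_le mu mO i0 (ltW i1) M0 mw mc2 _)).
  by move=> z _; rewrite /c2; case: ifP => // _; rewrite normr0 ltW.
rewrite EFinM lee_wpmul2l ?lee_fin ?(ltW M0)//.
apply: (le_trans (layer_norm_le_norm_L mw)).
by rewrite -kE; exact: norm_L_le_W.
Qed.

Lemma layer_norm_le_near f g (k d : R) : measurable_fun Omega f -> measurable_fun Omega g ->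
  (N i_n f <= k%:E)%E -> (N i_n (fun x => f x - g x)%R <= d%:E)%E ->
  (N i_n g <= (2 * (k + d))%:E)%E.
Proof.
move=> mf mg fk fgd.
have mgf : measurable_fun Omega (fun x => g x - f x) by exact: measurable_funB.
have -> : g = (fun x => f x + (g x - f x)) by apply/funext => x; rewrite addrC subrK.
apply: (le_trans (layer_normD mu mO i0 (ltW i1) mf mgf)).
rewrite EFinM lee_wpmul2l// EFinD; apply: leeD => //; apply: le_trans fgd.
apply: le_layer_norm_norm => //; [exact: measurable_funB|].
by move=> x _; rewrite distrC.
Qed.

(* For a test function phi, the derivative falling on v is moved to g * phi by
   the definition of the weak derivative; density then gives every w. *)
Lemma smooth_drift_le g i : nice g -> exists2 C : R, 0 <= C &
  forall v Dv w Dw (y k : R), 0 <= y -> sobolev Omega p' +oo%E v Dv ->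
  (norm_L Omega p' +oo%E v <= y%:E)%E -> sobolev0 Omega p 1%E w Dw ->
  (norm_W Omega p 1%E w Dw <= k%:E)%E ->
  mu.-integrable Omega (EFin \o (fun x => (g x * w x) * Dv x ord0 i)) /\
  (`|\int[mu]_(x in Omega) ((g x * w x) * Dv x ord0 i)|%:E <= (C * y * k)%:E)%E.
Proof.
move=> ng; have [sg [M0 [M00 gM0 dgM0 _]]] := ng.
pose M := M0 + 1; have Mp : 0 < M by rewrite ltr_wpDl.
have gM x : `|g x| <= M by rewrite (le_trans (gM0 x))// lerDl.
have dgM x : `|partial i g x| <= M by rewrite (le_trans (dgM0 i x))// lerDl.
have mg : measurable_fun Omega g by exact: nice_measurable.
have mdg : measurable_fun Omega (partial i g).
  apply: measurable_funTS; apply: rV_continuous_measurable.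
  exact: smooth_continuous (smooth_partial i sg).
exists (8 * n%:R * M); first by rewrite !mulr_ge0// ltW.
move=> v Dv w Dw y k y0 [[mv Nv] HD] vy [sw dw] wk.
have [wDv [mDv NDv]] := HD i.
have fd : norm_L Omega p' +oo%E (fun x => Dv x ord0 i) \is a fin_num.
  by rewrite ge0_fin_numE ?norm_L_ge0.
set d := fine (norm_L Omega p' +oo%E (fun x => Dv x ord0 i)).
have d0 : 0 <= d by rewrite fine_ge0// norm_L_ge0.
have vA : avg_bounded mu Omega i_n (n%:R * y) v by exact: norm_Ly_avg_bounded.
have DA : avg_bounded mu Omega i_n (n%:R * d) (fun x => Dv x ord0 i).
  by apply: norm_Ly_avg_bounded => //; rewrite fineK.
have ny0 : 0 <= n%:R * y by rewrite mulr_ge0// ltW.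
have nd0 : 0 <= n%:R * d by rewrite mulr_ge0// ltW.
have mw : measurable_fun Omega w by case: sw => -[].
have mDw : measurable_fun Omega (fun x => Dw x ord0 i).
  by have [_ /(_ i)[_ []]] := sw.
have Nw : (N i_n w <= k%:E)%E.
  apply: (le_trans (layer_norm_le_norm_L mw)); apply: le_trans wk; exact: norm_L_le_W.
have NDw : (N i_n (fun x => Dw x ord0 i) <= k%:E)%E.
  apply: (le_trans (layer_norm_le_norm_L mDw)); apply: le_trans wk.
  exact: norm_L_partial_le_W.
(* w is replaced by a test function phi at distance below dl. The product with phi is integrated by
   parts; the product with w - phi is paired directly with Dv and costs d dl. The 8 is a factor 2
   from the quasi-triangle inequality times the two terms of the Leibniz rule, each at most 2M(k +
   dl). *)
have main dl : 0 < dl ->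
  mu.-integrable Omega (EFin \o (fun x => (g x * w x) * Dv x ord0 i)) /\
  (`|\int[mu]_(x in Omega) ((g x * w x) * Dv x ord0 i)|%:E <=
    (n%:R * y * (8 * M * (k + dl)) + n%:R * d * (M * dl))%:E)%E.
  move=> dl0; have [phi tphi wphi] := dw dl dl0.
  have mphi : measurable_fun Omega phi by exact: test_function_measurable tphi.
  have tdphi := test_function_partial i tphi.
  have mdphi : measurable_fun Omega (partial i phi) by exact: test_function_measurable tdphi.
  have mh : measurable_fun Omega (fun x => w x - phi x) by exact: measurable_funB.
  have mdh : measurable_fun Omega (fun x => Dw x ord0 i - partial i phi x).
    exact: measurable_funB.
  have Nh : (N i_n (fun x => w x - phi x)%R <= dl%:E)%E.
    apply: (le_trans (layer_norm_le_norm_L mh)); apply: le_trans (ltW wphi).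
    exact: norm_L_le_W.
  have Ndh : (N i_n (fun x => Dw x ord0 i - partial i phi x)%R <= dl%:E)%E.
    apply: (le_trans (layer_norm_le_norm_L mdh)); apply: le_trans (ltW wphi).
    have -> : (fun x => Dw x ord0 i - partial i phi x) =
              (fun x => (Dw x - gradient phi x) ord0 i).
      by apply/funext => x; rewrite !mxE.
    exact: norm_L_partial_le_W.
  have Nphi := layer_norm_le_near mw mphi Nw Nh.
  have Ndphi := layer_norm_le_near mDw mdphi NDw Ndh.
  have tgphi := test_functionM sg tphi.
  have [sphi _ _] := tphi.
  have -> : (fun x => g x * w x * Dv x ord0 i) =
    (fun x => g x * phi x * Dv x ord0 i + g x * (w x - phi x) * Dv x ord0 i).
    by apply/funext => x; ring.
  apply: (RintegralD_norm_le); last first.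
    apply: (pairing_bound (ltW i0) nd0) => //; first exact: measurable_funM.
    apply: (le_trans (layer_normM_le mu mO i0 (ltW i1) Mp mh mg (fun x _ => gM x))).
    by rewrite EFinM lee_wpmul2l// lee_fin ltW.
  have mgphi : measurable_fun Omega (fun x => g x * phi x) by exact: measurable_funM.
  have mgd : measurable_fun Omega (fun x => g x * partial i phi x) by exact: measurable_funM.
  have mdgphi : measurable_fun Omega (fun x => partial i g x * phi x) by exact: measurable_funM.
  have Ngphi : (N i_n (fun x => g x * phi x)%R <= (M * (2 * (k + dl)))%:E)%E.
    apply: (le_trans (layer_normM_le mu mO i0 (ltW i1) Mp mphi mg (fun x _ => gM x))).
    by rewrite EFinM lee_wpmul2l// lee_fin ltW.
  split.
    by have [] := pairing_bound (ltW i0) nd0 mgphi mDv DA Ngphi.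
  have -> : \int[mu]_(x in Omega) (g x * phi x * Dv x ord0 i) =
      - \int[mu]_(x in Omega) ((g x * partial i phi x + partial i g x * phi x) * v x).
    have [_ _ /(_ _ tgphi) H] := wDv.
    under eq_Rintegral do rewrite mulrC.
    rewrite -[LHS]opprK -H; congr (- _).
    apply: eq_Rintegral => x _; rewrite mulrC partialM//.
    - by rewrite /= (mulrC (phi x)).
    - by move=> z; exact: smooth_derivable.
    - by move=> z; exact: smooth_derivable.
  rewrite normrN.
  have msum : measurable_fun Omega (fun x => g x * partial i phi x + partial i g x * phi x).
    exact: measurable_funD.
  suff Nsum : (N i_n (fun x => g x * partial i phi x + partial i g x * phi x)%R <=
      (8 * M * (k + dl))%:E)%E.
    exact: (pairing_bound (ltW i0) ny0 msum mv vA Nsum).2.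
  apply: (le_trans (layer_normD mu mO i0 (ltW i1) mgd mdgphi)).
  have -> : 8 * M * (k + dl) = 2 * (M * (2 * (k + dl)) + M * (2 * (k + dl))) by ring.
  rewrite EFinM lee_wpmul2l// EFinD; apply: leeD.
    apply: (le_trans (layer_normM_le mu mO i0 (ltW i1) Mp mdphi mg (fun x _ => gM x))).
    by rewrite EFinM lee_wpmul2l// lee_fin ltW.
  apply: (le_trans (layer_normM_le mu mO i0 (ltW i1) Mp mphi mdg (fun x _ => dgM x))).
  by rewrite EFinM lee_wpmul2l// lee_fin ltW.
split; first exact: (main 1 ltr01).1.
(* The size d of Dv occurs only with the factor dl, so it disappears as dl tends to 0: the constant
   C sees v and not its gradient. *)
rewrite lee_fin; apply/ler_addgt0Pr => e e0.
pose q := n%:R * y * (8 * M) + n%:R * d * M.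
have q0 : 0 <= q by rewrite addr_ge0// mulr_ge0// ?mulr_ge0// ltW.
have q1 : 0 < q + 1 by rewrite ltr_wpDl.
have [_] := main (e / (q + 1)) (divr_gt0 e0 q1).
rewrite lee_fin => /le_trans; apply.
rewrite (_ : _ + _ = 8 * n%:R * M * y * k + q * (e / (q + 1))); last by rewrite /q; ring.
rewrite lerD2l mulrCA ger_pMr// ler_pdivrMr// mul1r lerDl//.
Qed.

(** Write f = (f - g) + g with g smooth. For the first part w is bounded by the embedding and Dv is
    paired with f - g, which is small; the second part is [smooth_drift_le]. *)
Lemma drift_component_le f i eps : measurable_fun Omega f -> (N i_n f < +oo)%E -> 0 < eps ->
  exists2 C : R, 0 <= C &
  forall v Dv w Dw (x y k : R), 0 <= x -> 0 <= y -> 0 <= k ->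
  sobolev Omega p' +oo%E v Dv -> (norm_L Omega p' +oo%E v <= y%:E)%E ->
  (norm_L Omega p' +oo%E (fun x => Dv x ord0 i) <= x%:E)%E ->
  sobolev0 Omega p 1%E w Dw -> (norm_W Omega p 1%E w Dw <= k%:E)%E ->
  mu.-integrable Omega (EFin \o (fun x => (f x * w x) * Dv x ord0 i)) /\
  (`|\int[mu]_(x in Omega) ((f x * w x) * Dv x ord0 i)|%:E <=
     ((eps * x + C * y) * k)%:E)%E.
Proof.
move=> mf Nf eps0; have [A A0 HA] := sobolev_sup_bounded.
have k0 : 0 < n%:R * (A + 1) by rewrite mulr_gt0// ltr_wpDl.
pose e := eps / (n%:R * (A + 1)).
have e0 : 0 < e by rewrite divr_gt0.
have [g ng Ng] := finite_layer_norm_approx mO finO i0 (ltW i1) mf Nf e0.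
have [C C0 HC] := smooth_drift_le i ng.
exists C => // v Dv w Dw x y k x0 y0 kk0 sv vy Dvx sw wk.
have mg : measurable_fun Omega g by exact: nice_measurable.
have mw : measurable_fun Omega w by case: sw => -[[]].
have mDv : measurable_fun Omega (fun x => Dv x ord0 i) by have [_ /(_ i)[_ []]] := sv.
have -> : (fun x => f x * w x * Dv x ord0 i) =
    (fun x => (f x - g x) * w x * Dv x ord0 i + g x * w x * Dv x ord0 i).
  by apply/funext => z; ring.
rewrite (mulrDl (eps * x)); apply: (RintegralD_norm_le); last exact: (HC v Dv w Dw).
have DA : avg_bounded mu Omega i_n (n%:R * x) (fun x => Dv x ord0 i).
  exact: norm_Ly_avg_bounded.
have wA : avg_bounded mu Omega 1 (A * k) w by apply: (HA _ _ _ sw.1).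
have mfg : measurable_fun Omega (fun x => f x - g x) by exact: measurable_funB.
have mfgw : measurable_fun Omega (fun x => (f x - g x) * w x) by exact: measurable_funM.
have Ak0 := mulr_ge0 A0 kk0; have nx0 := mulr_ge0 (ltW n0) x0.
have Nfgw : (N i_n (fun x => (f x - g x) * w x)%R <= (A * k * e)%:E)%E.
  have Nfg : (N i_n (fun x => f x - g x)%R < +oo)%E by rewrite (lt_trans Ng)// ltry.
  apply: (le_trans (layer_normM_bounded mO finO i0 (ltW i1) Ak0 mfg mw wA Nfg)).
  by rewrite (EFinM (A * k)) lee_wpmul2l ?lee_fin// ltW.
have [int le] := pairing_bound (ltW i0) nx0 mfgw mDv DA Nfgw.
split => //; apply: (le_trans le); rewrite lee_fin.
have ee : e * (n%:R * (A + 1)) = eps by rewrite divfK// gt_eqF.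
rewrite -ee -subr_ge0 (_ : _ - _ = e * n%:R * x * k); last by ring.
exact: (mulr_ge0 (mulr_ge0 (mulr_ge0 (ltW e0) (ltW n0)) x0) kk0).
Qed.

Lemma integrable_sum_real (F : 'I_n -> 'rV[R]_n -> R) :
  (forall i, mu.-integrable Omega (EFin \o F i)) ->
  mu.-integrable Omega (EFin \o (fun x => \sum_(i < n) F i x)).
Proof.
move=> iF; rewrite (_ : EFin \o _ = (fun x => \sum_(i < n) (EFin \o F i) x)%E).
  exact: integrable_sum.
by apply/funext => x /=; rewrite sumEFin.
Qed.

(** Each component is handled with eps/n, since every component of Dv is bounded by the Euclidean
    norm of Dv. *)
Lemma norm_Wm1_dotp_le b eps : vlorentz Omega p 1%E b -> 0 < eps ->
  exists2 C : R, 0 <= C & forall v Dv, sobolev Omega p' +oo%E v Dv ->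
  (norm_Wm1 Omega p' +oo (fun x => dotp (b x) (Dv x)) <=
   eps%:E * vnorm_L Omega p' +oo Dv + C%:E * norm_L Omega p' +oo v)%E.
Proof.
move=> [mb Nb] eps0; have mcb := measurable_coords mb.
have Ncb i : (N i_n (fun x => b x ord0 i) < +oo)%E.
  apply: le_lt_trans (layer_norm_le_norm_L (mcb i)) _.
  apply: le_lt_trans Nb; apply: norm_L_coord_le_vnorm => //.
  by rewrite inE eqxx.
have e0 : 0 < eps / n%:R by rewrite divr_gt0.
have /choice[C HC] : forall i, exists C : R, 0 <= C /\
  forall v Dv w Dw (x y k : R), 0 <= x -> 0 <= y -> 0 <= k ->
  sobolev Omega p' +oo%E v Dv -> (norm_L Omega p' +oo%E v <= y%:E)%E ->
  (norm_L Omega p' +oo%E (fun x => Dv x ord0 i) <= x%:E)%E ->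
  sobolev0 Omega p 1%E w Dw -> (norm_W Omega p 1%E w Dw <= k%:E)%E ->
  mu.-integrable Omega (EFin \o (fun x => (b x ord0 i * w x) * Dv x ord0 i)) /\
  (`|\int[mu]_(x in Omega) ((b x ord0 i * w x) * Dv x ord0 i)|%:E <=
     ((eps / n%:R * x + C * y) * k)%:E)%E.
  by move=> i; have [C C0 HC] := drift_component_le i (mcb i) (Ncb i) e0; exists C.
have C0 : 0 <= \sum_(i < n) C i by apply: sumr_ge0 => i _; have [] := HC i.
exists (\sum_(i < n) C i) => // v Dv sob; have [[mv Nv] HD] := sob.
apply: lee_affine => //; [exact: norm_L_ge0|exact: norm_L_ge0|].
move=> x y x0 y0 Xx Yy.
have mDv i : measurable_fun Omega (fun x => Dv x ord0 i) by have [_ []] := HD i.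
have Dx i : (norm_L Omega p' +oo%E (fun x => Dv x ord0 i) <= x%:E)%E.
  by rewrite -Xx; apply: norm_L_coord_le_vnorm => //; rewrite !inE eqxx orbT.
apply: (norm_Wm1_le).
- by rewrite addr_ge0// mulr_ge0// ltW.
- apply: integrable_sum_real => i.
  have DA : avg_bounded mu Omega i_n (n%:R * x) (fun x => Dv x ord0 i).
    exact: norm_Ly_avg_bounded.
  have fN : N i_n (fun x => b x ord0 i) \is a fin_num.
    by rewrite ge0_fin_numE// layer_norm_ge0.
  have bN : (N i_n (fun x => b x ord0 i) <= (fine (N i_n (fun x => b x ord0 i)))%:E)%E.
    by rewrite fineK.
  exact: (pairing_bound (ltW i0) (mulr_ge0 (ltW n0) x0) (mcb i) (mDv i) DA bN).1.
move=> w Dw; rewrite hoelder_conjugate_dim' hoelder_conjugatey => sw.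
have kf : norm_W Omega p 1 w Dw \is a fin_num.
  by rewrite ge0_fin_numE ?norm_W_ge0// sobolev_norm_W_lty//; case: sw.
set k := fine (norm_W Omega p 1 w Dw).
have kE : norm_W Omega p 1 w Dw = k%:E by rewrite fineK.
have k0 : 0 <= k by rewrite fine_ge0// norm_W_ge0.
have comp i : _ := (HC i).2 v Dv w Dw x y k x0 y0 k0 sob (_ : _ <= y%:E)%E (Dx i) sw (_ : _ <= k%:E)%E.
have {}comp i : mu.-integrable Omega (EFin \o (fun x => (b x ord0 i * w x) * Dv x ord0 i)) /\
  (`|\int[mu]_(x in Omega) ((b x ord0 i * w x) * Dv x ord0 i)|%:E <=
     ((eps / n%:R * x + C i * y) * k)%:E)%E.
  by apply: comp; rewrite ?Yy ?kE.
have -> : (fun x => dotp (b x) (Dv x) * w x) =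
    (fun x => \sum_(i < n) b x ord0 i * w x * Dv x ord0 i).
  by apply/funext => z; rewrite /dotp mulr_suml; apply: eq_bigr => i _; rewrite mulrAC.
split; first by apply: integrable_sum_real => i; exact: (comp i).1.
rewrite Rintegral_sum//; last by move=> i; exact: (comp i).1.
rewrite kE -EFinM lee_fin; apply: (le_trans (ler_norm_sum _ _ _)).
apply: (@le_trans _ _ (\sum_(i < n) (eps / n%:R * x + C i * y) * k)).
  by apply: ler_sum => i _; rewrite -lee_fin; exact: (comp i).2.
rewrite -mulr_suml big_split/= -!mulr_suml sumr_const card_ord -[_ *+ n]mulr_natr.
by rewrite mulfK// gt_eqF.
Qed.

End sobolev_lorentz_estimates.

(** * The exponent for c, and conclusion *)

Section weak_type.
Context d (T : measurableType d) (R : realType).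
Variables (mu : {sigma_finite_measure set T -> \bar R}) (D : set T).
Hypothesis mD : measurable D.

Lemma lebesgue_space_weak_type (s : R) (f : T -> R) : 0 < s ->
  lebesgue_space mu D s%:E f -> exists2 B : R, 0 <= B & forall a, 0 < a ->
  (mu (suplevel D f a) <= (B * a `^ (- s))%:E)%E.
Proof.
move=> s0 [mf Nf]; pose h := f \_ D.
have mh : measurable_fun setT h by exact/(measurable_restrictT _ mD).
pose F x : \bar R := (`|h x| `^ s)%:E.
have mF : measurable_fun setT F.
  apply/measurable_EFinP; apply: (@measurableT_comp _ _ _ _ _ _ (fun t : R => t `^ s)).
    exact: measurable_powR.
  exact: (measurableT_comp (@normr_measurable R setT) mh).
have F0 x : (0 <= F x)%E by rewrite lee_fin powR_ge0.
have IF : (\int[mu]_x F x < +oo)%E.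
  have -> : (\int[mu]_x F x = \int[mu]_x `|(EFin \o h) x| `^ s)%E by [].
  by rewrite -powR_Lnorm ?gt_eqF// poweR_lty.
have fI : (\int[mu]_x F x)%E \is a fin_num by rewrite ge0_fin_numE// integral_ge0.
exists (fine (\int[mu]_x F x)%E); first by rewrite fine_ge0// integral_ge0.
move=> a a0; have as0 : 0 < a `^ s by rewrite powR_gt0.
have mZ : measurable (suplevel D f a) by exact: measurable_suplevel.
have H : ((a `^ s)%:E * mu (suplevel D f a) <= \int[mu]_x F x)%E.
  rewrite -integral_cst//.
  apply: (@le_trans _ _ (\int[mu]_(x in suplevel D f a) F x)%E).
    apply: ge0_le_integral => //; first by move=> *; rewrite lee_fin ltW.
      exact: measurable_funTS.
    move=> x [Dx ax]; rewrite lee_fin /h patchE mem_set//.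
    by rewrite ge0_ler_powR// ?nnegrE ?(ltW a0) ?(ltW s0) ?(ltW ax).
  by apply: ge0_subset_integral.
rewrite powRN EFinM fineK//.
have -> : mu (suplevel D f a) = ((a `^ s)^-1%:E * ((a `^ s)%:E * mu (suplevel D f a)))%E.
  by rewrite muleA -EFinM mulVf ?gt_eqF// mul1e.
by rewrite muleC lee_wpmul2r// lee_fin invr_ge0 ltW.
Qed.

End weak_type.

(** For n > 2 the exponent 2/n is the one of L^{n/2,1}, up to a constant factor. For n = 2 that
    space only gives exponent 1, outside the range of the weak embedding; Chebyshev's inequality in
    L^s makes the level sets decay like a^(-s) with s > 1, which allows a smaller exponent. *)
Lemma lower_order_exponent (R : realType) (n : nat) (Omega : set 'rV[R]_n)
    (c : 'rV[R]_n -> R) : (2 <= n)%N -> bounded_lipschitz_domain Omega ->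
  lorentz (lebesgue_rV n) Omega (n%:R / 2)%:E 1%E c ->
  (exists2 s : R, 1 < s < 3 / 2 & lebesgue_space (lebesgue_rV n) Omega s%:E c) ->
  exists s : R, [/\ s <= 1, @embedding_exponent R n s, n%:R^-1 <= s &
    (layer_norm (lebesgue_rV n) Omega s c < +oo)%E].
Proof.
move=> n2 dO [mc Nc] [s /andP[s1 s32] Lc].
have mO := measurable_domain dO; have finO := domain_lty dO.
have n0 := @dim_gt0 R n n2.
have [n3|n3] := ltnP 2 n.
  exists (2 / n%:R); split.
  - by rewrite ler_pdivrMr// mul1r (ler_nat R 2 n).
  - by left.
  - by rewrite ler_peMl ?invr_ge0 ?(ltW n0)// ler1n.
  have h0 : 0 < n%:R / 2 :> R by rewrite divr_gt0.
  move: Nc; rewrite (lorentz_norm1E mO finO h0 mc) invf_div => Nc.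
  by rewrite ltey; apply/eqP => E; move: Nc; rewrite E gt0_muley ?lte_fin// ltxx.
have {}n3 : n = 2 by apply/eqP; rewrite eqn_leq n3.
have s0 : 0 < s by rewrite (lt_trans ltr01).
have is1 : s^-1 < 1 by rewrite invf_lt1.
have is2 : 2^-1 <= s^-1.
  by rewrite lef_pV2 ?posrE//; apply: ltW; apply: (lt_trans s32); lra.
have t0 : 2^-1 <= (s^-1 + 1) / 2 by lra.
(* The midpoint of 1/s and 1: it is below 1 for the embedding, and its product with s is (1 + s)/2 >
   1, as [layer_norm_decay] requires. *)
exists ((s^-1 + 1) / 2); split => //.
- by lra.
- by right; split => //; rewrite t0/=; lra.
- by rewrite n3.
have [B B0 HB] := lebesgue_space_weak_type mO s0 Lc.
apply: (layer_norm_decay mO finO _ _ B0 mc HB); first by lra.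
by rewrite mulrA mulrDr mulfV ?gt_eqF// mulr1; lra.
Qed.

Theorem lemma3p4 (R : realType) (n : nat) (hn : (2 <= n)%N)
  (Omega : set 'rV[R]_n) (hOmega : bounded_lipschitz_domain Omega)
  (b : 'rV[R]_n -> 'rV[R]_n) (c : 'rV[R]_n -> R)
  (hb : vlorentz Omega n%:R%:E 1%E b)
  (hc : lorentz (lebesgue_rV n) Omega (n%:R / 2)%:E 1%E c)
  (hs : exists2 s : R, 1 < s < 3 / 2 &
        lebesgue_space (lebesgue_rV n) Omega s%:E c) :
  forall eps : R, 0 < eps -> exists C : R,
    (forall u Du, sobolev Omega n%:R%:E 1%E u Du ->
      (vnorm_L Omega n%:R%:E 1 (fun x => u x *: b x) +
       norm_Wm1 Omega n%:R%:E 1 (fun x => (c x * u x)%R)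
       <= eps%:E * vnorm_L Omega n%:R%:E 1 Du +
          C%:E * norm_L Omega n%:R%:E 1 u)%E) /\
    (forall v Dv, sobolev Omega (n%:R / (n%:R - 1))%:E +oo%E v Dv ->
      (norm_Wm1 Omega (n%:R / (n%:R - 1))%:E +oo (fun x => dotp (b x) (Dv x)) +
       norm_Wm1 Omega (n%:R / (n%:R - 1))%:E +oo (fun x => (c x * v x)%R)
       <= eps%:E * vnorm_L Omega (n%:R / (n%:R - 1))%:E +oo Dv +
          C%:E * norm_L Omega (n%:R / (n%:R - 1))%:E +oo v)%E).
Proof.
move=> eps eps0; have e2 : 0 < eps / 2 by rewrite divr_gt0.
have mO := measurable_domain hOmega.
have [s [s1 es ns Ncs]] := lower_order_exponent hn hOmega hc hs.
have mc : measurable_fun Omega c by case: hc.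
have [C1 C10 H1] := vnorm_mul_le hn hOmega hb e2.
have [C2 C20 H2] := norm_Wm1_mul_le hn hOmega s1 es ns mc Ncs e2.
have [C3 C30 H3] := norm_Wm1_dotp_le hn hOmega hb e2.
have [C4 C40 H4] := norm_Wm1_mul_weak_le hn hOmega s1 es ns mc Ncs e2.
(* Each of the two inequalities adds two estimates obtained with eps/2; enlarging the constant of
   the lower order term allows the same C in both. *)
have split_eps (X Y P Q : \bar R) (C C' C'' : R) : 0 <= C -> 0 <= C' -> C + C' <= C'' ->
    (0 <= X -> 0 <= Y -> P <= (eps / 2)%:E * X + C%:E * Y ->
     Q <= (eps / 2)%:E * X + C'%:E * Y -> P + Q <= eps%:E * X + C''%:E * Y)%E.
  move=> C0 C'0 CC X0 Y0 PX QX; apply: (le_trans (leeD PX QX)).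
  rewrite addeACA -!ge0_muleDl ?lee_fin ?(ltW e2)// -!EFinD -splitr leeD2l//.
  by rewrite lee_wpmul2r// lee_fin.
exists (C1 + C2 + (C3 + C4)); split.
  move=> u Du sob; apply: split_eps (H1 _ _ sob) (H2 _ _ sob) => //.
  - by rewrite lerDl addr_ge0.
  - exact: norm_L_ge0.
  - exact: norm_L_ge0.
move=> v Dv sob; apply: split_eps (H3 _ _ sob) (H4 _ _ sob) => //.
- by rewrite lerDr addr_ge0.
- exact: norm_L_ge0.
- exact: norm_L_ge0.
Qed.
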